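(* Let $(b_N)_N$ be a sequence of integers with $0\le b_N\le N-1$ and $b_N\to\infty$ as $N\to\infty$, and let $w_N:=\min(N,2b_N+1)$. Let $(\xi_i)_{i\in\mathbb{N}}$ be an exchangeable sequence of real-valued random variables on $(\Omega,\mathcal{F},\mathbb{P})$ with finite moments of all orders, let $V$ be its limiting empirical variance, and let $(F_N)_N$ and $(F_N^{\mathrm{per}})_N$ be, respectively, a strict and a periodic de Finetti band ensemble with half-widths $b_N$ whose entries are drawn from $(\xi_i)_i$. Let $\sigma_\mu$ be the deterministic probability measure on $\mathbb{R}$ defined by $\int f\,d\sigma_\mu=\mathbb{E}\big(\int f\,d\sigma_{V(\omega)}\big)$ for all bounded continuous $f:\mathbb{R}\to\mathbb{R}$. Then: (1) the empirical eigenvalue measures $\mu_N^\omega$ of $F_N^{\mathrm{per}}/\sqrt{w_N}$ converge weakly in expectation to $\sigma_\mu$; (2) if in addition $\frac{b_N}{N}$ converges either to $0$ or to $1$ as $N\to\infty$, then the empirical eigenvalue measures $\mu_N^\omega$ of $F_N/\sqrt{w_N}$ converge weakly in expectation to $\sigma_\mu$.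
   Context: An infinite sequence $(\xi_i)_{i\in\mathbb{N}}$ of real random variables is exchangeable if for every $n$ and every permutation $\pi$ of $\{1,\dots,n\}$ the vectors $(\xi_1,\dots,\xi_n)$ and $(\xi_{\pi(1)},\dots,\xi_{\pi(n)})$ have the same distribution. The limiting empirical variance $V$ of such a sequence is the $\mathbb{P}$-almost sure limit (which exists) of $V_n:=\frac1n\sum_{i=1}^n\xi_i^2-\big(\frac1n\sum_{i=1}^n\xi_i\big)^2$ as $n\to\infty$. De Finetti band ensembles with half-widths $b_N$: real symmetric random $N\times N$ matrices $F_N$ (strict) resp. $F_N^{\mathrm{per}}$ (periodic) such that the $(i,j)$ entry is zero whenever $|i-j|>b_N$ (strict) resp. $|i-j|_N>b_N$ (periodic), where $|i|_N:=\min(|i|,N-|i|)$ for $|i|\le N$; for each $N$ the remaining entries with $1\le i\le j\le N$, say $L_N$ many, are filled, in some order and each variable used exactly once, by the first $L_N$ members $\xi_1,\dots,\xi_{L_N}$ of the fixed exchangeable sequence; the entries below the diagonal are determined by symmetry. The eigenvalue distribution measure (empirical eigenvalue measure) of a real symmetric $N\times N$ matrix with eigenvalues $\lambda_1\le\dots\le\lambda_N$ (with multiplicity) is $\frac1N\sum_{j=1}^N\delta_{\lambda_j}$. For $v>0$, $\sigma_v$ is the probability measure on $\mathbb{R}$ with Lebesgue density $\frac{1}{2\pi v}\sqrt{(4v-x^2)_+}$, where $g_+=\max(g,0)$; $\sigma_0:=\delta_0$. Random probability measures $\mu_N^\omega$ converge to $\mu^\omega$ weakly in expectation if $\mathbb{E}(\int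 f\,d\mu_N^\omega)\to\mathbb{E}(\int f\,d\mu^\omega)$ as $N\to\infty$ for every bounded continuous $f:\mathbb{R}\to\mathbb{R}$. *)

(* Defs.v *)
(* MathComp / MathComp-Analysis. *)
From HB Require Import structures.
From mathcomp Require Import all_boot all_order all_algebra all_fingroup.
From mathcomp Require Import all_classical all_reals all_analysis.
From mathcomp Require Import measurable_realfun lebesgue_integral.
Set Implicit Arguments.
Unset Strict Implicit.
Unset Printing Implicit Defensive.
Import Order.TTheory GRing.Theory Num.Theory.
Import numFieldNormedType.Exports.
Local Open Scope classical_set_scope.
Local Open Scope ring_scope.

Section exchangeable_sequences.
Context {d : measure_display} {T : measurableType d} {R : realType}.
Variables (P : probability T R) (xi : nat -> {RV P >-> R}).

(* The sequence is indexed from 0, so that its first n members are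
   xi 0, ..., xi n.-1. *)
Definition exchangeable : Prop :=
  forall (n : nat) (s : 'S_n) (B : set (n.-tuple (measurableTypeR R))),
    measurable B ->
    P [set w | B [tuple xi i w | i < n]] =
    P [set w | B [tuple xi (s i) w | i < n]].

Definition finite_moments : Prop :=
  forall i k : nat, ('E_P[fun w => (`|xi i w| ^+ k)%R] < +oo)%E.

Definition empirical_variance (n : nat) (w : T) : R :=
  n%:R^-1 * (\sum_(i < n) xi i w ^+ 2) - (n%:R^-1 * \sum_(i < n) xi i w) ^+ 2.

(* For an exchangeable sequence the limit exists almost surely; [limn] takes a
   default value on the exceptional null set. *)
Definition limiting_variance (w : T) : R :=
  limn (fun n => empirical_variance n w).

End exchangeable_sequences.

Section band_ensembles.
Context {d : measure_display} {T : measurableType d} {R : realType}.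

Definition strict_dist (N i j : nat) : nat := `|i%:Z - j%:Z|%N.

Definition periodic_dist (N i j : nat) : nat :=
  minn (strict_dist N i j) (N - strict_dist N i j).

(* The free positions: those on or above the diagonal inside the band. *)
Definition band (dist : nat -> nat -> nat -> nat) (N b : nat) :
    {set 'I_N * 'I_N} :=
  [set p : 'I_N * 'I_N | (p.1 <= p.2)%N && (dist N p.1 p.2 <= b)%N]%SET.

(* [e] is the order in which the free positions are filled: it enumerates them
   as 0, ..., L_N - 1, each number being used exactly once. *)
Definition de_finetti_band (dist : nat -> nat -> nat -> nat) (P : probability T R)
    (xi : nat -> {RV P >-> R}) (b N : nat) (F : T -> 'M[R]_N) : Prop :=
  [/\ forall w, (F w)^T = F w,
      forall w (i j : 'I_N), (b < dist N i j)%N -> F w i j = 0 &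
      exists e : 'I_N * 'I_N -> nat,
        perm_eq [seq e p | p in band dist N b] (iota 0 #|band dist N b|) /\
        forall w p, p \in band dist N b -> F w p.1 p.2 = xi (e p) w].

Definition band_width (b N : nat) : nat := minn N (2 * b + 1).

End band_ensembles.

Section spectral_measures.
Context {R : realType}.

(* The eigenvalues, with multiplicity, in nondecreasing order; they exist
   whenever A is symmetric, and the list is then unique. *)
Definition eigenvalues (N : nat) (A : 'M[R]_N) : seq R :=
  xget [::] [set s : seq R | sorted <=%R s /\
                             char_poly A = \prod_(z <- s) ('X - z%:P)].

Definition eigenvalue_measure (N : nat) (A : 'M[R]_N) :
    {measure set (measurableTypeR R) -> \bar R} :=
  mscale (N%:R^-1)%:nng
    (msum (fun j => dirac ((eigenvalues A)`_j : measurableTypeR R)) N).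

Definition semicircle_pdf (v x : R) : R :=
  (2 * pi * v)^-1 * Num.sqrt (Num.max (4 * v - x ^+ 2) 0).

Definition semicircle_ac (v : R) (A : set (measurableTypeR R)) : \bar R :=
  (\int[lebesgue_measure]_(x in A) (semicircle_pdf v x)%:E)%E.

Lemma semicircle_pdf_ge0 (v x : R) : 0 <= semicircle_pdf v x.
Proof.
rewrite /semicircle_pdf; have [v0|v0] := leP 0 v.
  by rewrite mulr_ge0 ?invr_ge0 ?mulr_ge0 ?pi_ge0.
rewrite max_r ?sqrtr0 ?mulr0// subr_le0 (@le_trans _ _ 0) ?sqr_ge0//.
by rewrite mulr_ge0_le0// ltW.
Qed.

Lemma measurable_semicircle_pdf (v : R) :
  measurable_fun [set: measurableTypeR R] (semicircle_pdf v).
Proof.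
apply: measurable_funM; first exact: measurable_cst.
apply: (measurableT_comp (continuous_measurable_fun (@sqrt_continuous R))).
apply: measurable_maxr; last exact: measurable_cst.
by apply: measurable_funB; [exact: measurable_cst|exact: measurable_funX].
Qed.

Section semicircle_ac_measure.
Variable v : R.

Let semicircle_ac0 : semicircle_ac v set0 = 0%E.
Proof. by rewrite /semicircle_ac integral_set0. Qed.

Let semicircle_ac_ge0 A : (0 <= semicircle_ac v A)%E.
Proof. by apply: integral_ge0 => x _; rewrite lee_fin semicircle_pdf_ge0. Qed.

Let semicircle_ac_sigma_additive : semi_sigma_additive (semicircle_ac v).
Proof.
move=> F mF tF mUF; rewrite /semicircle_ac; apply: cvg_toP.
  apply: ereal_nondecreasing_is_cvgn => m n mn.
  apply: lee_sum_nneg_natr => // k _ _.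
  by apply: integral_ge0 => x _; rewrite lee_fin semicircle_pdf_ge0.
rewrite ge0_integral_bigcup//=.
- apply: measurable_funTS; apply: measurableT_comp => //.
  exact: measurable_semicircle_pdf.
- by move=> x _; rewrite lee_fin semicircle_pdf_ge0.
Qed.

HB.instance Definition _ := isMeasure.Build _ _ _ (semicircle_ac v)
  semicircle_ac0 semicircle_ac_ge0 semicircle_ac_sigma_additive.

End semicircle_ac_measure.

(* The value at v < 0 is irrelevant, a limiting variance being nonnegative. *)
Definition semicircle (v : R) : {measure set (measurableTypeR R) -> \bar R} :=
  if 0 < v then (semicircle_ac v : {measure set _ -> \bar R})
  else (dirac (0 : measurableTypeR R) : {measure set _ -> \bar R}).

End spectral_measures.

Section weak_convergence.
Context {d : measure_display} {T : measurableType d} {R : realType}.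

Definition cvg_weakly_in_expectation (P : probability T R)
    (mu_ : nat -> T -> {measure set (measurableTypeR R) -> \bar R})
    (mu : T -> {measure set (measurableTypeR R) -> \bar R}) : Prop :=
  forall f : R -> R, continuous f -> bounded_fun f ->
    'E_P[fun w => (\int[mu_ N w]_x f x)%R]%E @[N --> \oo] -->
    'E_P[fun w => (\int[mu w]_x f x)%R]%E.

End weak_convergence.

(* Main.v *)
Require Import Defs.
From HB Require Import structures.
From mathcomp Require Import all_boot all_order all_algebra all_fingroup.
From mathcomp Require Import all_classical all_reals all_analysis.
From mathcomp Require Import measurable_realfun lebesgue_integral.
From mathcomp Require Import complex spectral ring lra zify.

Set Implicit Arguments.
Unset Strict Implicit.
Unset Printing Implicit Defensive.
Import Order.TTheory GRing.Theory Num.Theory.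
Import numFieldNormedType.Exports.
Import Normc.
Local Open Scope classical_set_scope.
Local Open Scope ring_scope.

(** Why the theorem holds. By exchangeability the first [L] variables are
    distributed like [L] draws without replacement from the first [M] ones. For
    [M] much larger than [L^2] these may be replaced by independent uniform draws,
    so that, given the urn [x] formed by the first [M] variables, the free entries
    of the matrix are independent with a common law, whose variance is the
    empirical variance [V_M] of the urn ([exchangeable_urn]). It suffices to show
    that the mean eigenvalue distribution of a band matrix filled from an urn is
    close to the semicircle law [sigma_v] of the urn variance [v], uniformly over
    all urns with bounded fourth moment ([urn_semicircle]). Then [M] tends to
    infinity: [V_M] converges almost surely to [V], and [sigma_v] depends
    continuously on [v] ([exchangeable_pattern_close]).

    The law for urns is proved with the resolvent [G = (X - i eta)^-1] at a fixed
    large [eta]. Integration by parts in one entry at a time ([stein_entry]) gives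
    a Schwinger--Dyson equation ([schwinger_dyson]): with [s_i = E G_ii] and [g_i]
    the average of [G_jj] over the neighbours [j] of [i], the quantity
    [i eta s_i + 1 + v E (G_ii g_i)] is small. Testing the same equation against
    [g_k - E g_k] shows that all covariances between [G_ii] and [g_k] are small,
    since for [4 v <= eta^2] the equation bounds the largest of them by a fraction
    of itself ([cov_le]). The equation then closes; it is a contraction, and the
    [s_i] are on average close to its constant solution, the Stieltjes transform
    of [sigma_v], provided that the rows have [w] neighbours up to a small total
    deficit ([mean_resolvent_close]).

    The draws need not be centred. Their mean perturbs the matrix by a multiple of
    the indicator of the band, which is not small in norm; but its rows change
    slowly, so it is close to a matrix of low rank, and the trace of the
    resolvent hardly moves ([trace_resolvent_shift]). Traces of resolvents are
    integrals of [1 / (x^2 + s)] and [x / (x^2 + s)] against the eigenvalue measure,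
    and by a density argument in the style of Stone and Weierstrass these functions
    for large [s] determine weak convergence ([resolvent_density]). The same
    argument shows that [sigma_v] is weakly continuous in [v], from the explicit
    values of the two integrals.

    Almost sure convergence of [V_M] is a strong law for sequences with constant
    second moments and covariances, proved along fourth powers ([strong_law]).
    Finally, a periodic band has exactly [w] free positions in each row, while in
    a strict band the missing corners are negligible when [b / N] tends to [0],
    and so they are when it tends to [1], because the band then fills the whole
    matrix. *)

(** * Resolvents of real symmetric matrices on the imaginary axis *)

Ltac nonneg := do ?rewrite (addr_ge0, mulr_ge0, exprn_ge0, invr_ge0)//.

Section complex_norm.
Context {R : rcfType}.
Implicit Types z : R[i].

Lemma normc_ge0 z : 0 <= normc z.
Proof. by case: z => a b; exact: sqrtr_ge0. Qed.

Lemma normc_real (x : R) : normc x%:C%C = `|x|.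
Proof. by rewrite /= expr0n addr0 sqrtr_sqr. Qed.

Lemma normc_sum (I : Type) (r : seq I) (Q : pred I) (f : I -> R[i]) :
  normc (\sum_(i <- r | Q i) f i) <= \sum_(i <- r | Q i) normc (f i).
Proof.
elim/big_ind2 : _ => [|x a y b xa yb|//]; first by rewrite normc0.
by rewrite (le_trans (le_normcD _ _))// lerD.
Qed.

Lemma normc_conj z : normc (conjc z) = normc z.
Proof. by case: z => a b /=; rewrite sqrrN. Qed.

Lemma sqr_normcE z : (normc z ^+ 2)%:C%C = z * conjc z.
Proof.
case: z => a b /=; rewrite sqr_sqrtr ?addr_ge0 ?sqr_ge0//.
by apply/eqP; rewrite eq_complex /=; apply/andP; split; apply/eqP; ring.
Qed.

Lemma normcB z1 z2 : normc (z1 - z2) <= normc z1 + normc z2.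
Proof. by rewrite (le_trans (le_normcD _ _))// normcN. Qed.

End complex_norm.

Section resolvent.
Context {R : rcfType} (N : nat) (eta : R).
Implicit Types (X Y : 'M[R]_N) (u : 'rV[R[i]]_N).

Definition toC : 'M[R]_N -> 'M[R[i]]_N := map_mx (real_complex R).

Definition shifted X : 'M[R[i]]_N := toC X - (0 +i* eta)%C%:M.

Definition resolvent X : 'M[R[i]]_N := invmx (shifted X).

Definition vnorm2 u : R := \sum_j normc (u ord0 j) ^+ 2.

Lemma vnorm2_ge0 u : 0 <= vnorm2 u.
Proof. by apply: sumr_ge0 => j _; exact: sqr_ge0. Qed.

Lemma vnorm2E u : (vnorm2 u)%:C%C = (u *m (map_mx conjc u)^T) ord0 ord0.
Proof.
rewrite /vnorm2 rmorph_sum mxE; apply: eq_bigr => j _.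
by rewrite !mxE -sqr_normcE.
Qed.

Lemma vnorm2_delta i : vnorm2 (delta_mx ord0 i) = 1.
Proof.
rewrite /vnorm2 (bigD1 i)//= big1 => [|j ji].
  by rewrite mxE !eqxx normc1 expr1n addr0.
by rewrite mxE eqxx (negbTE ji) normc0 expr0n.
Qed.

(** The cross terms [u X u^*] cancel because [X] is real symmetric and the shift
    purely imaginary. Invertibility of [X - i eta] and every bound on the
    resolvent come from this identity. *)
Lemma vnorm2_shifted X u : X^T = X ->
  vnorm2 (u *m shifted X) = vnorm2 (u *m toC X) + eta ^+ 2 * vnorm2 u.
Proof.
move=> Xs; apply: (@complexI R); rewrite rmorphD rmorphM /= !vnorm2E.
set U := map_mx conjc u; set Z := toC X.
have cZ : (map_mx conjc Z)^T = Z.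
  apply/matrixP => i j; rewrite !mxE conjc_real.
  by rewrite -[X in RHS]Xs mxE.
rewrite !map_mxM !trmx_mul cZ /shifted -/Z.
have -> : (map_mx conjc (Z - (0 +i* eta)%C%:M))^T = Z + (0 +i* eta)%C%:M.
  rewrite map_mxB linearB /= cZ map_scalar_mx tr_scalar_mx; congr (_ + _).
  apply/matrixP => i j; rewrite !mxE; case: (i == j); rewrite ?mulr1n ?mulr0n ?oppr0//.
  by apply/eqP; rewrite eq_complex /= oppr0 opprK !eqxx.
have -> : u *m (Z - (0 +i* eta)%C%:M) *m ((Z + (0 +i* eta)%C%:M) *m U^T) =
    u *m Z *m (Z *m U^T) + ((eta ^+ 2)%:C%C)%:M *m (u *m U^T).
  set c := (0 +i* eta)%C.
  have -> : (eta ^+ 2)%:C%C = - (c * c) :> R[i].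
    by apply/eqP; rewrite eq_complex /=; apply/andP; split; apply/eqP; ring.
  rewrite mulmxBr mulmxDl mul_mx_scalar !mul_scalar_mx.
  rewrite mulmxDl.
  rewrite !mulmxDr !mulNmx.
  rewrite !mul_scalar_mx -!scalemxAl -!scalemxAr !mulmxA scalerA scaleNr.
  by rewrite addrA addrK.
by rewrite mxE mul_scalar_mx [in X in _ + X]mxE.
Qed.

Hypothesis eta_gt0 : 0 < eta.

Lemma shifted_unit X : X^T = X -> shifted X \in unitmx.
Proof.
move=> Xs; rewrite -row_free_unit; apply: inj_row_free => v v0.
have := vnorm2_shifted v Xs; rewrite v0.
have -> : vnorm2 (0 : 'rV[R[i]]_N) = 0.
  by rewrite /vnorm2 big1// => j _; rewrite mxE normc0 expr0n.
move/esym/eqP; rewrite paddr_eq0; [|exact: vnorm2_ge0|by rewrite mulr_ge0 ?vnorm2_ge0 ?sqr_ge0].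
case/andP => _; rewrite mulf_eq0 sqrf_eq0 (gt_eqF eta_gt0)/= => /eqP v20.
apply/rowP => j; rewrite mxE; apply: eq0_normc; apply/eqP; rewrite -sqrf_eq0.
apply/eqP; move: v20; rewrite /vnorm2 => /eqP; rewrite psumr_eq0; last first.
  by move=> *; exact: sqr_ge0.
by move/allP => /(_ j); rewrite mem_index_enum => /(_ isT)/eqP.
Qed.

Lemma vnorm2_resolvent X u : X^T = X ->
  vnorm2 (u *m resolvent X) <= (eta ^-1) ^+ 2 * vnorm2 u.
Proof.
move=> Xs; have := vnorm2_shifted (u *m resolvent X) Xs.
rewrite mulmxKV ?shifted_unit// => ->.
rewrite exprVn mulrDr mulrA mulVf ?mul1r ?lerDr; last by rewrite expf_eq0 gt_eqF.
by rewrite mulr_ge0 ?vnorm2_ge0// invr_ge0 sqr_ge0.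
Qed.

(** Bounding the entries one by one would lose a factor [N]. *)
Lemma resolvent_row X i : X^T = X ->
  \sum_j normc (resolvent X i j) ^+ 2 <= (eta ^-1) ^+ 2.
Proof.
move=> Xs; have := vnorm2_resolvent (delta_mx ord0 i) Xs.
rewrite vnorm2_delta mulr1; apply: le_trans; rewrite le_eqVlt; apply/orP; left.
by apply/eqP; apply: eq_bigr => j _; rewrite -rowE mxE.
Qed.

Lemma resolvent_entry X i j : X^T = X -> normc (resolvent X i j) <= eta^-1.
Proof.
move=> Xs; rewrite -(ler_pXn2r (ltn0Sn 1)) ?nnegrE ?normc_ge0 ?invr_ge0 ?(ltW eta_gt0)//.
apply: le_trans (resolvent_row i Xs); rewrite (bigD1 j)//= lerDl.
by apply: sumr_ge0 => k _; exact: sqr_ge0.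
Qed.

Lemma resolvent_tr X : X^T = X -> (resolvent X)^T = resolvent X.
Proof.
move=> Xs; rewrite /resolvent trmx_inv; congr invmx.
by rewrite /shifted linearB /= tr_scalar_mx /toC map_trmx Xs.
Qed.

Lemma resolvent_sym X i j : X^T = X -> resolvent X i j = resolvent X j i.
Proof. by move=> Xs; rewrite -{1}(resolvent_tr Xs) mxE. Qed.

Lemma resolventB X Y : X^T = X -> Y^T = Y ->
  resolvent Y = resolvent X - resolvent X *m toC (Y - X) *m resolvent Y.
Proof.
move=> Xs Ys; have uX := shifted_unit Xs; have uY := shifted_unit Ys.
have -> : toC (Y - X) = shifted Y - shifted X.
  by rewrite /shifted /toC map_mxB opprB addrA subrK.
rewrite mulmxBr mulmxBl -[resolvent X *m shifted Y *m _]mulmxA mulmxV// mulmx1.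
by rewrite mulVmx// mul1mx opprB addrC subrK.
Qed.

Lemma mul_resolvent X : X^T = X ->
  toC X *m resolvent X = 1%:M + (0 +i* eta)%C *: resolvent X.
Proof.
move=> Xs; rewrite -(mulmxV (shifted_unit Xs)) {2}/shifted mulmxBl mul_scalar_mx.
by rewrite subrK.
Qed.

End resolvent.

(** * Averages over samples from a finite urn *)

(** Expectation for the uniform distribution; locked, so that rewriting does not
    look inside sums over all samples. *)
HB.lock Definition avg {K : numFieldType} {T : finType} (f : T -> K) : K :=
  #|T|%:R^-1 * \sum_t f t.
Canonical avg_unlockable := Unlockable avg.unlock.

Section average.
Context {K : numFieldType} {T : finType}.
Implicit Types f g : T -> K.

Lemma avgD f g : avg (fun t => f t + g t) = avg f + avg g.
Proof. by rewrite unlock big_split mulrDr. Qed.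

Lemma avgZ (c : K) f : avg (fun t => c * f t) = c * avg f.
Proof. by rewrite unlock -mulr_sumr mulrCA. Qed.

Lemma avgN f : avg (fun t => - f t) = - avg f.
Proof. by rewrite unlock sumrN mulrN. Qed.

Lemma avgB f g : avg (fun t => f t - g t) = avg f - avg g.
Proof. by rewrite avgD avgN. Qed.

Lemma eq_avg f g : f =1 g -> avg f = avg g.
Proof. by move=> fg; rewrite unlock (eq_bigr g). Qed.

Lemma avg_sum (I : Type) (r : seq I) (Q : pred I) (F : I -> T -> K) :
  avg (fun t => \sum_(i <- r | Q i) F i t) = \sum_(i <- r | Q i) avg (F i).
Proof. by rewrite unlock exchange_big mulr_sumr. Qed.

Lemma avg_le f g : (forall t, f t <= g t) -> avg f <= avg g.
Proof. by move=> fg; rewrite unlock ler_wpM2l ?invr_ge0// ler_sum. Qed.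

Lemma avg_ge0 f : (forall t, 0 <= f t) -> 0 <= avg f.
Proof. by move=> f0; rewrite unlock mulr_ge0 ?invr_ge0 ?sumr_ge0. Qed.

Hypothesis T_gt0 : (0 < #|T|)%N.

Lemma avg_cst (c : K) : avg (fun _ : T => c) = c.
Proof.
by rewrite unlock sumr_const -[c *+ _]mulr_natl mulKf// pnatr_eq0 -lt0n.
Qed.

End average.

Lemma normc_avg (R : rcfType) (T : finType) (f : T -> R[i]) :
  normc (avg f) <= avg (fun t => normc (f t)).
Proof.
rewrite unlock normcM normcV.
have -> : normc (#|T|%:R : R[i]) = #|T|%:R.
  by rewrite -(rmorph_nat (real_complex R)) /= expr0n addr0 sqrtr_sqr ger0_norm.
by rewrite ler_wpM2l ?invr_ge0// normc_sum.
Qed.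

Lemma real_complex_avg (R : rcfType) (T : finType) (f : T -> R) :
  (avg f)%:C%C = avg (fun t => (f t)%:C%C).
Proof. by rewrite unlock rmorphM/= fmorphV rmorph_nat rmorph_sum. Qed.

Lemma conjc_avg (R : rcfType) (T : finType) (f : T -> R[i]) :
  conjc (avg f) = avg (fun t => conjc (f t)).
Proof. by rewrite unlock rmorphM fmorphV rmorph_nat rmorph_sum. Qed.

Section urn_sampling.
Context {K : numFieldType} {M L : nat}.
Implicit Types (phi : {ffun 'I_L -> 'I_M}) (l : 'I_L) (a : 'I_M).

(** Resampling the draw number [l]. *)
Definition upd phi l a : {ffun 'I_L -> 'I_M} :=
  [ffun k => if k == l then a else phi k].

Hypothesis M_gt0 : (0 < M)%N.

Lemma card_samples : (0 < #|{ffun 'I_L -> 'I_M}|)%N.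
Proof. by rewrite card_ffun card_ord expn_gt0 M_gt0. Qed.

(** Redrawing one coordinate does not change the law of the sample; the
    involution [(phi, a) |-> (upd phi l a, phi l)] exchanges the old and the
    new draw. *)
Lemma avg_upd l (f : {ffun 'I_L -> 'I_M} -> K) :
  avg (fun phi => avg (fun a => f (upd phi l a))) = avg f.
Proof.
rewrite unlock; congr (_ * _); rewrite -mulr_sumr pair_big /=.
pose h (p : {ffun 'I_L -> 'I_M} * 'I_M) := (upd p.1 l p.2, p.1 l).
have hK : involutive h.
  move=> [phi a]; rewrite /h /=; congr pair.
    by apply/ffunP => k; rewrite !ffunE; case: eqP => // ->.
  by rewrite ffunE eqxx.
rewrite (reindex_inj (inv_inj hK)) /=.
rewrite (eq_bigr (fun p => f p.1)); last first.
  move=> [phi a] _ /=; congr f; apply/ffunP => k; rewrite !ffunE.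
  by case: eqP => // ->.
rewrite -(pair_big xpredT xpredT (fun phi (a : 'I_M) => f phi)) /=.
rewrite exchange_big /= sumr_const -[X in _ * X]mulr_natl mulKf//.
by rewrite pnatr_eq0 -lt0n card_ord.
Qed.

(** Distinct draws are independent. *)
Lemma avg_indep l (t : 'I_M -> K) (Q : {ffun 'I_L -> 'I_M} -> K) :
  (forall phi a, Q (upd phi l a) = Q phi) ->
  avg (fun phi => t (phi l) * Q phi) = avg t * avg Q.
Proof.
move=> Ql; rewrite -(avg_upd l) -avgZ; apply: eq_avg => phi.
under eq_avg do rewrite ffunE eqxx Ql.
by rewrite mulrC -avgZ; apply: eq_avg => a; rewrite mulrC.
Qed.

End urn_sampling.

(** * The self-consistent equation for an urn band matrix *)

Lemma mulmx_toC_entry (R : rcfType) (N : nat) (A B : 'M[R[i]]_N) (Z : 'M[R]_N)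
    (k l : 'I_N) :
  (A *m toC Z *m B) k l = \sum_i \sum_j A k i * (Z i j)%:C%C * B j l.
Proof.
rewrite mxE exchange_big /=; apply: eq_bigr => j _; rewrite mxE mulr_suml.
by apply: eq_bigr => i _; rewrite mxE.
Qed.

Section band_urn_matrix.
Context {R : rcfType} {N M L : nat}.
Variables (D : rel 'I_N) (e : 'I_N -> 'I_N -> 'I_L) (tau : 'I_M -> R) (eta : R).
Implicit Types (phi : {ffun 'I_L -> 'I_M}) (i j k l : 'I_N).

Definition urn_matrix phi : 'M[R]_N :=
  \matrix_(i, j) if D i j then tau (phi (e i j)) else 0.

(** Erasing the entries that carry the same draw as [(i, j)] makes the resolvent
    independent of that draw. *)
Definition urn_matrix0 i j phi : 'M[R]_N :=
  \matrix_(k, l) if D k l && (e k l != e i j) then tau (phi (e k l)) else 0.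

Local Notation G phi := (resolvent eta (urn_matrix phi)).
Local Notation G0 i j phi := (resolvent eta (urn_matrix0 i j phi)).
Local Notation y := (eta^-1).

Hypotheses (eta_gt0 : 0 < eta) (M_gt0 : (0 < M)%N).
Hypothesis Dsym : forall i j, D i j = D j i.
Hypothesis esym : forall i j, e i j = e j i.
Hypothesis einj : forall i j k l, D i j -> D k l -> e k l = e i j ->
  ((k == i) && (l == j)) || ((k == j) && (l == i)).

Let y_ge0 : 0 <= y. Proof. by rewrite invr_ge0 ltW. Qed.

Lemma urn_matrix_tr phi : (urn_matrix phi)^T = urn_matrix phi.
Proof. by apply/matrixP => i j; rewrite !mxE Dsym esym. Qed.

Lemma urn_matrix0_tr i j phi : (urn_matrix0 i j phi)^T = urn_matrix0 i j phi.
Proof. by apply/matrixP => k l; rewrite !mxE Dsym (esym l k). Qed.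

Lemma urn_matrix0_upd i j phi a :
  urn_matrix0 i j (upd phi (e i j) a) = urn_matrix0 i j phi.
Proof.
by apply/matrixP => k l; rewrite !mxE ffunE; case: eqP => //; rewrite andbF.
Qed.

Let Xs := urn_matrix_tr.
Let X0s := urn_matrix0_tr.

Section one_entry.
Variables (i j : 'I_N) (Dij : D i j) (ij : i != j).
Local Notation t phi := (tau (phi (e i j))).

Lemma urn_resolvent_expand phi k l :
  G phi k l = G0 i j phi k l - (t phi)%:C%C *
    (G0 i j phi k i * G phi j l + G0 i j phi k j * G phi i l).
Proof.
rewrite {1}(resolventB eta_gt0 (X0s i j phi) (Xs phi)) mxE; congr (_ + _).
rewrite mxE; congr (- _); rewrite mulmx_toC_entry.
have dX a b : (urn_matrix phi - urn_matrix0 i j phi) a b =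
    ((a == i) && (b == j) || (a == j) && (b == i))%:R * t phi.
  rewrite !mxE; case Dab : (D a b) => /=; last first.
    rewrite subr0; case: (boolP (_ || _)); last by rewrite mul0r.
    by case/orP => /andP[/eqP ha /eqP hb]; move: Dab; rewrite ha hb ?(Dsym j i) Dij.
  have [eab|eab] := eqVneq (e a b) (e i j); rewrite /=.
    by rewrite (einj Dij Dab eab) mul1r eab subr0.
  rewrite subrr; case: (boolP (_ || _)); last by rewrite mul0r.
  by case/orP => /andP[/eqP ha /eqP hb]; move: eab; rewrite ha hb ?(esym j i) eqxx.
under eq_bigr do under eq_bigr do rewrite dX.
rewrite (bigD1 i)//= (bigD1 j)//= [\sum_(i0 < N | i0 != j) _]big1; last first.
  by move=> b bj; rewrite eqxx (negbTE bj) (negbTE ij) /= mul0r mulr0 mul0r.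
rewrite (bigD1 j) 1?eq_sym//= (bigD1 i)//= [\sum_(i0 < N | i0 != i) _]big1; last first.
  by move=> b bi; rewrite (eq_sym j i) (negbTE ij) eqxx (negbTE bi) /= mul0r mulr0 mul0r.
rewrite [\sum_(i0 < N | _) _]big1; last first.
  move=> a /andP[ai aj]; rewrite big1// => b _.
  by rewrite (negbTE ai) (negbTE aj) mul0r mulr0 mul0r.
by rewrite !eqxx orbT !mul1r !addr0; ring.
Qed.

Lemma urn_resolventB phi k l :
  normc (G phi k l - G0 i j phi k l) <= `|t phi| * (2 * y ^+ 2).
Proof.
rewrite urn_resolvent_expand addrAC subrr add0r normcN normcM normc_real.
rewrite ler_wpM2l// (le_trans (le_normcD _ _))// !normcM mulr_natl mulr2n expr2.
by rewrite lerD// ler_pM ?normc_ge0// resolvent_entry.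
Qed.

(** Summed over all [k], the diagonal moves by only twice the size of the entry:
    both factors are rows of resolvents, whose Euclidean norm is bounded. *)
Lemma urn_resolvent_diagB phi (S : pred 'I_N) :
  \sum_(k | S k) normc (G phi k k - G0 i j phi k k) <= `|t phi| * (2 * y ^+ 2).
Proof.
apply: (@le_trans _ _ (\sum_k `|t phi| * (normc (G0 i j phi k i) * normc (G phi j k)
    + normc (G0 i j phi k j) * normc (G phi i k)))).
  rewrite big_mkcond /=; apply: ler_sum => k _; case: ifP => _; last first.
    by rewrite mulr_ge0// addr_ge0// mulr_ge0 ?normc_ge0.
  rewrite urn_resolvent_expand addrAC subrr add0r normcN normcM normc_real.
  by rewrite ler_wpM2l// (le_trans (le_normcD _ _))// !normcM.
rewrite -mulr_sumr ler_wpM2l// big_split /= mulr_natl mulr2n.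
have cs (a b : 'I_N) :
    \sum_k normc (G0 i j phi k a) * normc (G phi b k) <= y ^+ 2.
  apply: (@le_trans _ _ (\sum_k (normc (G0 i j phi a k) ^+ 2 + normc (G phi b k) ^+ 2) / 2)).
    apply: ler_sum => k _; rewrite (resolvent_sym _ k a (X0s i j phi)).
    by have := sqr_ge0 (normc (G0 i j phi a k) - normc (G phi b k)); nra.
  rewrite -mulr_suml big_split /= ler_pdivrMr// mulr_natr mulr2n.
  by rewrite lerD// resolvent_row.
by rewrite lerD.
Qed.

Variables (H H0 : {ffun 'I_L -> 'I_M} -> R[i]) (h c : R).
Hypotheses (H_le : forall phi, normc (H phi) <= h)
  (H0_le : forall phi, normc (H0 phi) <= h)
  (HB : forall phi, normc (H phi - H0 phi) <= `|t phi| * c)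
  (H0_upd : forall phi a, H0 (upd phi (e i j) a) = H0 phi)
  (tau_centred : avg tau = 0).

Let h_ge0 : 0 <= h.
Proof.
case: (pickP [pred phi : {ffun 'I_L -> 'I_M} | true]) => [phi _|no].
  exact: le_trans (normc_ge0 _) (H_le phi).
by have := card_samples (L := L) M_gt0; rewrite (eq_card0 no).
Qed.

Let avg_abs : avg (fun phi => `|t phi|) = avg (fun a => `|tau a|).
Proof.
rewrite -[RHS]mulr1 -[X in _ * X](avg_cst (card_samples (L := L) M_gt0) 1).
by rewrite -(avg_indep M_gt0 (l := e i j))//; apply: eq_avg => phi; rewrite mulr1.
Qed.

Let avg_sqr_abs q : avg (fun phi => `|t phi| ^+ q) = avg (fun a => `|tau a| ^+ q).
Proof.
rewrite -[RHS]mulr1 -[X in _ * X](avg_cst (card_samples (L := L) M_gt0) 1).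
rewrite -(avg_indep M_gt0 (l := e i j) (fun a => `|tau a| ^+ q))//.
by apply: eq_avg => phi; rewrite mulr1.
Qed.

(** One step of Stein's method: for a centred entry [t] independent of the
    erased matrix, [E (t G_ij H)] is to leading order [E t^2] times the
    derivative [- (G_ii G_jj + G_ij^2)] of the resolvent entry. *)
Lemma stein_entry :
  normc (avg (fun phi => (t phi)%:C%C * G phi i j * H phi)
    + (avg (fun a => tau a ^+ 2))%:C%C *
      avg (fun phi => (G phi i i * G phi j j + G phi i j ^+ 2) * H phi))
  <= avg (fun a => `|tau a| ^+ 3) * (4 * h * y ^+ 3)
     + avg (fun a => tau a ^+ 2) * (c * y)
     + avg (fun a => tau a ^+ 2) * avg (fun a => `|tau a|) *
       (8 * h * y ^+ 3 + 2 * c * y ^+ 2).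
Proof.
pose P phi := G phi i i * G phi j j + G phi i j ^+ 2.
pose P0 phi := G0 i j phi i i * G0 i j phi j j + G0 i j phi i j ^+ 2.
pose rho phi := - (t phi)%:C%C *
  (G0 i j phi i i * (G phi j j - G0 i j phi j j)
   + G0 i j phi i j * (G phi i j - G0 i j phi i j)).
have GE phi : G phi i j = G0 i j phi i j - (t phi)%:C%C * P0 phi + rho phi.
  by rewrite {1}urn_resolvent_expand /rho /P0; ring.
have G0_upd phi a : G0 i j (upd phi (e i j) a) = G0 i j phi.
  by rewrite urn_matrix0_upd.
have P0_upd phi a : P0 (upd phi (e i j) a) = P0 phi by rewrite /P0 !G0_upd.
have absE q (x : R) : ~~ odd q -> `|x| ^+ q = x ^+ q by move=> oq; rewrite -normrX ger0_norm// exprn_even_ge0.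
have yG phi k l : normc (G phi k l) <= y by exact: resolvent_entry.
have yG0 phi k l : normc (G0 i j phi k l) <= y by exact: resolvent_entry.
have dG phi k l := urn_resolventB phi k l.
have rho_le phi : normc (rho phi) <= `|t phi| ^+ 2 * (4 * y ^+ 3).
  rewrite normcM normcN normc_real.
  rewrite [leRHS](_ : _ = `|t phi| * (`|t phi| * (4 * y ^+ 3))); last by ring.
  rewrite ler_wpM2l// (le_trans (le_normcD _ _))// !normcM.
  rewrite [leRHS](_ : _ = y * (`|t phi| * (2 * y ^+ 2)) + y * (`|t phi| * (2 * y ^+ 2))); last by ring.
  by rewrite lerD// ler_pM ?normc_ge0.
have PB phi : normc (P phi - P0 phi) <= `|t phi| * (8 * y ^+ 3).
  have -> : P phi - P0 phi = (G phi i i - G0 i j phi i i) * G phi j j +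
     G0 i j phi i i * (G phi j j - G0 i j phi j j) +
     ((G phi i j - G0 i j phi i j) * G phi i j + G0 i j phi i j * (G phi i j - G0 i j phi i j)).
    by rewrite /P /P0; ring.
  rewrite [leRHS](_ : _ = (`|t phi| * (2 * y ^+ 2)) * y + y * (`|t phi| * (2 * y ^+ 2)) +
    ((`|t phi| * (2 * y ^+ 2)) * y + y * (`|t phi| * (2 * y ^+ 2)))); last by ring.
  rewrite (le_trans (le_normcD _ _))// lerD// (le_trans (le_normcD _ _))// !normcM.
    by rewrite lerD// ler_pM ?normc_ge0.
  by rewrite lerD// ler_pM ?normc_ge0.
have P0_le phi : normc (P0 phi) <= 2 * y ^+ 2.
  rewrite (le_trans (le_normcD _ _))// expr2 !normcM mulr_natl mulr2n expr2.
  by rewrite lerD// ler_pM ?normc_ge0.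
have -> : avg (fun phi => (t phi)%:C%C * G phi i j * H phi)
    + (avg (fun a => tau a ^+ 2))%:C%C * avg (fun phi => P phi * H phi) =
    avg (fun phi => (t phi)%:C%C * rho phi * H0 phi)
    + avg (fun phi => (t phi)%:C%C * G phi i j * (H phi - H0 phi))
    + (avg (fun a => tau a ^+ 2))%:C%C * avg (fun phi => P phi * H phi - P0 phi * H0 phi).
  have e1 : avg (fun phi => (t phi)%:C%C * G phi i j * H phi) =
     avg (fun phi => (t phi)%:C%C * (G0 i j phi i j * H0 phi))
     - avg (fun phi => (t phi ^+ 2)%:C%C * (P0 phi * H0 phi))
     + avg (fun phi => (t phi)%:C%C * rho phi * H0 phi)
     + avg (fun phi => (t phi)%:C%C * G phi i j * (H phi - H0 phi)).
    rewrite -avgB -!avgD; apply: eq_avg => phi.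
    by rewrite [in LHS]GE [in RHS]GE rmorphXn /=; ring.
  rewrite e1.
  rewrite (avg_indep M_gt0 (l := e i j) (fun a => (tau a)%:C%C)); last first.
    by move=> phi a; rewrite G0_upd H0_upd.
  rewrite (avg_indep M_gt0 (l := e i j) (fun a => (tau a ^+ 2)%:C%C)); last first.
    by move=> phi a; rewrite P0_upd H0_upd.
  by rewrite -!real_complex_avg tau_centred avgB; ring.
have t2_ge0 : 0 <= avg (fun a => tau a ^+ 2) by apply: avg_ge0 => a; exact: sqr_ge0.
rewrite (le_trans (le_normcD _ _))// lerD//.
  rewrite (le_trans (le_normcD _ _))// lerD//.
    rewrite (le_trans (normc_avg _))// -(avg_sqr_abs 3) mulrC -avgZ avg_le// => phi.
    rewrite 2!normcM normc_real.
    rewrite [leRHS](_ : _ = `|t phi| * (`|t phi| ^+ 2 * (4 * y ^+ 3)) * h); last by ring.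
    by rewrite ler_pM ?mulr_ge0 ?normc_ge0 ?ler_wpM2l.
  rewrite (le_trans (normc_avg _))//.
  rewrite (_ : avg (fun a => tau a ^+ 2) = avg (fun a => `|tau a| ^+ 2)); last first.
    by apply: eq_avg => a; rewrite absE.
  rewrite -(avg_sqr_abs 2) mulrC -avgZ avg_le// => phi.
  rewrite !normcM normc_real.
  rewrite [leRHS](_ : _ = `|t phi| * y * (`|t phi| * c)); last by ring.
  by rewrite ler_pM ?mulr_ge0 ?normc_ge0 ?ler_wpM2l.
rewrite normcM normc_real (ger0_norm t2_ge0) -mulrA ler_wpM2l//.
rewrite (le_trans (normc_avg _))// -avg_abs mulrC -avgZ avg_le// => phi.
have -> : P phi * H phi - P0 phi * H0 phi =
   (P phi - P0 phi) * H phi + P0 phi * (H phi - H0 phi) by ring.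
rewrite (le_trans (le_normcD _ _))// !normcM.
rewrite [leRHS](_ : _ = (`|t phi| * (8 * y ^+ 3)) * h + (2 * y ^+ 2) * (`|t phi| * c)); last by ring.
by rewrite lerD// ler_pM ?normc_ge0.
Qed.

End one_entry.

Hypothesis tau_centred : avg tau = 0.

Variable w : R.
Hypotheses (w_gt0 : 0 < w)
  (deg_le : forall i, (#|[pred j | D i j]|)%:R <= w).

Local Notation tau1 := (avg (fun a => `|tau a|)).
Local Notation tau2 := (avg (fun a => tau a ^+ 2)).
Local Notation tau3 := (avg (fun a => `|tau a| ^+ 3)).

(** The total error of Stein's method over the at most [w] entries of a row; the
    last two terms pay for the diagonal entry and for the [G_ij^2]. *)
Definition urn_error (h c : R) : R :=
  w * (tau3 * (4 * h * y ^+ 3) + tau2 * (c * y)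
     + tau2 * tau1 * (8 * h * y ^+ 3 + 2 * c * y ^+ 2))
  + 2 * tau2 * h * y ^+ 2 + tau1 * h * y.

Let tau1_ge0 : 0 <= tau1. Proof. exact: avg_ge0. Qed.
Let tau2_ge0 : 0 <= tau2. Proof. by apply: avg_ge0 => a; exact: sqr_ge0. Qed.
Let tau3_ge0 : 0 <= tau3. Proof. by apply: avg_ge0 => a; exact: exprn_ge0. Qed.

Let avg_abs (l : 'I_L) : avg (fun phi : {ffun 'I_L -> 'I_M} => `|tau (phi l)|) = tau1.
Proof.
rewrite -[RHS]mulr1 -[X in _ * X](avg_cst (card_samples (L := L) M_gt0) 1).
by rewrite -(avg_indep M_gt0 (l := l))//; apply: eq_avg => phi; rewrite mulr1.
Qed.

(** The Schwinger--Dyson equation for a diagonal resolvent entry tested against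
    [H]: expand [X G = 1 + i eta G] along row [i] and apply Stein's method to
    every entry of that row. *)
Lemma schwinger_dyson (i : 'I_N) (H : {ffun 'I_L -> 'I_M} -> R[i])
    (H0 : 'I_N -> {ffun 'I_L -> 'I_M} -> R[i]) (h c : R) :
  0 <= c ->
  (forall phi, normc (H phi) <= h) ->
  (forall j phi, normc (H0 j phi) <= h) ->
  (forall j, D i j -> i != j -> forall phi,
    normc (H phi - H0 j phi) <= `|tau (phi (e i j))| * c) ->
  (forall j phi a, H0 j (upd phi (e i j) a) = H0 j phi) ->
  normc ((0 +i* eta)%C * avg (fun phi => G phi i i * H phi) + avg H
    + (tau2)%:C%C * avg (fun phi => G phi i i * (\sum_(j | D i j) G phi j j) * H phi))
  <= urn_error h c.
Proof.
move=> c_ge0 Hh H0h HB Hupd.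
have h_ge0 : 0 <= h.
  case: (pickP [pred phi : {ffun 'I_L -> 'I_M} | true]) => [phi _|no].
    exact: le_trans (normc_ge0 _) (Hh phi).
  by have := card_samples (L := L) M_gt0; rewrite (eq_card0 no).
have yG phi k l : normc (G phi k l) <= y by exact: resolvent_entry.
pose P j phi := G phi i i * G phi j j + G phi i j ^+ 2.
pose A j := avg (fun phi => (tau (phi (e i j)))%:C%C * G phi i j * H phi)
    + (tau2)%:C%C * avg (fun phi => P j phi * H phi).
pose B := (tau2)%:C%C * avg (fun phi => (\sum_(j | D i j && (i != j)) G phi i j ^+ 2) * H phi).
pose Z1 := \sum_(j | D i j && (i == j)) avg (fun phi => (tau (phi (e i j)))%:C%C * G phi i j * H phi).
pose Z2 := \sum_(j | D i j && (i == j)) (tau2)%:C%C * avg (fun phi => G phi i i * G phi j j * H phi).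
have -> : (0 +i* eta)%C * avg (fun phi => G phi i i * H phi) + avg H
    + (tau2)%:C%C * avg (fun phi => G phi i i * (\sum_(j | D i j) G phi j j) * H phi)
  = (\sum_(j | D i j && (i != j)) A j) - B + Z1 + Z2.
  have -> : (0 +i* eta)%C * avg (fun phi => G phi i i * H phi) + avg H =
    \sum_(j | D i j) avg (fun phi => (tau (phi (e i j)))%:C%C * G phi i j * H phi).
    rewrite -avgZ -avgD -avg_sum; apply: eq_avg => phi.
    have /matrixP/(_ i i) := mul_resolvent eta_gt0 (Xs phi).
    rewrite !mxE eqxx mulr1n => GE.
    rewrite -mulr_suml.
    have -> : \sum_(j | D i j) (tau (phi (e i j)))%:C%C * G phi i j =
       \sum_j toC (urn_matrix phi) i j * G phi j i.
      rewrite big_mkcond /=; apply: eq_bigr => j _; rewrite !mxE.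
      rewrite (resolvent_sym _ j i (Xs phi)).
      by case: ifP => // _; rewrite mul0r.
    by rewrite GE mulrDl mul1r addrC mulrA.
  have -> : (tau2)%:C%C * avg (fun phi => G phi i i * (\sum_(j | D i j) G phi j j) * H phi) =
     \sum_(j | D i j) (tau2)%:C%C * avg (fun phi => G phi i i * G phi j j * H phi).
    rewrite -mulr_sumr -avg_sum; congr (_ * _); apply: eq_avg => phi.
    by rewrite -mulr_suml -mulr_sumr.
  have -> : B = \sum_(j | D i j && (i != j)) (tau2)%:C%C * avg (fun phi => G phi i j ^+ 2 * H phi).
    rewrite -mulr_sumr -avg_sum; congr (_ * _); apply: eq_avg => phi.
    by rewrite -mulr_suml.
  rewrite (bigID (fun j => i == j)) /= [X in _ + X](bigID (fun j => i == j)) /=.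
  rewrite -/Z1 -/Z2 -sumrB.
  rewrite [\sum_(j | _ && _) (A j - _)](eq_bigr (fun j =>
    avg (fun phi => (tau (phi (e i j)))%:C%C * G phi i j * H phi) +
    (tau2)%:C%C * avg (fun phi => G phi i i * G phi j j * H phi))); last first.
    move=> j _; rewrite /A.
    have -> : avg (fun phi => P j phi * H phi) =
        avg (fun phi => G phi i i * G phi j j * H phi) + avg (fun phi => G phi i j ^+ 2 * H phi).
      by rewrite -avgD; apply: eq_avg => phi; rewrite /P mulrDl.
    by ring.
  by rewrite big_split /=; ring.
have AN j : D i j && (i != j) -> normc (A j) <= tau3 * (4 * h * y ^+ 3) + tau2 * (c * y)
     + tau2 * tau1 * (8 * h * y ^+ 3 + 2 * c * y ^+ 2).
  move=> /andP[Dij ij].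
  by apply: (stein_entry Dij ij Hh (H0h j) (HB j Dij ij)).
pose E := tau3 * (4 * h * y ^+ 3) + tau2 * (c * y)
     + tau2 * tau1 * (8 * h * y ^+ 3 + 2 * c * y ^+ 2).
rewrite -/E in AN.
have E_ge0 : 0 <= E.
  by rewrite /E; nonneg.
have B_le : normc B <= tau2 * h * y ^+ 2.
  rewrite normcM normc_real ger0_norm// -mulrA ler_wpM2l//.
  rewrite (le_trans (normc_avg _))// -[leRHS](avg_cst (card_samples (L := L) M_gt0)).
  apply: avg_le => phi; rewrite normcM mulrC ler_pM ?normc_ge0//.
  rewrite (le_trans (normc_sum _ _ _))//.
  apply: le_trans (resolvent_row eta_gt0 i (Xs phi)).
  rewrite [leLHS]big_mkcond /=; apply: ler_sum => j _; case: ifP => _.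
    by rewrite !expr2 normcM.
  exact: sqr_ge0.
have one_le (f : 'I_N -> R[i]) (x : R) : 0 <= x -> normc (f i) <= x ->
    normc (\sum_(j | D i j && (i == j)) f j) <= x.
  move=> x0 fx; have [Dii|Dii] := boolP (D i i).
    rewrite (bigD1 i) ?Dii ?eqxx//= big1 ?addr0// => j /andP[/andP[_ /eqP <-]].
    by rewrite eqxx.
  rewrite big1 ?normc0// => j /andP[Dij /eqP ij]; move: Dij Dii.
  by rewrite -ij => ->.
have Z1_le : normc Z1 <= tau1 * h * y.
  apply: one_le; first by nonneg.
  rewrite (le_trans (normc_avg _))// -(avg_abs (e i i)) -mulrA mulrC -avgZ.
  apply: avg_le => phi; rewrite !normcM normc_real.
  rewrite [leRHS](_ : _ = `|tau (phi (e i i))| * y * h); last by ring.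
  by rewrite ler_pM ?mulr_ge0 ?normc_ge0 ?ler_wpM2l.
have Z2_le : normc Z2 <= tau2 * h * y ^+ 2.
  apply: one_le; first by nonneg.
  rewrite normcM normc_real ger0_norm// -mulrA ler_wpM2l//.
  rewrite (le_trans (normc_avg _))// -[leRHS](avg_cst (card_samples (L := L) M_gt0)).
  apply: avg_le => phi; rewrite !normcM.
  rewrite [leRHS](_ : _ = y * y * h); last by ring.
  by rewrite ler_pM ?mulr_ge0 ?normc_ge0 ?ler_pM ?normc_ge0.
have A_le : normc (\sum_(j | D i j && (i != j)) A j) <= w * E.
  rewrite (le_trans (normc_sum _ _ _))//.
  apply: le_trans (ler_wpM2r E_ge0 (deg_le i)).
  apply: (@le_trans _ _ (\sum_(j | D i j) E)); last first.
    by rewrite sumr_const mulr_natl.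
  rewrite big_mkcondr /=; apply: ler_sum => j Dij; case: ifP => ij //.
  by rewrite AN// Dij ij.
rewrite /urn_error -/E.
rewrite (le_trans (le_normcD _ _))//.
have := le_trans (le_normcD _ _) (lerD (le_trans (normcB _ _) (lerD A_le B_le)) Z1_le).
move=> /(lerD Z2_le); rewrite addrC => /le_trans; apply.
by rewrite le_eqVlt; apply/orP; left; apply/eqP; ring.
Qed.

(** The quantity through which row [k] sees the rest of the matrix: it is the
    self-energy of that row up to the factor [v]. *)
Definition local_trace phi k : R[i] :=
  (w^-1)%:C%C * \sum_(j | D k j) G phi j j.

Let winv_ge0 : 0 <= w^-1. Proof. by rewrite invr_ge0 ltW. Qed.

Local Notation g k phi := (local_trace phi k).
Local Notation s i := (avg (fun phi => G phi i i)).
Local Notation sg k := (avg (fun phi => g k phi)).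

Let nbr_avg_le (Q : pred 'I_N) (f : 'I_N -> R[i]) (x : R) :
  (#|[pred j | Q j]|)%:R <= w -> 0 <= x -> (forall j, normc (f j) <= x) ->
  normc ((w^-1)%:C%C * \sum_(j | Q j) f j) <= x.
Proof.
move=> Qw x0 fx; rewrite normcM normc_real ger0_norm//.
rewrite mulrC ler_pdivrMr// mulrC (le_trans (normc_sum _ _ _))//.
apply: le_trans (ler_wpM2r x0 Qw); rewrite mulr_natl -sumr_const.
exact: ler_sum.
Qed.

Let s_le (f : {ffun 'I_L -> 'I_M} -> R[i]) x :
  (forall phi, normc (f phi) <= x) -> normc (avg f) <= x.
Proof.
move=> fx; rewrite (le_trans (normc_avg _))//.
by rewrite -[leRHS](avg_cst (card_samples (L := L) M_gt0)); exact: avg_le.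
Qed.

Let normc_CB a b : normc (conjc a - conjc b : R[i]) = normc (a - b).
Proof. by rewrite -rmorphB normc_conj. Qed.

Variables (v r : R).
Hypotheses (r_gt0 : 0 < r) (r_le1 : r <= 1) (w_tau2 : w * tau2 = v)
  (tau1_r : tau1 <= r ^+ 2) (tau2_r : tau2 <= r ^+ 2) (tau3_r : w * tau3 <= r ^+ 2)
  (w_r : w^-1 <= r ^+ 2) (v_eta : 4 * v <= eta ^+ 2).

Definition error_const (h c : R) : R :=
  4 * h * y ^+ 3 + v * c * y + v * (8 * h * y ^+ 3 + 2 * c * y ^+ 2)
  + 2 * h * y ^+ 2 + h * y.

Let v_ge0 : 0 <= v. Proof. by rewrite -w_tau2 mulr_ge0// ltW. Qed.

Lemma error_const_ge0 h c : 0 <= h -> 0 <= c -> 0 <= error_const h c.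
Proof.
move=> h0 c0; rewrite /error_const.
by nonneg.
Qed.

Lemma urn_error_le h c : 0 <= h -> 0 <= c ->
  urn_error h (c * w^-1) <= r ^+ 2 * error_const h c.
Proof.
move=> h0 c0; have r2 : 0 <= r ^+ 2 by exact: sqr_ge0.
have y2 := exprn_ge0 2 y_ge0; have y3 := exprn_ge0 3 y_ge0.
have cw : c * w^-1 <= r ^+ 2 * c by rewrite mulrC ler_wpM2r.
have cw' : c * w^-1 <= c.
  by rewrite (le_trans cw)// ler_piMl// exprn_ile1// ltW.
have cw0 : 0 <= c * w^-1 by rewrite mulr_ge0// invr_ge0 ltW.
have -> : urn_error h (c * w^-1) = w * tau3 * (4 * h * y ^+ 3) +
  v * y * (c * w^-1) + v * (tau1 * (8 * h * y ^+ 3 + 2 * (c * w^-1) * y ^+ 2)) +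
  2 * h * y ^+ 2 * tau2 + h * y * tau1.
  by rewrite /urn_error -w_tau2; ring.
have -> : r ^+ 2 * error_const h c = r ^+ 2 * (4 * h * y ^+ 3) +
  v * y * (r ^+ 2 * c) + v * (r ^+ 2 * (8 * h * y ^+ 3 + 2 * c * y ^+ 2)) +
  2 * h * y ^+ 2 * r ^+ 2 + h * y * r ^+ 2.
  by rewrite /error_const; ring.
rewrite !lerD//.
- by rewrite ler_wpM2r// !mulr_ge0.
- by rewrite ler_wpM2l// mulr_ge0.
- rewrite ler_wpM2l// ler_pM//; first by nonneg.
  by rewrite lerD2l ler_wpM2r// ler_wpM2l.
- by rewrite ler_wpM2l// !mulr_ge0.
- by rewrite ler_wpM2l// !mulr_ge0.
Qed.

Let v_y : v * y <= eta / 4.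
Proof. by rewrite ler_pdivrMr// mulrAC ler_pdivlMr// -expr2 mulrC. Qed.

Definition cov_const : R := 2 * y * error_const (2 * y) (2 * y ^+ 2).

Lemma cov_const_ge0 : 0 <= cov_const.
Proof. by rewrite !mulr_ge0// error_const_ge0// mulr_ge0// sqr_ge0. Qed.

Local Notation cov i k :=
  (avg (fun phi => G phi i i * conjc (g k phi - sg k))).

Let var k := avg (fun phi => normc (g k phi - sg k) ^+ 2).

(** The variance of the local trace is an average of covariances with diagonal
    entries, so a uniform bound on those covariances controls it. *)
Let var_le (kappa : R) k : 0 <= kappa -> (forall i, normc (cov i k) <= kappa) ->
  var k <= kappa.
Proof.
move=> k0 covk.
have E : (var k)%:C%C = (w^-1)%:C%C * \sum_(j | D k j) cov j k.
  rewrite real_complex_avg.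
  transitivity (avg (fun phi => g k phi * conjc (g k phi - sg k)) -
     sg k * avg (fun phi => conjc (g k phi - sg k))).
    by rewrite -avgZ -avgB; apply: eq_avg => phi; rewrite sqr_normcE mulrBl.
  have -> : avg (fun phi => conjc (g k phi - sg k)) = 0.
    have -> : avg (fun phi => conjc (g k phi - sg k)) =
       conjc (avg (fun phi => g k phi - sg k)).
      by rewrite conjc_avg.
    by rewrite avgB avg_cst ?subrr ?conjc0// card_samples.
  rewrite mulr0 subr0 -avg_sum -avgZ; apply: eq_avg => phi.
  by rewrite /local_trace -mulrA mulr_suml.
have : normc (var k)%:C%C <= kappa by rewrite E; exact: nbr_avg_le.
by rewrite normc_real; apply: le_trans; exact: ler_norm.
Qed.

(** Correlations between resolvent entries are of the order of the error in the
    Schwinger--Dyson equation: tested against the centred local trace, that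
    equation bounds the largest covariance by half of itself plus the error,
    because [v / eta] is small against [eta]. *)
Lemma cov_le i k : normc (cov i k) <= r ^+ 2 * cov_const.
Proof.
pose kappa : R := \big[Num.max/0]_(p : 'I_N * 'I_N) normc (cov p.1 p.2).
have le_kappa a b : normc (cov a b) <= kappa.
  by rewrite /kappa (bigmaxD1 (a, b))//= le_max lexx.
have kappa_ge0 : 0 <= kappa by apply: le_trans (le_kappa i k); exact: normc_ge0.
suff kappa_le : kappa <= r ^+ 2 * cov_const by apply: le_trans (le_kappa i k) _.
have var_kappa a : var a <= kappa by exact: var_le.
have g_le phi a : normc (g a phi) <= y.
  by apply: nbr_avg_le => // j; exact: resolvent_entry.
have sg_le a : normc (sg a) <= y by exact: s_le.
have gB_le phi a : normc (g a phi - sg a) <= 2 * y.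
  by rewrite (le_trans (normcB _ _))// mulr_natl mulr2n lerD.
have err_ge0 : 0 <= r ^+ 2 * error_const (2 * y) (2 * y ^+ 2).
  by rewrite mulr_ge0 ?sqr_ge0 ?error_const_ge0 ?mulr_ge0 ?sqr_ge0.
have bnd a b : eta * normc (cov a b) <= eta / 2 * kappa +
    r ^+ 2 * error_const (2 * y) (2 * y ^+ 2).
  pose H phi := conjc (g b phi - sg b).
  pose H0 j phi := conjc ((w^-1)%:C%C * \sum_(l | D b l) G0 a j phi l l - sg b).
  have HB j : D a j -> a != j -> forall phi,
      normc (H phi - H0 j phi) <= `|tau (phi (e a j))| * (2 * y ^+ 2 * w^-1).
    move=> Daj aj phi; rewrite normc_CB opprB addrA subrK /local_trace -mulrBr -sumrB.
    rewrite normcM normc_real ger0_norm// mulrA mulrC.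
    rewrite ler_wpM2r// (le_trans (normc_sum _ _ _))//.
    exact: urn_resolvent_diagB.
  have H_le phi : normc (H phi) <= 2 * y by rewrite normc_conj.
  have H0_le j phi : normc (H0 j phi) <= 2 * y.
    rewrite normc_conj (le_trans (normcB _ _))// mulr_natl mulr2n lerD//.
    by apply: nbr_avg_le => // l; exact: resolvent_entry.
  have H0u j phi x : H0 j (upd phi (e a j) x) = H0 j phi.
    by rewrite /H0 urn_matrix0_upd.
  have := schwinger_dyson _ H_le H0_le HB H0u.
  have -> : avg H = 0.
    have -> : avg H = conjc (avg (fun phi => g b phi - sg b)).
      by rewrite conjc_avg.
    by rewrite avgB avg_cst ?subrr ?conjc0// card_samples.
  have c_ge0 : 0 <= 2 * y ^+ 2 * w^-1 by nonneg.
  rewrite addr0 => /(_ c_ge0)/le_trans SD.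
  have {}SD := SD _ (@urn_error_le (2 * y) (2 * y ^+ 2) _ _).
  have {}SD : normc ((0 +i* eta)%C * avg (fun phi => G phi a a * H phi) +
      (tau2)%:C%C * avg (fun phi => G phi a a * (\sum_(j | D a j) G phi j j) * H phi))
      <= r ^+ 2 * error_const (2 * y) (2 * y ^+ 2).
    by apply: SD; nonneg.
  pose Z := avg (fun phi => G phi a a * (g a phi - sg a) * H phi).
  have E : (tau2)%:C%C * avg (fun phi => G phi a a * (\sum_(j | D a j) G phi j j) * H phi) =
      v%:C%C * (Z + sg a * cov a b).
    rewrite -w_tau2 rmorphM /= /Z -avgZ -avgD [w%:C%C * _]mulrC -mulrA.
    congr (_ * _); rewrite -avgZ; apply: eq_avg => phi.
    have -> : \sum_(j | D a j) G phi j j = w%:C%C * g a phi.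
      by rewrite /local_trace mulrA -rmorphM mulfV ?gt_eqF// mul1r.
    by rewrite /H; ring.
  have Z_le : normc Z <= y * kappa.
    rewrite (le_trans (normc_avg _))//.
    apply: (@le_trans _ _ (avg (fun phi => y / 2 * (normc (g a phi - sg a) ^+ 2 + normc (g b phi - sg b) ^+ 2)))).
      apply: avg_le => phi; rewrite !normcM normc_conj -!mulrA.
      rewrite ler_pM ?mulr_ge0 ?normc_ge0 ?resolvent_entry//.
      by have := sqr_ge0 (normc (g a phi - sg a) - normc (g b phi - sg b)); nra.
    rewrite avgZ avgD -mulrA ler_wpM2l// mulrC ler_pdivrMr// mulr_natr mulr2n.
    by rewrite lerD// var_kappa.
  have -> : eta * normc (cov a b) = normc ((0 +i* eta)%C * cov a b).
    by rewrite normcM /= expr0n add0r sqrtr_sqr ger0_norm// ltW.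
  have -> : (0 +i* eta)%C * cov a b = ((0 +i* eta)%C * avg (fun phi => G phi a a * H phi) +
      (tau2)%:C%C * avg (fun phi => G phi a a * (\sum_(j | D a j) G phi j j) * H phi))
      - v%:C%C * (Z + sg a * cov a b).
    by rewrite E /H; ring.
  rewrite (le_trans (normcB _ _))// addrC lerD//.
  rewrite normcM normc_real ger0_norm//.
  have : normc (Z + sg a * cov a b) <= y * kappa + y * kappa.
    by rewrite (le_trans (le_normcD _ _))// lerD// normcM ler_pM ?normc_ge0.
  move=> /(ler_wpM2l v_ge0)/le_trans; apply.
  have := ler_wpM2r kappa_ge0 v_y; lra.
have : eta * kappa <= eta / 2 * kappa + r ^+ 2 * error_const (2 * y) (2 * y ^+ 2).
  rewrite mulrC -ler_pdivlMr// /kappa; apply: bigmax_le => [|[a b] _].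
    by nonneg; rewrite ltW.
  by rewrite ler_pdivlMr// mulrC /= bnd.
rewrite /cov_const => h.
have {}h : eta * kappa <= 2 * (r ^+ 2 * error_const (2 * y) (2 * y ^+ 2)) by lra.
rewrite [leRHS](_ : _ = eta^-1 * (2 * (r ^+ 2 * error_const (2 * y) (2 * y ^+ 2)))); last by ring.
by rewrite ler_pdivlMl.
Qed.

Lemma var_local_trace_le k : avg (fun phi => normc (g k phi - sg k) ^+ 2) <= r ^+ 2 * cov_const.
Proof.
apply: var_le => [|i]; last exact: cov_le.
by rewrite mulr_ge0 ?cov_const_ge0// sqr_ge0.
Qed.

Definition self_const : R := error_const 1 0 + v * y * (1 + cov_const) / 2.

(** The Schwinger--Dyson equation tested against a constant; the small variance
    of the local trace allows one to factorize the quadratic term. *)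
Lemma self_consistent i :
  normc ((0 +i* eta)%C * s i + 1 + v%:C%C * (s i * sg i)) <= r * self_const.
Proof.
have := @schwinger_dyson i (fun=> 1) (fun _ _ => 1) 1 0 (lexx 0).
have c1 : normc (1 : R[i]) = 1 := normc1 R.
have -> : avg (fun phi : {ffun 'I_L -> 'I_M} => 1 : R[i]) = 1.
  by rewrite avg_cst// card_samples.
move=> SD.
have {}SD : normc ((0 +i* eta)%C * s i + 1
    + (tau2)%:C%C * avg (fun phi => G phi i i * (\sum_(j | D i j) G phi j j) * 1))
    <= r ^+ 2 * error_const 1 0.
  have := @urn_error_le 1 0 ler01 (lexx 0); rewrite mul0r; apply: le_trans.
  have -> : s i = avg (fun phi => G phi i i * 1) by apply: eq_avg => phi; rewrite mulr1.
  apply: SD => //.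
  - by move=> _; rewrite c1.
  - by move=> _ _; rewrite c1.
  - by move=> j _ _ phi; rewrite subrr normc0 mulr0.
pose Z := avg (fun phi => G phi i i * (g i phi - sg i)).
have E : (tau2)%:C%C * avg (fun phi => G phi i i * (\sum_(j | D i j) G phi j j) * 1) =
    v%:C%C * (Z + s i * sg i).
  rewrite -w_tau2 rmorphM /= /Z.
  have -> : s i * sg i = avg (fun phi => sg i * G phi i i) by rewrite mulrC -(avgZ (sg i)).
  rewrite -avgD [w%:C%C * _]mulrC -mulrA.
  congr (_ * _); rewrite -avgZ; apply: eq_avg => phi.
  have -> : \sum_(j | D i j) G phi j j = w%:C%C * g i phi.
    by rewrite /local_trace mulrA -rmorphM mulfV ?gt_eqF// mul1r.
  by ring.
rewrite E in SD.
have Z_le : normc Z <= y * (r * (1 + cov_const) / 2).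
  rewrite (le_trans (normc_avg _))//.
  apply: (@le_trans _ _ (avg (fun phi => y * ((r + r^-1 * normc (g i phi - sg i) ^+ 2) / 2)))).
    apply: avg_le => phi; rewrite normcM ler_pM ?normc_ge0 ?resolvent_entry//.
    set x := normc _.
    have := sqr_ge0 (r - x); rewrite ler_pdivlMr// => h.
    have : 0 <= r^-1 * (r - x) ^+ 2 by rewrite mulr_ge0// invr_ge0 ltW.
    rewrite (_ : r^-1 * _ = r - 2 * x + r^-1 * x ^+ 2); first lra.
    by field; rewrite gt_eqF.
  rewrite avgZ ler_wpM2l//.
  rewrite (_ : avg _ = (r + r^-1 * avg (fun phi => normc (g i phi - sg i) ^+ 2)) / 2); last first.
    have cr : avg (fun phi : {ffun 'I_L -> 'I_M} => r) = r by rewrite avg_cst// card_samples.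
    by rewrite -[X in _ = (X + _) / _]cr -avgZ -avgD mulrC -avgZ; apply: eq_avg => phi; rewrite mulrC.
  rewrite ler_pM2r// mulrDr mulr1 lerD2l ler_pdivrMl// mulrA -expr2.
  exact: var_local_trace_le.
have -> : (0 +i* eta)%C * s i + 1 + v%:C%C * (s i * sg i) =
   ((0 +i* eta)%C * s i + 1 + v%:C%C * (Z + s i * sg i)) - v%:C%C * Z by ring.
rewrite (le_trans (normcB _ _))// /self_const [leRHS]mulrDr lerD//.
  rewrite (le_trans SD)// ler_wpM2r ?error_const_ge0// expr2 ler_piMr// ltW//.
rewrite normcM normc_real ger0_norm//.
rewrite [leRHS](_ : _ = v * (y * (r * (1 + cov_const) / 2))); last by ring.
by rewrite ler_wpM2l.
Qed.

(** The imaginary part of the Stieltjes transform at [i eta] of the semicircle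
    law of variance [v]. *)
Variable c0 : R.
Hypotheses (c0_ge0 : 0 <= c0) (c0_eq : eta * c0 + v * c0 ^+ 2 = 1).

Let c0_le : c0 <= y.
Proof. by rewrite -[leRHS]mul1r ler_pdivlMr// mulrC -c0_eq lerDl mulr_ge0// sqr_ge0. Qed.

Variable def : R.
Hypothesis deg_ge : N%:R * (1 - def) * w <= \sum_i (#|[pred j | D i j]|)%:R.

(** The self-consistent equation is a contraction for [4 v <= eta^2], so the
    approximate solution given by the diagonal entries is close, on average over
    the rows, to the exact one; rows with fewer than [w] neighbours only
    contribute through their total deficit. *)
Lemma mean_resolvent_close :
  normc (\sum_i (s i - (0 +i* c0)%C)) <=
    N%:R * (2 * y * (v * y ^+ 2 * def + r * self_const)).
Proof.
pose d i := normc (s i - (0 +i* c0)%C).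
pose deg i : R := (#|[pred j | D i j]|)%:R.
have s_y i : normc (s i) <= y by apply: s_le => phi; exact: resolvent_entry.
have d_ge0 i : 0 <= d i by exact: normc_ge0.
have cN : normc (0 +i* c0 : R[i])%C = c0 by rewrite /= expr0n add0r sqrtr_sqr ger0_norm.
have sgE i : sg i = (w^-1)%:C%C * \sum_(j | D i j) s j.
  by rewrite -avg_sum -avgZ.
have sgB i : normc (sg i - (0 +i* c0)%C) <= w^-1 * \sum_(j | D i j) d j + (1 - deg i / w) * y.
  have -> : sg i - (0 +i* c0)%C = (w^-1)%:C%C * \sum_(j | D i j) (s j - (0 +i* c0)%C)
     - (1 - deg i / w)%:C%C * (0 +i* c0)%C.
    rewrite sgE sumrB mulrBr sumr_const -mulr_natl rmorphB rmorphM rmorph1 /deg rmorph_nat /=.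
    by ring.
  have deg1 : 0 <= 1 - deg i / w by rewrite subr_ge0 ler_pdivrMr// mul1r; exact: deg_le.
  rewrite (le_trans (normcB _ _))// lerD// normcM normc_real ger0_norm//.
    by rewrite ler_wpM2l// normc_sum.
  by rewrite cN ler_wpM2l.
have row i : eta * d i <= v * y * (w^-1 * \sum_(j | D i j) d j) + v * y ^+ 2 * (1 - deg i / w)
    + v * y * d i + r * self_const.
  have -> : eta * d i = normc ((0 +i* eta)%C * (s i - (0 +i* c0)%C)).
    by rewrite normcM /= expr0n add0r sqrtr_sqr ger0_norm// ltW.
  have -> : (0 +i* eta)%C * (s i - (0 +i* c0)%C) =
     ((0 +i* eta)%C * s i + 1 + v%:C%C * (s i * sg i))
     - v%:C%C * (s i * (sg i - (0 +i* c0)%C) + (0 +i* c0)%C * (s i - (0 +i* c0)%C)).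
    have e2 : (0 +i* eta)%C * (0 +i* c0)%C = - 1 - v%:C%C * ((0 +i* c0)%C * (0 +i* c0)%C) :> R[i].
      apply/eqP; rewrite eq_complex /=; apply/andP; split; apply/eqP; last by ring.
      by rewrite -c0_eq; ring.
    by rewrite mulrBr e2; ring.
  rewrite (le_trans (normcB _ _))// addrC lerD//; last exact: self_consistent.
  rewrite normcM normc_real ger0_norm//.
  rewrite [leRHS](_ : _ = v * (y * (w^-1 * \sum_(j | D i j) d j + (1 - deg i / w) * y) + y * d i)); last by ring.
  rewrite ler_wpM2l// (le_trans (le_normcD _ _))// !normcM lerD//.
    by rewrite ler_pM ?normc_ge0.
  apply: ler_wpM2r; first exact: d_ge0.
  exact: (eq_ind_r (fun x => x <= y) c0_le cN).
have dd : \sum_i w^-1 * (\sum_(j | D i j) d j) <= \sum_i d i.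
  rewrite -mulr_sumr ler_pdivrMl// mulr_sumr.
  rewrite (exchange_big_dep xpredT)//=; apply: ler_sum => j _.
  rewrite sumr_const -[_ *+ _]mulr_natl ler_wpM2r//.
  apply: le_trans (deg_le j); rewrite ler_nat; apply: subset_leq_card.
  by apply/fintype.subsetP => i; rewrite !inE /in_mem /= Dsym.
apply: (le_trans (normc_sum _ _ _)).
have := @ler_sum _ _ (index_enum 'I_N) xpredT _ _ (fun i _ => row i).
rewrite !big_split /= -!mulr_sumr sumrB !sumr_const card_ord -mulr_suml => tot.
have S_ge0 : 0 <= \sum_i d i by exact: sumr_ge0.
have h1 : v * y * (w^-1 * \sum_(i < N) \sum_(j | D i j) d j) <= eta / 4 * \sum_i d i.
  by rewrite ler_pM ?mulr_ge0 ?sumr_ge0// => [i _|]; [rewrite sumr_ge0|rewrite mulr_sumr].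
have h2 : v * y * \sum_i d i <= eta / 4 * \sum_i d i by rewrite ler_wpM2r.
have h3 : v * y ^+ 2 * (1 *+ N - (\sum_i deg i) / w) <= v * y ^+ 2 * (N%:R * def).
  rewrite ler_wpM2l; [by []|by rewrite mulr_ge0// sqr_ge0|].
  rewrite lerBlDr -lerBlDl ler_pdivlMr//.
  by rewrite [leLHS](_ : _ = N%:R * (1 - def) * w); last by ring.
rewrite -(ler_pM2l eta_gt0).
rewrite [leRHS](_ : _ = N%:R * (2 * (v * y ^+ 2 * def + r * self_const))); last first.
  by field; rewrite gt_eqF.
rewrite -[self_const *+ N]mulr_natl [r * _]mulrCA in tot.
have : eta * \sum_i d i <= eta / 4 * \sum_i d i + v * y ^+ 2 * (N%:R * def) + eta / 4 * \sum_i d i + N%:R * (r * self_const).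
  by apply: (le_trans tot); rewrite !lerD.
lra.
Qed.

End band_urn_matrix.

(** * Removing the mean of the entries *)

Section mean_removal.
Context {R : rcfType} {N : nat}.
Variables (D : rel 'I_N) (eta mu w sw : R) (q : nat) (A B : 'M[R]_N).
Local Notation y := (eta^-1).
Hypotheses (eta_gt0 : 0 < eta) (As : A^T = A) (Bs : B^T = B).
Hypothesis AB : A - B = \matrix_(i, j) (if D i j then mu else 0).
Hypotheses (sw_gt0 : 0 < sw) (sw2 : sw ^+ 2 = w) (q_gt0 : (0 < q)%N).
Hypothesis deg_le : forall i, (#|[pred j | D i j]|)%:R <= w.
Hypothesis row_regular : forall i k : 'I_N, (k <= i < k + q ^ 2)%N ->
  (#|[pred j | D i j != D k j]| <= 4 * q ^ 2)%N.

Let y_gt0 : 0 < y. Proof. by rewrite invr_gt0. Qed.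

Let E (i j : 'I_N) : R := (D i j)%:R.
Let K := resolvent eta A *m resolvent eta B.

Let traceE : \sum_i (resolvent eta A i i - resolvent eta B i i) =
  - (mu%:C%C * \sum_i \sum_j (E i j)%:C%C * K j i).
Proof.
have -> : \sum_i (resolvent eta A i i - resolvent eta B i i) =
    \tr (resolvent eta A - resolvent eta B).
  by rewrite /mxtrace; apply: eq_bigr => i _; rewrite !mxE.
rewrite {1}(resolventB eta_gt0 Bs As) addrAC subrr add0r linearN /=; congr (- _).
rewrite mxtrace_mulC mulmxA -/K mxtrace_mulC mulr_sumr; apply: eq_bigr => i _.
rewrite mxE mulr_sumr; apply: eq_bigr => j _; rewrite AB !mxE mulrA; congr (_ * _).
by rewrite -rmorphM /E; case: (D i j); rewrite ?mulr1 ?mulr0.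
Qed.

Let vnorm2_K (u : 'rV[R[i]]_N) : vnorm2 (u *m K) <= y ^+ 4 * vnorm2 u.
Proof.
rewrite /K mulmxA (le_trans (vnorm2_resolvent eta_gt0 _ Bs))//.
rewrite (_ : y ^+ 4 = y ^+ 2 * y ^+ 2); last by rewrite -exprD.
by rewrite -mulrA ler_wpM2l ?sqr_ge0// vnorm2_resolvent.
Qed.

Let K_col i : \sum_j normc (K j i) ^+ 2 <= y ^+ 4.
Proof.
have trK : K^T = resolvent eta B *m resolvent eta A.
  by rewrite /K trmx_mul !resolvent_tr.
have -> : \sum_j normc (K j i) ^+ 2 = vnorm2 (delta_mx ord0 i *m K^T).
  by apply: eq_bigr => j _; rewrite -rowE !mxE.
rewrite trK mulmxA (le_trans (vnorm2_resolvent eta_gt0 _ As))//.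
rewrite (_ : y ^+ 4 = y ^+ 2 * y ^+ 2); last by rewrite -exprD.
rewrite ler_wpM2l ?sqr_ge0// (le_trans (vnorm2_resolvent eta_gt0 _ Bs))//.
by rewrite vnorm2_delta mulr1.
Qed.

(** The first row of the block of [q ^ 2] rows that contains [i]. *)
Let anchor (i : 'I_N) : 'I_N :=
  Ordinal (leq_ltn_trans (leq_divM i (q ^ 2)) (ltn_ord i)).

Let anchor_le i : (anchor i <= i < anchor i + q ^ 2)%N.
Proof.
rewrite /= leq_divM /= {1}(divn_eq i (q ^ 2)) ltn_add2l ltn_mod.
by rewrite expn_gt0 q_gt0.
Qed.

(** Weighted Cauchy--Schwarz for complex sums, with the weight chosen freely. *)
Let weighted_cs (c : 'I_N -> R) (z : 'I_N -> R[i]) (a X Y : R) : 0 < a ->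
  \sum_j c j ^+ 2 <= X -> \sum_j normc (z j) ^+ 2 <= Y ->
  normc (\sum_j (c j)%:C%C * z j) <= (a * X + a^-1 * Y) / 2.
Proof.
move=> a0 cX zY; rewrite (le_trans (normc_sum _ _ _))//.
apply: (@le_trans _ _ (\sum_j (a * c j ^+ 2 + a^-1 * normc (z j) ^+ 2) / 2)).
  apply: ler_sum => j _; rewrite normcM normc_real ler_pdivlMr//.
  have : 0 <= a^-1 * (a * `|c j| - normc (z j)) ^+ 2 by rewrite mulr_ge0 ?sqr_ge0 ?invr_ge0 1?ltW.
  rewrite (_ : a^-1 * _ = a * `|c j| ^+ 2 - `|c j| * normc (z j) * 2 + a^-1 * normc (z j) ^+ 2); last first.
    by field; rewrite gt_eqF.
  by rewrite real_normK ?num_real//; lra.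
rewrite -mulr_suml ler_pM2r ?invr_gt0// big_split /= -!mulr_sumr lerD//.
  by rewrite ler_pM2l.
by rewrite ler_pM2l// invr_gt0.
Qed.

Let card_anchors : (#|[pred k : 'I_N | (q ^ 2 %| k)%N]| <= (N %/ q ^ 2).+1)%N.
Proof.
have q2 : (0 < q ^ 2)%N by rewrite expn_gt0 q_gt0.
have lt (k : 'I_N) : (k %/ q ^ 2 < (N %/ q ^ 2).+1)%N by rewrite ltnS leq_div2r// ltnW.
rewrite -[X in (_ <= X)%N]card_ord.
apply: (@leq_card_in _ _ (fun k => Ordinal (lt k))) => k l.
rewrite !inE => qk ql [kl]; apply: val_inj => /=.
by rewrite -(divnK qk) -(divnK ql) kl.
Qed.

(** Adding a constant to all the entries of a band matrix does not move the
    trace of its resolvent much, although this perturbation is not small in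
    norm: up to a few entries per row it is constant on blocks of [q ^ 2]
    consecutive rows, hence close to a matrix of low rank. *)
Lemma trace_resolvent_shift :
  normc (\sum_i (resolvent eta A i i - resolvent eta B i i)) <=
  `|mu| * (y ^+ 2 * (2 * q%:R * N%:R + (N%:R / q%:R + q%:R) * sw)).
Proof.
have q0 : 0 < q%:R :> R by rewrite ltr0n.
rewrite traceE normcN normcM normc_real ler_wpM2l//.
have -> : \sum_i \sum_j (E i j)%:C%C * K j i =
    \sum_i \sum_j (E i j - E (anchor i) j)%:C%C * K j i +
    \sum_i \sum_j (E (anchor i) j)%:C%C * K j i.
  rewrite -big_split; apply: eq_bigr => i _; rewrite -big_split; apply: eq_bigr => j _.
  by rewrite /= -mulrDl -rmorphD subrK.
rewrite (le_trans (le_normcD _ _))// mulrDr lerD//.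
  rewrite (le_trans (normc_sum _ _ _))//.
  rewrite [leRHS](_ : _ = \sum_(i < N) (2 * q%:R * y ^+ 2)); last first.
    by rewrite sumr_const card_ord -[RHS]mulr_natl; ring.
  apply: ler_sum => i _.
  have c2 : \sum_j (E i j - E (anchor i) j) ^+ 2 <= 4 * q%:R ^+ 2.
    have := row_regular (anchor_le i); rewrite -(ler_nat R) natrM natrX; apply: le_trans.
    rewrite -sumr_const [leRHS]big_mkcond /=; apply: ler_sum => j _.
    rewrite /E !inE; case: (D i j); case: (D _ j); rewrite ?subrr ?subr0 ?sub0r ?sqrrN ?expr1n ?expr0n//.
  have a0 : 0 < y ^+ 2 / (2 * q%:R) by rewrite divr_gt0 ?exprn_gt0 ?mulr_gt0.
  apply: (le_trans (weighted_cs a0 c2 (K_col i))); rewrite le_eqVlt; apply/orP; left; apply/eqP.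
  by field; rewrite !gt_eqF.
pose z (k i : 'I_N) := \sum_j (E k j)%:C%C * K j i.
have -> : \sum_i \sum_j (E (anchor i) j)%:C%C * K j i =
    \sum_(k : 'I_N | (q ^ 2 %| k)%N) \sum_i ((anchor i == k)%:R)%:C%C * z k i.
  rewrite [RHS]exchange_big /=; apply: eq_bigr => i _.
  have dv : (q ^ 2 %| anchor i)%N by rewrite /= dvdn_mull.
  rewrite [RHS](bigD1 _ dv) eqxx /= mul1r [X in _ + X]big1 ?addr0// => k.
  by case/andP => _; rewrite eq_sym => /negbTE ->; rewrite mul0r.
rewrite (le_trans (normc_sum _ _ _))//.
have blk k : normc (\sum_i ((anchor i == k)%:R)%:C%C * z k i) <= y ^+ 2 * sw * q%:R.
  have c2 : \sum_i ((anchor i == k)%:R : R) ^+ 2 <= q%:R ^+ 2.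
    rewrite -natrX; apply: (@le_trans _ _ (\sum_(i : 'I_N | anchor i == k) 1)).
      by rewrite [leRHS]big_mkcond; apply: ler_sum => i _; case: eqP => _; rewrite ?expr1n ?expr0n.
    rewrite sumr_const ler_nat.
    have lt (i : 'I_N) : (i %% q ^ 2 < q ^ 2)%N by rewrite ltn_mod expn_gt0 q_gt0.
    rewrite -[X in (_ <= X)%N]card_ord.
    apply: (@leq_card_in _ _ (fun i => Ordinal (lt i))) => i j.
    rewrite /in_mem /= => /eqP ik /eqP jk [ij]; apply: val_inj => /=.
    by rewrite [LHS](divn_eq i (q ^ 2)) [RHS](divn_eq j (q ^ 2)) ik jk ij.
  have z2 : \sum_i normc (z k i) ^+ 2 <= y ^+ 4 * w.
    have := vnorm2_K (\row_j (E k j)%:C%C).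
    have -> : vnorm2 ((\row_j (E k j)%:C%C) *m K) = \sum_i normc (z k i) ^+ 2.
      apply: eq_bigr => i _; rewrite mxE; congr (normc _ ^+ 2).
      by apply: eq_bigr => j _; rewrite mxE.
    move/le_trans; apply; rewrite ler_wpM2l ?exprn_ge0 ?(ltW y_gt0)//.
    apply: le_trans (deg_le k); rewrite -sumr_const [leRHS]big_mkcond /=.
    apply: ler_sum => j _; rewrite mxE normc_real /E inE.
    by case: (D k j); rewrite ?normr1 ?normr0 ?expr1n ?expr0n.
  have a0 : 0 < y ^+ 2 * sw / q%:R by rewrite divr_gt0 ?mulr_gt0 ?exprn_gt0.
  apply: (le_trans (weighted_cs a0 c2 z2)); rewrite le_eqVlt; apply/orP; left; apply/eqP.
  by rewrite -sw2; field; rewrite !gt_eqF.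
apply: (le_trans (ler_sum _ (fun k _ => blk k))).
rewrite sumr_const -[_ *+ _]mulr_natl.
rewrite [leRHS](_ : _ = (N%:R / q%:R ^+ 2 + 1) * (y ^+ 2 * sw * q%:R)); last first.
  by field; rewrite !gt_eqF.
rewrite ler_wpM2r ?mulr_ge0 ?exprn_ge0 ?(ltW y_gt0) ?(ltW sw_gt0)//.
apply: (@le_trans _ _ ((N %/ q ^ 2).+1)%:R); first by rewrite ler_nat.
rewrite -addn1 natrD lerD2r ler_pdivlMr ?exprn_gt0// -natrX -natrM ler_nat.
exact: leq_divM.
Qed.

End mean_removal.

(** * Traces and eigenvalues *)

Lemma char_poly_conj (F : fieldType) (n : nat) (P A : 'M[F]_n) : P \in unitmx ->
  char_poly (invmx P *m A *m P) = char_poly A.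
Proof.
move=> Pu; rewrite /char_poly /char_poly_mx.
set Q := map_mx polyC P; set Q' := map_mx polyC (invmx P).
have QQ : Q' *m Q = 1%:M by rewrite -map_mxM mulVmx// map_mx1.
have -> : 'X%:M - map_mx polyC (invmx P *m A *m P) =
    Q' *m ('X%:M - map_mx polyC A) *m Q.
  rewrite mulmxBr mulmxBl !map_mxM -/Q -/Q'; congr (_ - _).
  by rewrite mul_mx_scalar -scalemxAl QQ scalemx1.
by rewrite !det_mulmx mulrAC -det_mulmx QQ det1 mul1r.
Qed.

Lemma trace_conj_diag_power (F : fieldType) (n : nat) (P : 'M[F]_n) (d : 'rV[F]_n) (k : nat) :
  P \in unitmx -> \tr (iter k (mulmx (invmx P *m diag_mx d *m P)) 1%:M) = \sum_i d ord0 i ^+ k.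
Proof.
move=> Pu.
have -> : iter k (mulmx (invmx P *m diag_mx d *m P)) 1%:M =
    invmx P *m diag_mx (\row_i d ord0 i ^+ k) *m P.
  elim: k => [|k /= ->].
    rewrite /= [diag_mx _](_ : _ = 1%:M) ?mulmx1 ?mulVmx//.
    by apply/matrixP => i j; rewrite !mxE expr0.
  rewrite !mulmxA mulmxK// -[_ *m diag_mx _ *m diag_mx _]mulmxA mulmx_diag.
  by congr (_ *m diag_mx _ *m _); apply/rowP => i; rewrite !mxE exprS.
rewrite mxtrace_mulC mulmxA mulmxV// mul1mx mxtrace_diag.
by apply: eq_bigr => i _; rewrite mxE.
Qed.

Lemma trace_invmx_shift (F : fieldType) (n : nat) (P : 'M[F]_n) (d : 'rV[F]_n) (c : F) :
  P \in unitmx -> (forall i, d ord0 i != c) ->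
  \tr (invmx (invmx P *m diag_mx d *m P - c%:M)) = \sum_i (d ord0 i - c)^-1.
Proof.
move=> Pu dc; pose Dv := diag_mx (\row_i (d ord0 i - c)^-1).
have -> : invmx P *m diag_mx d *m P - c%:M =
    invmx P *m diag_mx (\row_i (d ord0 i - c)) *m P.
  have -> : c%:M = invmx P *m c%:M *m P.
    by rewrite mul_mx_scalar -scalemxAl mulVmx// scalemx1.
  rewrite -mulmxBl -mulmxBr; congr (_ *m _ *m _).
  apply/matrixP => i j; rewrite !mxE; case: eqP => [->|_]; last by rewrite !mulr0n subrr.
  by rewrite !mulr1n.
set W := invmx P *m _ *m P.
have DD : diag_mx (\row_i (d ord0 i - c)) *m Dv = 1%:M.
  rewrite mulmx_diag; apply/matrixP => i j; rewrite !mxE mulfV ?mulr1n//.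
  by rewrite subr_eq0.
have WG : W *m (invmx P *m Dv *m P) = 1%:M.
  by rewrite /W !mulmxA mulmxK// -[_ *m Dv]mulmxA DD mulmx1 mulVmx.
have Wu : W \in unitmx by case: (mulmx1_unit WG).
have -> : invmx W = invmx P *m Dv *m P by rewrite -[LHS]mulmx1 -WG mulKmx.
rewrite mxtrace_mulC mulmxA mulmxV// mul1mx /Dv mxtrace_diag.
by apply: eq_bigr => i _; rewrite mxE.
Qed.

Section spectrum.
Context {R : realType} {N : nat}.
Variables (A : 'M[R]_N) (As : A^T = A).

Let AC := toC A.
Let P := spectralmx AC.
Let sp := spectral_diag AC.
Let Pu : P \in unitmx := spectral_unit AC.

Let herm : AC \is hermsymmx.
Proof.
apply: realsym_hermsym.
  by apply/is_hermitianmxP; rewrite expr0 scale1r /AC /toC map_mx_id// map_trmx As.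
by apply/mxOverP => i j; rewrite mxE complex_real.
Qed.

Let ACE : AC = invmx P *m diag_mx sp *m P.
Proof. by apply/orthomx_spectralP; exact: hermitian_normalmx. Qed.

Let lam (i : 'I_N) : R := complex.Re (sp ord0 i).

Let spE i : sp ord0 i = (lam i)%:C%C.
Proof.
have /mxOverP/(_ ord0 i) := hermitian_spectral_diag_real herm.
by move/RRe_real => <-.
Qed.

Let char_polyE : char_poly A = \prod_i ('X - (lam i)%:P).
Proof.
apply: (@map_poly_inj _ _ (real_complex R)).
rewrite map_char_poly -[map_mx _ A]/AC ACE char_poly_conj// char_poly_trig; last first.
  exact: diag_mx_is_trig.
rewrite rmorph_prod; apply: eq_bigr => i _.
by rewrite rmorphB /= map_polyX map_polyC /= mxE eqxx mulr1n spE.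
Qed.

(** The spectral theorem supplies an ordered list of real roots, so that the
    default value in the definition of the eigenvalues is never taken. *)
Lemma char_poly_eigenvalues :
  char_poly A = \prod_(z <- eigenvalues A) ('X - z%:P).
Proof.
rewrite /eigenvalues; case: xgetP => [s _ [_ ->]//|].
move/(_ (sort <=%R [seq lam i | i <- enum 'I_N])); case; split.
  by apply: sort_sorted; exact: le_total.
rewrite char_polyE (perm_big [seq lam i | i <- enum 'I_N]) ?perm_sort//=.
by rewrite big_map big_enum.
Qed.

Let eigenvalues_perm : perm_eq (eigenvalues A) [seq lam i | i <- enum 'I_N].
Proof.
by apply: prod_XsubC_eq; rewrite -char_poly_eigenvalues big_map big_enum.
Qed.

Lemma size_eigenvalues : size (eigenvalues A) = N.
Proof. by rewrite (perm_size eigenvalues_perm) size_map size_enum_ord. Qed.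

Lemma trace_power k : \tr (iter k (mulmx A) 1%:M) = \sum_(z <- eigenvalues A) z ^+ k.
Proof.
rewrite (perm_big _ eigenvalues_perm) big_map big_enum /=; apply: complexI.
have Ek : toC (iter k (mulmx A) 1%:M) = iter k (mulmx AC) 1%:M.
  by elim: k => [|k ih] /=; rewrite /toC ?map_mx1// map_mxM -/(toC (iter _ _ _)) ih.
rewrite [LHS](_ : _ = \tr (toC (iter k (mulmx A) 1%:M))); last by rewrite /mxtrace rmorph_sum; apply: eq_bigr => i _; rewrite mxE.
rewrite Ek ACE trace_conj_diag_power// rmorph_sum.
by apply: eq_bigr => i _; rewrite spE rmorphXn.
Qed.

Variables (eta : R) (eta_gt0 : 0 < eta).

Lemma trace_resolvent :
  \sum_i resolvent eta A i i =
  \sum_(z <- eigenvalues A) (z%:C%C - (0 +i* eta)%C)^-1.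
Proof.
rewrite (perm_big _ eigenvalues_perm) big_map big_enum /=.
transitivity (\tr (resolvent eta A)) => //.
rewrite /resolvent /shifted -/AC ACE trace_invmx_shift// => [|i].
  by apply: eq_bigr => i _; rewrite spE.
rewrite spE; apply/eqP => /(congr1 (@complex.Im R)) /= /eqP.
by rewrite eq_sym gt_eqF.
Qed.

Let ReD : {morph @complex.Re R : x y / x + y}.
Proof. by case=> a b [c d]. Qed.

Lemma trace_resolvent_Re :
  complex.Re (\sum_i resolvent eta A i i) =
  \sum_(z <- eigenvalues A) z / (z ^+ 2 + eta ^+ 2).
Proof.
rewrite trace_resolvent (big_morph _ ReD erefl); apply: eq_bigr => z _.
by rewrite /= subr0 sub0r sqrrN.
Qed.

Let ImD : {morph @complex.Im R : x y / x + y}.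
Proof. by case=> a b [c d]. Qed.

Lemma trace_resolvent_Im :
  complex.Im (\sum_i resolvent eta A i i) =
  \sum_(z <- eigenvalues A) eta / (z ^+ 2 + eta ^+ 2).
Proof.
rewrite trace_resolvent (big_morph _ ImD erefl); apply: eq_bigr => z _.
by rewrite /= subr0 sub0r sqrrN mulNr opprK.
Qed.

End spectrum.

(** * Polynomial approximation *)

Lemma bounded_funP (R : realType) (f : R -> R) :
  bounded_fun f <-> exists M : R, forall x, `|f x| <= M.
Proof.
split=> [[M [_ h]]|[M h]].
  by exists (M + 1) => x; apply: (h (M + 1)) => //; rewrite ltrDl.
exists M; split; first exact: num_real.
by move=> M' MM' x _ /=; exact: le_trans (h x) (ltW MM').
Qed.

Section heine.
Context {R : realType}.

Lemma continuous_epsdelta (f : R -> R) (x e : R) : {for x, continuous f} -> 0 < e ->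
  exists2 d : R, 0 < d & forall z : R, `|x - z| < d -> `|f x - f z| < e.
Proof.
move=> fx e0; have /cvgrPdist_lt/(_ e e0) : f @ x --> f x := fx.
by case=> d /= d0 h; exists d => // z xz; exact: (h z).
Qed.

Lemma heine_segment (f : R -> R) (a b e : R) : continuous f -> 0 < e ->
  exists2 d : R, 0 < d & forall x z : R, a <= x <= b -> `|x - z| < d -> `|f x - f z| < e.
Proof.
move=> cf e0.
have /compact_near_coveringP/(_ R (0^'+)
    (fun d x => forall z : R, `|x - z| < d -> `|f x - f z| < e) _) := @segment_compact R a b.
case=> [x _|d /= d0 h].
  have [r r0 xr] := continuous_epsdelta (cf x) (divr_gt0 e0 (ltr0n R 2)).
  exists (ball x (r / 2), [set d | 0 < d < r / 2]).
    split => /=; first by apply: nbhsx_ballx; rewrite divr_gt0.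
    exists (r / 2) => /=; first by rewrite divr_gt0.
    by move=> t /=; rewrite sub0r normrN => h t0; rewrite t0/= (le_lt_trans (ler_norm _)).
  move=> [x' d] /= [xx' /andP[d0 dr]] z x'z.
  have h1 : `|f x - f x'| < e / 2 by apply: xr; apply: lt_trans xx' _; lra.
  have h2 : `|f x - f z| < e / 2.
    apply: xr; rewrite (_ : x - z = (x - x') + (x' - z)); last by ring.
    rewrite (le_lt_trans (ler_normD _ _))//; move: xx'; rewrite /ball /= => xx'.
    by lra.
  rewrite (_ : f x' - f z = (f x - f z) - (f x - f x')); last by ring.
  by rewrite (le_lt_trans (ler_normB _ _))//; lra.
exists (d / 2); first by rewrite divr_gt0.
move=> x z xab xz; apply: (h (d / 2)) => //=.
- by rewrite sub0r normrN gtr0_norm ?divr_gt0//; move: d0 => /=; lra.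
- by rewrite divr_gt0.
Qed.

Lemma continuous_bounded_segment (f : R -> R) (a b : R) : continuous f ->
  exists2 M : R, 0 <= M & forall x : R, a <= x <= b -> `|f x| <= M.
Proof.
move=> cf; have [ab|ba] := leP a b; last first.
  by exists 0 => // x /andP[ax xb]; have := le_lt_trans (le_trans ax xb) ba; rewrite ltxx.
have cn : {within `[a, b], continuous (fun x => `|f x|)}.
  apply: continuous_subspaceT => x; apply: continuous_comp; first exact: cf.
  exact: norm_continuous.
have [c _ h] := EVT_max ab cn.
by exists `|f c| => // x xab; apply: h; rewrite in_itv.
Qed.

End heine.

Section bernstein.
Context {R : realType}.

(** [coin_mean n x phi] is the expectation of [phi] at the number of heads in [n]
    tosses of a coin of bias [x], computed toss by toss; as a function of [x] it
    is the [n]-th Bernstein polynomial of [phi]. *)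
Fixpoint coin_mean (n : nat) (x : R) (phi : nat -> R) : R :=
  if n is m.+1 then (1 - x) * coin_mean m x phi + x * coin_mean m x (phi \o S)
  else phi 0%N.

Fixpoint bernstein (n : nat) (phi : nat -> R) : {poly R} :=
  if n is m.+1 then (1 - 'X) * bernstein m phi + 'X * bernstein m (phi \o S)
  else (phi 0%N)%:P.

Lemma horner_bernstein n phi x : (bernstein n phi).[x] = coin_mean n x phi.
Proof.
by elim: n phi => [|n ih] phi /=; rewrite ?hornerC// !hornerE !ih.
Qed.

Lemma coin_mean_le n x phi psi : 0 <= x <= 1 ->
  (forall k, (k <= n)%N -> phi k <= psi k) -> coin_mean n x phi <= coin_mean n x psi.
Proof.
move=> /andP[x0 x1]; elim: n phi psi => [|n ih] phi psi h /=; first exact: h.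
rewrite lerD// ler_wpM2l ?subr_ge0//; apply: ih => k kn; apply: h => //.
exact: leqW.
Qed.

Lemma coin_mean_lin n x c phi psi :
  coin_mean n x (fun k => c * phi k + psi k) = c * coin_mean n x phi + coin_mean n x psi.
Proof.
elim: n phi psi => [//|n ih] phi psi /=.
by rewrite /comp !ih; ring.
Qed.

Lemma coin_mean_cst n x c : coin_mean n x (fun=> c) = c.
Proof. by elim: n => [//|n ih] /=; rewrite /comp !ih; ring. Qed.

(** The variance of the number of heads, which is all that Chebyshev's inequality
    needs. *)
Lemma coin_mean_sqr n x c :
  coin_mean n x (fun k => (k%:R - c) ^+ 2) = n%:R * x * (1 - x) + (n%:R * x - c) ^+ 2.
Proof.
elim: n c => [|n ih] c /=; first by ring.
have -> : (fun k : nat => (k%:R - c) ^+ 2) \o S = (fun k : nat => (k%:R - (c - 1)) ^+ 2).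
  by apply/funext => k /=; congr (_ ^+ 2); rewrite -natr1; ring.
by rewrite !ih -natr1; ring.
Qed.

(** Bernstein's proof: [f] varies little where the frequency of heads is within
    [d] of [x], and elsewhere its oscillation is dominated by a multiple of the
    squared deviation, whose mean is of order [1 / n]. *)
Lemma weierstrass01 (f : R -> R) (e : R) : continuous f -> 0 < e ->
  exists p : {poly R}, forall x : R, 0 <= x <= 1 -> `|f x - p.[x]| <= e.
Proof.
move=> cf e0.
have [d d0 hd] := heine_segment 0 1 cf (divr_gt0 e0 (ltr0n R 2)).
have [M M0 hM] := continuous_bounded_segment 0 1 cf.
have [n n0 hn] : exists2 n : nat, (0 < n)%N & 2 * M / d ^+ 2 <= e / 2 * n%:R.
  have X0 : 0 <= 2 * M / d ^+ 2 / (e / 2).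
    apply: divr_ge0; last by rewrite divr_ge0// ltW.
    by apply: divr_ge0; [exact: mulr_ge0|exact: sqr_ge0].
  have := archi_boundP X0; set B := Num.Def.archi_bound _; rewrite ltr_pdivrMr ?divr_gt0// => hB.
  exists B.+1 => //; rewrite (le_trans (ltW hB))// mulrC ler_wpM2l ?divr_ge0 ?(ltW e0)//.
  by rewrite ler_nat.
have nR0 : 0 < n%:R :> R by rewrite ltr0n.
pose phi (k : nat) := f (k%:R / n%:R); exists (bernstein n phi) => x x01.
rewrite horner_bernstein.
pose psi (k : nat) := 2 * M / d ^+ 2 / n%:R ^+ 2 * (k%:R - n%:R * x) ^+ 2 + e / 2.
have dev (k : nat) : (k <= n)%N -> `|f x - phi k| <= psi k.
  move=> kn; have kn01 : 0 <= (k%:R / n%:R : R) <= 1.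
    by rewrite divr_ge0// ler_pdivrMr// mul1r ler_nat.
  have [xk|xk] := ltP `|x - k%:R / n%:R| d.
    rewrite (le_trans (ltW (hd _ _ x01 xk)))// lerDr mulr_ge0 ?sqr_ge0//.
    by rewrite !divr_ge0 ?sqr_ge0// mulr_ge0.
  rewrite (le_trans (ler_normB _ _))//.
  apply: (@le_trans _ _ (2 * M)); first by rewrite mulr_natl mulr2n lerD// hM.
  apply: (@le_trans _ _ (2 * M / d ^+ 2 / n%:R ^+ 2 * (k%:R - n%:R * x) ^+ 2)); last first.
    by rewrite lerDl divr_ge0// ltW.
  rewrite (_ : 2 * M / d ^+ 2 / _ * _ = 2 * M / d ^+ 2 * (x - k%:R / n%:R) ^+ 2); last first.
    by field; rewrite !gt_eqF.
  rewrite mulrAC ler_pdivlMr ?exprn_gt0// ler_wpM2l ?mulr_ge0//.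
  by rewrite -[leRHS]real_normK ?num_real// ler_pXn2r// ?nnegrE// ltW.
have up : coin_mean n x psi <= e.
  rewrite /psi coin_mean_lin coin_mean_cst coin_mean_sqr subrr expr0n addr0.
  have -> : 2 * M / d ^+ 2 / n%:R ^+ 2 * (n%:R * x * (1 - x)) =
     (2 * M / d ^+ 2 / n%:R) * (x * (1 - x)) by field; rewrite !gt_eqF.
  have h1 : 2 * M / d ^+ 2 / n%:R <= e / 2 by rewrite ler_pdivrMr.
  have h0 : 0 <= 2 * M / d ^+ 2 / n%:R by rewrite !divr_ge0 ?sqr_ge0 ?mulr_ge0// ltW.
  by case/andP: x01 => x0 x1; nra.
rewrite ler_norml; apply/andP; split.
  rewrite lerNl opprB (le_trans _ up)// -subr_le0.
  have -> : coin_mean n x phi - f x - coin_mean n x psi = 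
     coin_mean n x (fun k => 1 * phi k + (-1 * psi k + - f x)).
    by rewrite (coin_mean_lin n x 1 phi) (coin_mean_lin n x (-1) psi (fun=> - f x)) coin_mean_cst; ring.
  apply: (@le_trans _ _ (coin_mean n x (fun=> 0))); last by rewrite coin_mean_cst.
  by apply: coin_mean_le => // k kn; have := dev k kn; rewrite ler_norml => /andP[]; lra.
rewrite (le_trans _ up)// -subr_ge0.
have -> : coin_mean n x psi - (f x - coin_mean n x phi) =
     coin_mean n x (fun k => 1 * psi k + (1 * phi k + - f x)).
  by rewrite (coin_mean_lin n x 1 psi) (coin_mean_lin n x 1 phi (fun=> - f x)) coin_mean_cst; ring.
apply: (@le_trans _ _ (coin_mean n x (fun=> 0))); first by rewrite coin_mean_cst.
by apply: coin_mean_le => // k kn; have := dev k kn; rewrite ler_norml => /andP[]; lra.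
Qed.

Lemma weierstrass (f : R -> R) (a b e : R) : continuous f -> a < b -> 0 < e ->
  exists p : {poly R}, forall x : R, a <= x <= b -> `|f x - p.[x]| <= e.
Proof.
move=> cf ab e0; have ba : 0 < b - a by rewrite subr_gt0.
have cg : continuous (fun t : R => f (a + (b - a) * t)).
  move=> t; apply: continuous_comp; last exact: cf.
  by apply: cvgD; [exact: cvg_cst|apply: cvgM; [exact: cvg_cst|exact: cvg_id]].
have [p hp] := weierstrass01 cg e0.
exists (p \Po ((b - a)^-1 *: ('X - a%:P))) => x /andP[ax xb].
rewrite horner_comp !hornerE.
have := hp ((b - a)^-1 * (x - a)).
have -> : a + (b - a) * ((b - a)^-1 * (x - a)) = x by field; rewrite gt_eqF.
apply.
by rewrite mulr_ge0 ?invr_ge0 ?subr_ge0 ?(ltW ab)//= ler_pdivrMl// mulr1 lerD2r.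
Qed.

End bernstein.

(** * Resolvent functions determine test functions *)

(** In names, [u] and [xu] refer to the functions [1 / (x^2 + s)] and [x / (x^2 + s)],
    the imaginary and real parts of [1 / (x - i sqrt s)] up to a factor. *)
Section resolvent_density.
Context {R : realType}.
Variables (Cls : (R -> R) -> Prop) (s0 : R).
Hypotheses (s0_ge1 : 1 <= s0)
  (Cls_lin : forall (c : R) f g, Cls f -> Cls g -> Cls (fun x => c * f x + g x))
  (Cls_closed : forall f : R -> R, (forall e : R, 0 < e ->
     exists2 g : R -> R, Cls g & forall x, `|f x - g x| <= e) -> Cls f)
  (Cls1 : Cls (fun=> 1))
  (Cls_u : forall s : R, s0 <= s -> Cls (fun x => (x ^+ 2 + s)^-1))
  (Cls_xu : forall s : R, s0 <= s -> Cls (fun x => x * (x ^+ 2 + s)^-1)).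

(** The parameter [t >= 0] measures how far the spectral parameter lies beyond [s0]. *)
Let a (t x : R) : R := (x ^+ 2 + s0 + t)^-1.

Let den_gt0 (t x : R) : 0 <= t -> 1 <= x ^+ 2 + s0 + t.
Proof. by move=> t0; have := sqr_ge0 x; have := s0_ge1; lra. Qed.

Let a_ge0 (t x : R) : 0 <= t -> 0 <= a t x.
Proof. by move=> t0; rewrite invr_ge0 (le_trans ler01)// den_gt0. Qed.

Let a_le1 (t x : R) : 0 <= t -> a t x <= 1.
Proof. by move=> t0; rewrite invf_le1 ?den_gt0// (lt_le_trans ltr01)// den_gt0. Qed.

Let aB (t h x : R) : 0 <= t -> 0 <= h -> a t x - a (t + h) x = h * a t x * a (t + h) x.
Proof.
move=> t0 h0; have d1 := den_gt0 x t0; have d2 := den_gt0 x (addr_ge0 t0 h0).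
by rewrite /a; field; rewrite addrA !gt_eqF//; lra.
Qed.

Let subXX_le (u v : R) n : 0 <= v -> v <= u -> u <= 1 -> 0 <= u ^+ n - v ^+ n <= n%:R * (u - v).
Proof.
move=> v0 vu u1; have u0 := le_trans v0 vu.
elim: n => [|n /andP[ih1 ih2]]; first by rewrite !expr0 subrr mul0r lexx.
have un0 : 0 <= u ^+ n by exact: exprn_ge0.
have un1 : u ^+ n <= 1 by exact: exprn_ile1.
have -> : u ^+ n.+1 - v ^+ n.+1 = u ^+ n * (u - v) + v * (u ^+ n - v ^+ n).
  by rewrite !exprSr; ring.
rewrite -natr1 mulrDl mul1r; apply/andP; split.
  by rewrite addr_ge0// mulr_ge0// subr_ge0.
rewrite addrC lerD//.
  by rewrite (le_trans _ ih2)// ler_piMl// (le_trans vu).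
by rewrite ler_piMl// subr_ge0.
Qed.

(** The powers of [1 / (x^2 + s)] come from its derivatives in [s], that is, from
    limits of difference quotients. *)
Let Cls_pow (q : R -> R) : (forall x, `|q x| * a 0 x <= 1) ->
  (forall t : R, 0 <= t -> Cls (fun x => q x * a t x)) ->
  forall n t, 0 <= t -> Cls (fun x => q x * a t x ^+ n.+1).
Proof.
move=> q1 Cq; elim=> [|n ih] t t0; first exact: Cq.
apply: Cls_closed => e e0; pose h := e / n.+1%:R.
have n0 : 0 < n.+1%:R :> R by rewrite ltr0n.
have h0 : 0 < h by rewrite divr_gt0.
exists (fun x => (n.+1%:R * h)^-1 * (q x * a t x ^+ n.+1) +
   (- (n.+1%:R * h)^-1 * (q x * a (t + h) x ^+ n.+1) + 0)).
  apply: Cls_lin; first exact: ih.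
  have C0 : Cls (fun=> 0 : R).
    apply: (Cls_closed) => d d0; exists (fun x => -1 * 1 + 1); first exact: (Cls_lin _ Cls1 Cls1).
    by move=> x; rewrite (_ : 0 - _ = 0); [rewrite normr0 ltW|ring].
  by apply: Cls_lin => //; apply: ih; rewrite addr_ge0// ltW.
move=> x; set u := a t x; set v := a (t + h) x.
have uv : u - v = h * u * v by apply: aB; rewrite // ltW.
have th0 : 0 <= t + h by rewrite addr_ge0// ltW.
have v0 : 0 <= v by exact: a_ge0.
have u0 : 0 <= u by exact: a_ge0.
have u1 : u <= 1 by exact: a_le1.
have v1 : v <= 1 by exact: a_le1.
have vu : v <= u by rewrite -subr_ge0 uv !mulr_ge0// ltW.
have qu : `|q x| * u <= 1.
  apply: le_trans (q1 x); rewrite ler_wpM2l// lef_pV2 ?posrE ?(lt_le_trans ltr01 (den_gt0 _ _))//.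
  by rewrite lerD2l.
have -> : q x * u ^+ n.+2 - ((n.+1%:R * h)^-1 * (q x * u ^+ n.+1) +
    (- (n.+1%:R * h)^-1 * (q x * v ^+ n.+1) + 0)) =
  n.+1%:R^-1 * \sum_(i < n.+1) q x * u * (u ^+ (n - i) * (u ^+ i.+1 - v ^+ i.+1)).
  have -> : (n.+1%:R * h)^-1 * (q x * u ^+ n.+1) + (- (n.+1%:R * h)^-1 * (q x * v ^+ n.+1) + 0) =
     (n.+1%:R * h)^-1 * q x * (u ^+ n.+1 - v ^+ n.+1) by ring.
  rewrite subrXX uv.
  have -> : (n.+1%:R * h)^-1 * q x * (h * u * v * \sum_(i < n.+1) u ^+ (n.+1.-1 - i) * v ^+ i) =
     n.+1%:R^-1 * (q x * u * v * \sum_(i < n.+1) u ^+ (n.+1.-1 - i) * v ^+ i).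
    by field; rewrite !gt_eqF.
  have -> : q x * u ^+ n.+2 = n.+1%:R^-1 * (n.+1%:R * (q x * u ^+ n.+2)) by rewrite mulKf ?gt_eqF.
  rewrite -mulrBr; congr (_ * _).
  rewrite mulr_natl -[X in _ *+ X - _](card_ord n.+1) -sumr_const mulr_sumr -sumrB.
  apply: eq_bigr => i _ /=; have := ltn_ord i; rewrite ltnS => ni.
  rewrite -{1}(subnK ni) -!addnS exprD !exprS; ring.
rewrite normrM gtr0_norm ?invr_gt0// ler_pdivrMl//.
rewrite (le_trans (ler_norm_sum _ _ _))//.
apply: (@le_trans _ _ (\sum_(i < n.+1) e)); last by rewrite sumr_const card_ord mulr_natl.
apply: ler_sum => i _.
have /andP[d0 d1] := subXX_le i.+1 v0 vu u1.
have un1 : u ^+ (n - i) <= 1 by exact: exprn_ile1.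
have un0 : 0 <= u ^+ (n - i) by exact: exprn_ge0.
rewrite normrM [`|q x * u|]normrM (ger0_norm u0) (ger0_norm (mulr_ge0 un0 d0)).
have le1 : u ^+ (n - i) * (u ^+ i.+1 - v ^+ i.+1) <= e.
  apply: (@le_trans _ _ (u ^+ i.+1 - v ^+ i.+1)); first by rewrite ler_piMl.
  apply: (le_trans d1); apply: (@le_trans _ _ (n.+1%:R * h)); last first.
    by rewrite /h mulrCA mulfV ?mulr1 ?gt_eqF.
  apply: ler_pM => //; [by rewrite subr_ge0|by rewrite ler_nat|].
  by rewrite uv -mulrA ler_piMr ?(ltW h0)// mulr_ile1.
rewrite -[leRHS]mul1r ler_pM// ?mulr_ge0//.
Qed.

Let u x : R := a 0 x.

Let Cls_q_poly (q : R -> R) : (forall x, `|q x| * a 0 x <= 1) ->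
  (forall t : R, 0 <= t -> Cls (fun x => q x * a t x)) ->
  forall (p : {poly R}) n, Cls (fun x => q x * u x ^+ n.+1 * p.[u x]).
Proof.
move=> q1 Cq; elim/poly_ind => [|p c ih] n.
  have := Cls_lin (-1) (Cq 0 (lexx 0)) (Cq 0 (lexx 0)).
  by congr Cls; apply/funext => x; rewrite horner0; ring.
have := Cls_lin c (Cls_pow q1 Cq n (lexx 0)) (ih n.+1).
by congr Cls; apply/funext => x; rewrite hornerD hornerM hornerX hornerC /u (exprS _ n.+1); ring.
Qed.

Let Cls_even (p : {poly R}) : Cls (fun x => p.[u x]).
Proof.
elim/poly_ind: p => [|p c _].
  have := Cls_lin (-1) Cls1 Cls1.
  by congr Cls; apply/funext => x; rewrite horner0; ring.
have q1 x : `|1| * a 0 x <= 1 :> R by rewrite normr1 mul1r a_le1.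
have Cq t : 0 <= t -> Cls (fun x => 1 * a t x).
  move=> t0; have := @Cls_u (s0 + t); rewrite lerDl => /(_ t0).
  by congr Cls; apply/funext => x; rewrite /a mul1r addrA.
have := Cls_lin c Cls1 (Cls_q_poly q1 Cq p 0).
by congr Cls; apply/funext => x; rewrite !hornerE; ring.
Qed.

Let Cls_odd (p : {poly R}) : Cls (fun x => x * u x * p.[u x]).
Proof.
have q1 (x : R) : `|x| * a 0 x <= 1.
  rewrite ler_pdivrMr; last by rewrite (lt_le_trans ltr01)// den_gt0.
  rewrite -real_normK ?num_real//; have := s0_ge1; have := sqr_ge0 (`|x| - 1); nra.
have Cq t : 0 <= t -> Cls (fun x => x * a t x).
  move=> t0; have := @Cls_xu (s0 + t); rewrite lerDl => /(_ t0).
  by congr Cls; apply/funext => x; rewrite /a addrA.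
by have := Cls_q_poly q1 Cq p 0; congr Cls; apply/funext => x; rewrite expr1.
Qed.

Let u_gt0 x : 0 < u x.
Proof. by rewrite invr_gt0 (lt_le_trans ltr01)// den_gt0. Qed.

Let u01 x : 0 <= u x <= 1. Proof. by rewrite a_ge0//= a_le1. Qed.

(** An even function vanishing near infinity is a continuous function of
    [1 / (x^2 + s0)], hence a uniform limit of polynomials in it. *)
Let even_approx (f : R -> R) (B e : R) : continuous f -> 0 < B ->
  (forall x : R, B <= `|x| -> f x = 0) -> (forall x, f (- x) = f x) -> 0 < e ->
  exists p : {poly R}, forall x, `|f x - p.[u x]| <= e.
Proof.
move=> cf B0 fB fN e0; pose y0 := (B ^+ 2 + s0)^-1.
have y0_gt0 : 0 < y0.
  by rewrite invr_gt0; have := den_gt0 B (lexx 0); rewrite addr0; lra.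
pose g y := f (Num.sqrt ((Num.max y y0)^-1 - s0)).
have cg : continuous g.
  move=> y; apply: continuous_comp; last exact: cf.
  apply: continuous_comp; last exact: sqrt_continuous.
  apply: (@continuousB _ _ _ (fun y => (Num.max y y0)^-1) (fun=> s0)); last exact: cvg_cst.
  apply: (@continuousV _ _ (fun y => Num.max y y0)).
    by rewrite gt_eqF// lt_max y0_gt0 orbT.
  by apply: (@continuous_max _ _ id (cst y0)); [exact: cvg_id|exact: cvg_cst].
have fabs x : f `|x| = f x by have [//|_] := ger0P x; rewrite fN.
have gu x : g (u x) = f x.
  rewrite /g; have [ux|ux] := leP y0 (u x).
    by rewrite /u /a addr0 invrK addrK sqrtr_sqr fabs.
  have Bx : B <= `|x|.
    rewrite leNgt; apply/negP => xB; move: ux; apply/negP; rewrite -leNgt.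
    have xs0 : 0 < x ^+ 2 + s0 by have := den_gt0 x (lexx 0); rewrite addr0; lra.
    have Bs0 : 0 < B ^+ 2 + s0 by have := den_gt0 B (lexx 0); rewrite addr0; lra.
    rewrite /u /a addr0 lef_pV2 ?posrE//.
    rewrite lerD2r -[x ^+ 2]real_normK ?num_real//.
    by rewrite ler_pXn2r ?nnegrE ?(ltW B0) ?(ltW xB).
  by rewrite invrK addrK sqrtr_sqr ger0_norm ?(ltW B0)// !fB// ger0_norm// ltW.
have [p hp] := weierstrass01 cg e0.
by exists p => x; rewrite -gu; exact: hp.
Qed.

(** The even part of [f] is a limit of polynomials in [u = 1 / (x^2 + s0)]. The odd
    part is [x u k] with [k] even; [k] may be singular at the origin, where [f]
    is small, and regularizing it there costs little. *)
Lemma resolvent_density (f : R -> R) (B : R) : continuous f -> 0 < B ->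
  (forall x : R, B <= `|x| -> f x = 0) -> Cls f.
Proof.
move=> cf B0 fB.
have cfN : continuous (fun x => f (- x)).
  by move=> x; apply: continuous_comp; [exact: continuousN|exact: cf].
pose fe x := 2^-1 * (f x + f (- x)); pose fo x := 2^-1 * (f x - f (- x)).
have cfe : continuous fe.
  by move=> x; apply: cvgM; [exact: cvg_cst|apply: cvgD; [exact: cf|exact: cfN]].
have cfo : continuous fo.
  by move=> x; apply: cvgM; [exact: cvg_cst|apply: cvgB; [exact: cf|exact: cfN]].
have feB x : B <= `|x| -> fe x = 0.
  by move=> Bx; rewrite /fe !fB ?normrN// addr0 mulr0.
have foB x : B <= `|x| -> fo x = 0.
  by move=> Bx; rewrite /fo !fB ?normrN// subr0 mulr0.
have Cfe : Cls fe.
  apply: Cls_closed => e e0.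
  have [|p hp] := even_approx cfe B0 feB _ e0; first by move=> x; rewrite /fe opprK addrC.
  by exists (fun x => p.[u x]).
suff Cfo : Cls fo.
  by have := Cls_lin 1 Cfe Cfo; congr Cls; apply/funext => x; rewrite /fe /fo; field.
apply: Cls_closed => e e0.
have fo0 : fo 0 = 0 by rewrite /fo oppr0 subrr mulr0.
have [r r0 hr] := continuous_epsdelta (cfo 0) (divr_gt0 e0 (ltr0n R 2)).
have [M M0 hM] := continuous_bounded_segment (- B) B cfo.
have foM x : `|fo x| <= M.
  have [xB|Bx] := ltP `|x| B; last by rewrite foB// normr0.
  by apply: hM; move: xB; rewrite ltr_norml => /andP[/ltW -> /ltW ->].
(* With this [d] the factor [d / (x^2 + d)] is below [e / (2 M)] once [|x| >= r]. *)
pose d := e / 2 * r ^+ 2 / (M + 1).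
have d0 : 0 < d by rewrite divr_gt0 ?mulr_gt0 ?divr_gt0 ?exprn_gt0// ltr_wpDl.
have xd x : 0 < x ^+ 2 + d by rewrite ltr_wpDl ?sqr_ge0.
pose k x := x * fo x / (x ^+ 2 + d) * (x ^+ 2 + s0).
have ck : continuous k.
  move=> x; apply: cvgM; first apply: cvgM; first apply: cvgM.
  - exact: cvg_id.
  - exact: cfo.
  - apply: cvgV; first by rewrite gt_eqF.
    by apply: cvgD; [exact: exprn_continuous|exact: cvg_cst].
  - by apply: cvgD; [exact: exprn_continuous|exact: cvg_cst].
have kB x : B <= `|x| -> k x = 0 by move=> Bx; rewrite /k foB// mulr0 !mul0r.
have kN x : k (- x) = k x by rewrite /k /fo !sqrrN opprK; field; rewrite gt_eqF.
have [p hp] := even_approx ck B0 kB kN (divr_gt0 e0 (ltr0n R 2)).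
exists (fun x => x * u x * p.[u x]) => // x.
have xu1 : `|x * u x| <= 1.
  rewrite normrM (ger0_norm (ltW (u_gt0 x))) ler_pdivrMr; last by rewrite (lt_le_trans ltr01)// den_gt0.
  rewrite -real_normK ?num_real//; have := s0_ge1; have := sqr_ge0 (`|x| - 1); nra.
have h1 : `|x * u x * k x - x * u x * p.[u x]| <= e / 2.
  by rewrite -mulrBr normrM -[leRHS]mul1r ler_pM.
have h2 : `|fo x - x * u x * k x| <= e / 2.
  have -> : fo x - x * u x * k x = fo x * (d / (x ^+ 2 + d)).
    have := den_gt0 x (lexx 0); rewrite addr0 => dd.
    rewrite /k /u /a addr0; field; rewrite !gt_eqF//; lra.
  have dge : 0 <= d / (x ^+ 2 + d) := divr_ge0 (ltW d0) (ltW (xd x)).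
  rewrite normrM [`|d / _|]ger0_norm//.
  have [xr|rx] := ltP `|x| r.
    have := hr x; rewrite sub0r normrN => /(_ xr); rewrite fo0 sub0r normrN => /ltW fe2.
    rewrite -[leRHS]mulr1; apply: ler_pM => //.
    by rewrite ler_pdivrMr// mul1r lerDr sqr_ge0.
  apply: (@le_trans _ _ (M * (d / r ^+ 2))).
    apply: ler_pM => //; rewrite ler_pM2l//.
    have rx2 : r ^+ 2 <= x ^+ 2.
      by rewrite -[leRHS]real_normK ?num_real// ler_pXn2r ?nnegrE ?(ltW r0).
    rewrite lef_pV2 ?posrE ?exprn_gt0//; apply: (le_trans rx2).
    by rewrite lerDl ltW.
  have -> : M * (d / r ^+ 2) = e / 2 * (M / (M + 1)).
    by rewrite /d; field; rewrite !gt_eqF// ltr_wpDl.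
  by rewrite ler_piMr ?divr_ge0 ?(ltW e0)// ler_pdivrMr ?mul1r ?lerDl// ltr_wpDl.
rewrite (_ : fo x - _ = (fo x - x * u x * k x) + (x * u x * k x - x * u x * p.[u x])); last by ring.
by rewrite (le_trans (ler_normD _ _))//; lra.
Qed.

End resolvent_density.

(** * Integrals over a half disk *)

Section derivation_rules.
Context {R : realType}.
Implicit Types (f g : R -> R) (x df dg : R).

Lemma is_derive_mul f g x df dg : is_derive x 1 f df -> is_derive x 1 g dg ->
  is_derive x 1 (fun t => f t * g t) (df * g x + f x * dg).
Proof.
move=> hf hg; have := is_deriveM hf hg.
by rewrite addrC /GRing.scale /= [g x * df]mulrC.
Qed.

Lemma is_derive_add f g x df dg : is_derive x 1 f df -> is_derive x 1 g dg ->
  is_derive x 1 (fun t => f t + g t) (df + dg).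
Proof. by move=> hf hg; exact: is_deriveD. Qed.

Lemma is_derive_scale f x c df : is_derive x 1 f df ->
  is_derive x 1 (fun t => c * f t) (c * df).
Proof. by move=> hf; exact: (is_deriveZ c hf). Qed.

Lemma is_derive_sqrt_comp f x df : 0 < f x -> is_derive x 1 f df ->
  is_derive x 1 (fun t => Num.sqrt (f t)) (df / (2 * Num.sqrt (f x))).
Proof.
by move=> f0 hf; rewrite mulrC; apply: is_derive1_comp; exact: is_derive1_sqrt.
Qed.

Lemma is_derive_inv f x df : f x != 0 -> is_derive x 1 f df ->
  is_derive x 1 (fun t => (f t)^-1) (- df / f x ^+ 2).
Proof.
move=> f0 hf; have := is_deriveV f0 hf; rewrite /GRing.scale /=.
by rewrite -exprVn mulNr -mulrN mulrC mulNr -mulrN mulrC.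
Qed.

Lemma is_derive_val f x df df' : is_derive x 1 f df -> df = df' -> is_derive x 1 f df'.
Proof. by move=> h <-. Qed.

(** The derivative of the angle of the point [(q, p)], written with the half-angle
    formula so that it stays smooth up to [q = 0]. *)
Lemma is_derive_angle (p q r : R -> R) x dp dq dr :
  is_derive x 1 p dp -> is_derive x 1 q dq -> is_derive x 1 r dr ->
  0 < r x -> 0 <= q x -> p x ^+ 2 + q x ^+ 2 = r x ^+ 2 ->
  p x * dp + q x * dq = r x * dr ->
  is_derive x 1 (fun t => 2 * atan (p t / (r t + q t))) ((dp * q x - p x * dq) / r x ^+ 2).
Proof.
move=> hp hq hr r0 q0 pq dpq; have rq0 : 0 < r x + q x by rewrite ltr_pwDl.
have h1 := @is_derive_inv (fun t => r t + q t) _ _ (lt0r_neq0 rq0) (is_derive_add hr hq).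
have h2 := is_derive_mul hp h1.
have := is_derive_scale 2 (is_derive1_comp (is_derive1_atan _) h2).
have -> //: 2 * ((1 + (p x / (r x + q x)) ^+ 2)^-1 * (dp / (r x + q x) + p x * (- (dr + dq) / (r x + q x) ^+ 2)))
  = (dp * q x - p x * dq) / r x ^+ 2.
have E : 1 + (p x / (r x + q x)) ^+ 2 = 2 * r x / (r x + q x).
  have p2 : p x ^+ 2 = r x ^+ 2 - q x ^+ 2 by rewrite -pq addrK.
  by rewrite expr_div_n p2; field; rewrite gt_eqF.
have dr' : dr = (p x * dp + q x * dq) / r x by rewrite dpq mulrC mulKf ?gt_eqF.
rewrite E dr'.
have p2 : p x ^+ 2 = r x ^+ 2 - q x ^+ 2 by rewrite -pq addrK.
transitivity ((dp * (r x * (r x + q x)) - p x ^+ 2 * dp - p x * q x * dq - p x * r x * dq) / (r x ^+ 2 * (r x + q x))).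
  by field; rewrite !gt_eqF.
by rewrite p2; field; rewrite !gt_eqF.
Qed.

End derivation_rules.

Section semicircle_primitives.
Context {R : realType}.
Variable a : R.
Hypothesis a_gt0 : 0 < a.

Let Q (x : R) := Num.sqrt (a ^+ 2 - x ^+ 2).

Let cQ : continuous Q.
Proof.
move=> x; apply: continuous_comp; last exact: sqrt_continuous.
by apply: cvgB; [exact: cvg_cst|exact: exprn_continuous].
Qed.

Let in_oo (x : R) : x \in `]- a, a[ -> 0 < a ^+ 2 - x ^+ 2.
Proof.
rewrite in_itv/= => /andP[ax xa]; rewrite subr_sqr mulr_gt0//; lra.
Qed.

Let dX (x : R) : is_derive x 1 (fun t : R => t ^+ 2) (2 * x).
Proof.
have := is_deriveX 2 (is_derive_id x (1 : R)); rewrite /GRing.scale /= mulr1 expr1.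
by [].
Qed.

Let dQ (x : R) : x \in `]- a, a[ -> is_derive x 1 Q (- x / Q x).
Proof.
move=> xa; have x0 := in_oo xa.
have h := is_derive_add (is_derive_cst (a ^+ 2) x 1) (is_derive_scale (-1) (dX x)).
have hf : (fun t : R => a ^+ 2 + -1 * t ^+ 2) = (fun t => a ^+ 2 - t ^+ 2).
  by apply/funext => t; rewrite mulN1r.
rewrite /= hf in h; have := @is_derive_sqrt_comp _ (fun t => a ^+ 2 - t ^+ 2) _ _ x0 h.
rewrite -/(Q x) (_ : _ / _ = - x / Q x)//.
by field; rewrite gt_eqF// sqrtr_gt0.
Qed.

Let Q2 (x : R) : x \in `]- a, a[ -> Q x ^+ 2 = a ^+ 2 - x ^+ 2.
Proof. by move=> /in_oo/ltW x0; rewrite sqr_sqrtr. Qed.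

Let Qa : Q a = 0. Proof. by rewrite /Q subrr sqrtr0. Qed.
Let QNa : Q (- a) = 0. Proof. by rewrite /Q sqrrN subrr sqrtr0. Qed.

Let Q_ge0 x : 0 <= Q x. Proof. exact: sqrtr_ge0. Qed.

Let Q_gt0 (x : R) : x \in `]- a, a[ -> 0 < Q x.
Proof. by move=> xa; rewrite sqrtr_gt0 in_oo. Qed.

Let angle0 (x : R) := 2 * atan (x / (a + Q x)).

Let dangle0 (x : R) : x \in `]- a, a[ -> is_derive x 1 angle0 (Q x)^-1.
Proof.
move=> xa; have Qx := Q_gt0 xa; have q2 := Q2 xa.
have := is_derive_angle (is_derive_id x 1) (dQ xa) (is_derive_cst a x 1) a_gt0 (Q_ge0 x).
rewrite /= q2 addrC subrK mulr0 => /(_ erefl) h.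
have hx : x * 1 + Q x * (- x / Q x) = 0 by field; rewrite gt_eqF.
have {}h : is_derive x 1 angle0 _ := h hx.
apply: (is_derive_val h).
rewrite (_ : _ / _ = (Q x ^+ 2 + x ^+ 2) / (Q x * a ^+ 2)); last by field; rewrite !gt_eqF.
by rewrite q2 subrK; field; rewrite !gt_eqF.
Qed.

Let aQ_gt0 x : 0 < a + Q x. Proof. by rewrite ltr_pwDl. Qed.

Let cangle0 : continuous angle0.
Proof.
move=> x; apply: cvgM; first exact: cvg_cst.
apply: (@continuous_cvg _ _ _ _ _ _ atan); first exact: continuous_atan.
apply: cvgM; first exact: cvg_id.
by apply: cvgV; [rewrite gt_eqF|apply: cvgD; [exact: cvg_cst|exact: cQ]].
Qed.

Let atan_1 : 2 * atan 1 = pi / 2 :> R.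
Proof. by rewrite atan1; field. Qed.

Let angle0a : angle0 a = pi / 2.
Proof. by rewrite /angle0 Qa addr0 divff ?gt_eqF. Qed.

Let angle0Na : angle0 (- a) = - (pi / 2).
Proof. by rewrite /angle0 QNa addr0 mulNr divff ?gt_eqF// atanN mulrN atan_1. Qed.

(** The integrands have square roots that are not differentiable at the endpoints;
    continuity of the primitive there is enough. *)
Let FTC (F f : R -> R) (y : R) : continuous F -> continuous f ->
  (forall x, x \in `]- a, a[ -> is_derive x 1 F (f x)) -> F a - F (- a) = y ->
  (\int[lebesgue_measure]_(x in `[(- a)%R, a]) (f x)%:E = y%:E)%E.
Proof.
move=> cF cf dF <-; rewrite (@continuous_FTC2 _ f F).
- by rewrite EFinB.
- by rewrite gtrN.
- exact: continuous_subspaceT.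
- split.
  + by move=> x xa; case: (dF x xa).
  + by apply: cvg_at_right_filter; exact: cF.
  + by apply: cvg_at_left_filter; exact: cF.
- by move=> x xa; rewrite derive1E; case: (dF x xa).
Qed.

Lemma integral_half_disk :
  (\int[lebesgue_measure]_(x in `[(- a)%R, a]) (Q x)%:E = (a ^+ 2 * pi / 2)%R%:E)%E.
Proof.
apply: (@FTC (fun x => 2^-1 * (x * Q x) + a ^+ 2 / 2 * angle0 x) Q).
- move=> x; apply: cvgD; apply: cvgM; try exact: cvg_cst.
    by apply: cvgM; [exact: cvg_id|exact: cQ].
  exact: cangle0.
- exact: cQ.
- move=> x xa; have Qx := Q_gt0 xa; have q2 := Q2 xa.
  have h1 := is_derive_scale 2^-1 (is_derive_mul (is_derive_id x 1) (dQ xa)).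
  have h2 := is_derive_scale (a ^+ 2 / 2) (dangle0 xa).
  apply: (is_derive_val (is_derive_add h1 h2)).
  rewrite /= (_ : _ + _ = (Q x ^+ 2 - x ^+ 2 + a ^+ 2) / (2 * Q x)); last by field; rewrite !gt_eqF.
  have -> : Q x ^+ 2 - x ^+ 2 + a ^+ 2 = 2 * Q x ^+ 2 by rewrite q2; ring.
  by field; rewrite !gt_eqF.
- by rewrite Qa QNa angle0a angle0Na; field.
Qed.

Variable eta : R.
Hypothesis eta_gt0 : 0 < eta.

Let c := Num.sqrt (a ^+ 2 + eta ^+ 2).
Let S (x : R) := Num.sqrt (x ^+ 2 + eta ^+ 2).

Let c_gt0 : 0 < c. Proof. by rewrite sqrtr_gt0 ltr_wpDl ?sqr_ge0 ?exprn_gt0. Qed.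
Let c2 : c ^+ 2 = a ^+ 2 + eta ^+ 2. Proof. by rewrite sqr_sqrtr// addr_ge0 ?sqr_ge0. Qed.
Let xe_gt0 (x : R) : 0 < x ^+ 2 + eta ^+ 2. Proof. by rewrite ltr_wpDl ?sqr_ge0 ?exprn_gt0. Qed.
Let S_gt0 x : 0 < S x. Proof. by rewrite sqrtr_gt0. Qed.
Let S2 x : S x ^+ 2 = x ^+ 2 + eta ^+ 2. Proof. by rewrite sqr_sqrtr// ltW. Qed.

Let cxe : continuous (fun x : R => x ^+ 2 + eta ^+ 2).
Proof. by move=> x; apply: cvgD; [exact: exprn_continuous|exact: cvg_cst]. Qed.

Let cS : continuous S.
Proof. by move=> x; apply: continuous_comp; [exact: cxe|exact: sqrt_continuous]. Qed.

Let dS (x : R) : is_derive x 1 S (x / S x).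
Proof.
have h := is_derive_add (dX x) (is_derive_cst (eta ^+ 2) x 1).
apply: (is_derive_val (@is_derive_sqrt_comp _ (fun t => t ^+ 2 + eta ^+ 2) _ _ (xe_gt0 x) h)).
by rewrite -/(S x) addr0; field; rewrite gt_eqF.
Qed.

Let angle1 (x : R) := 2 * atan (c * x / (a * S x + eta * Q x)).

Let dangle1 (x : R) : x \in `]- a, a[ -> is_derive x 1 angle1 (c * eta / (Q x * S x ^+ 2)).
Proof.
move=> xa; have Qx := Q_gt0 xa; have q2 := Q2 xa; have Sx := S_gt0 x.
have h := is_derive_angle (is_derive_scale c (is_derive_id x 1)) (is_derive_scale eta (dQ xa))
   (is_derive_scale a (dS x)) (mulr_gt0 a_gt0 Sx) (mulr_ge0 (ltW eta_gt0) (Q_ge0 x)).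
have e1 : (c * x) ^+ 2 + (eta * Q x) ^+ 2 = (a * S x) ^+ 2.
  by rewrite !exprMn c2 q2 S2; ring.
have e2 : c * x * (c * 1) + eta * Q x * (eta * (- x / Q x)) = a * S x * (a * (x / S x)).
  rewrite (_ : _ + _ = (c ^+ 2 - eta ^+ 2) * x); last by field; rewrite gt_eqF.
  by rewrite c2 addrK; field; rewrite gt_eqF.
apply: (is_derive_val (h e1 e2)).
rewrite /= (_ : _ / _ = c * eta * (Q x ^+ 2 + x ^+ 2) / (Q x * S x ^+ 2 * a ^+ 2)); last first.
  by field; rewrite !gt_eqF.
by rewrite q2 subrK; field; rewrite !gt_eqF.
Qed.

Let den1_gt0 x : 0 < a * S x + eta * Q x.
Proof. by rewrite ltr_pwDl ?mulr_gt0// mulr_ge0// ltW. Qed.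

Let cangle1 : continuous angle1.
Proof.
move=> x; apply: cvgM; first exact: cvg_cst.
apply: (@continuous_cvg _ _ _ _ _ _ atan); first exact: continuous_atan.
apply: cvgM; first by apply: cvgM; [exact: cvg_cst|exact: cvg_id].
apply: cvgV; first by rewrite gt_eqF.
by apply: cvgD; apply: cvgM; [exact: cvg_cst|exact: cS|exact: cvg_cst|exact: cQ].
Qed.

Let cQxe : continuous (fun x => Q x / (x ^+ 2 + eta ^+ 2)).
Proof.
move=> x; apply: cvgM; first exact: cQ.
by apply: cvgV; [rewrite gt_eqF|exact: cxe].
Qed.

Lemma integral_half_disk_u :
  (\int[lebesgue_measure]_(x in `[(- a)%R, a]) (Q x / (x ^+ 2 + eta ^+ 2))%R%:E
   = (pi * (c / eta - 1))%R%:E)%E.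
Proof.
apply: (@FTC (fun x => c / eta * angle1 x + -1 * angle0 x) (fun x => Q x / (x ^+ 2 + eta ^+ 2))).
- move=> x; apply: cvgD; apply: cvgM; try exact: cvg_cst.
    exact: cangle1.
  exact: cangle0.
- exact: cQxe.
- move=> x xa; have Qx := Q_gt0 xa; have q2 := Q2 xa; have Sx := S_gt0 x.
  have h := is_derive_add (is_derive_scale (c / eta) (dangle1 xa)) (is_derive_scale (-1) (dangle0 xa)).
  apply: (is_derive_val h).
  rewrite (_ : _ + _ = (c ^+ 2 - S x ^+ 2) / (Q x * S x ^+ 2)); last first.
    by field; rewrite !gt_eqF.
  rewrite c2 S2 (_ : a ^+ 2 + _ - _ = Q x ^+ 2); last by rewrite q2; ring.
  by field; rewrite !gt_eqF.
- have Sa : S a = c by [].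
  have SNa : S (- a) = c by rewrite /S sqrrN.
  rewrite angle0a angle0Na /angle1 Sa SNa Qa QNa mulr0 addr0 mulrN mulNr.
  have e1 : c * a / (a * c) = 1 by field; rewrite !gt_eqF.
  rewrite [- (c * a) / _]mulNr e1 atanN mulrN atan_1.
  by field; rewrite gt_eqF.
Qed.

(** The integrand is odd. *)
Lemma integral_half_disk_xu :
  (\int[lebesgue_measure]_(x in `[(- a)%R, a]) (x / (x ^+ 2 + eta ^+ 2) * Q x)%R%:E = 0)%E.
Proof.
pose f x := x / (x ^+ 2 + eta ^+ 2) * Q x; rewrite -/(f _).
have cf : continuous f.
  move=> x; apply: cvgM; last exact: cQ.
  apply: cvgM; first exact: cvg_id.
  by apply: cvgV; [rewrite gt_eqF|exact: cxe].
have If : lebesgue_measure.-integrable `[(- a)%R, a]%classic (EFin \o f).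
  apply: continuous_compact_integrable; first exact: segment_compact.
  exact: continuous_subspaceT.
have := @integration_by_substitution_oppr _ f (- a) a _ _; rewrite opprK.
have Na : - a <= a by rewrite ltW// gtrN.
move=> /(_ Na (continuous_subspaceT cf)) E.
have E2 : (\int[lebesgue_measure]_(x in `[(- a)%R, a]) (f x)%:E =
    - \int[lebesgue_measure]_(x in `[(- a)%R, a]) (f x)%:E)%E.
  rewrite {1}E -mulN1e -(integralZl _ If)//.
  by apply: eq_integral => x _; rewrite /= -EFinM mulN1r /f /Q sqrrN !mulNr.
have : (\int[lebesgue_measure]_(x in `[(- a)%R, a]) (f x)%:E)%E \is a fin_num.
  exact: integrable_fin_num If.
move: E2; set I := integral _ _ _; case: I => // r [rr] _; congr EFin; lra.
Qed.

End semicircle_primitives.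

(** * Integration against the semicircle law *)

(** Integration against a measure with density, by monotone approximation with
    simple functions. *)
Section density_integral.
Context {d : measure_display} {T : measurableType d} {R : realType}.
Variables (mu nu : {measure set T -> \bar R}) (p : T -> R).
Hypotheses (mp : measurable_fun [set: T] p) (p_ge0 : forall x, 0 <= p x).
Hypothesis nuE : forall A, measurable A -> nu A = (\int[mu]_(x in A) (p x)%:E)%E.
Import HBNNSimple.
Local Open Scope ereal_scope.

Let integral_density_nnsfun (f : {nnsfun T >-> R}) :
  \int[nu]_x (f x)%:E = \int[mu]_x ((f x)%:E * (p x)%:E).
Proof.
under [LHS]eq_integral do rewrite fimfunE -fsumEFin//.
rewrite [LHS]ge0_integral_fsum//; last 2 first.
  - by move=> r; exact/measurable_EFinP/measurableT_comp.
  - by move=> n x _; rewrite EFinM nnfun_muleindic_ge0.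
under [RHS]eq_integral.
  move=> x xD; rewrite fimfunE -fsumEFin// muleC ge0_mule_fsumr; last first.
    by move=> r; rewrite EFinM nnfun_muleindic_ge0.
  over.
rewrite [RHS]ge0_integral_fsum//; last 2 first.
  - move=> r; apply: emeasurable_funM; first exact/measurable_EFinP.
    exact/measurable_EFinP/measurableT_comp.
  - move=> n x _; apply: mule_ge0; first by rewrite lee_fin.
    by rewrite EFinM nnfun_muleindic_ge0.
apply: eq_fsbigr => r _.
have mf : measurable (f @^-1` [set r]) by exact: measurable_funPTI.
rewrite integralZl_indic_nnsfun// integral_indic// setIT nuE//.
transitivity (\int[mu]_x (r%:E * ((p x)%:E * (\1_(f @^-1` [set r]) x)%:E))); last first.
  by apply: eq_integral => x _; rewrite EFinM muleCA.
have [r0|r0] := leP 0%R r.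
  rewrite ge0_integralZl//; last 2 first.
  - apply: emeasurable_funM; first exact/measurable_EFinP.
    exact/measurable_EFinP.
  - by move=> x _; rewrite mule_ge0// lee_fin.
  congr (_ * _); rewrite [LHS]integral_mkcond; apply: eq_integral => x _.
  rewrite patchE indicE; case: ifPn => xr; rewrite ?mule1 ?mule0//.
have -> : f @^-1` [set r] = set0.
  by rewrite preimage_nnfun0.
rewrite integral_set0 mule0 integral0_eq// => x _.
by rewrite indic0 mule0 mule0.
Qed.

Lemma ge0_integral_density (f : T -> \bar R) :
  measurable_fun [set: T] f -> (forall x, 0 <= f x) ->
  \int[nu]_x f x = \int[mu]_x (f x * (p x)%:E).
Proof.
move=> mf f0; pose f_ := nnsfun_approx measurableT mf.
transitivity (lim (\int[nu]_x (f_ n x)%:E @[n --> \oo])).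
  rewrite -monotone_convergence//=.
  - apply: eq_integral => ? /[!inE] xD; apply/esym/cvg_lim => //=.
    exact: cvg_nnsfun_approx.
  - by move=> n; exact/measurable_EFinP/measurable_funTS.
  - by move=> n ? _; rewrite lee_fin.
  - by move=> ? _ ? ? mn; rewrite lee_fin; exact/lefP/nd_nnsfun_approx.
have -> : \int[mu]_x (f x * (p x)%:E) =
    lim (\int[mu]_x ((f_ n x)%:E * (p x)%:E) @[n --> \oo]).
  rewrite -monotone_convergence//=.
  - apply: eq_integral => x /[!inE] xD; apply/esym/cvg_lim => //=.
    apply: cvgeZr => //; exact: cvg_nnsfun_approx.
  - move=> n; apply: emeasurable_funM; exact/measurable_EFinP/measurable_funTS.
  - by move=> n x _; rewrite mule_ge0// lee_fin.
  - move=> x _ m n mn; rewrite lee_wpmul2r ?lee_fin//; exact/lefP/nd_nnsfun_approx.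
by apply: congr_lim; apply/funext => n /=; exact: integral_density_nnsfun.
Qed.

End density_integral.

Section cutoff.
Context {R : realType}.

(** A continuous function equal to [1] on [[- B, B]] and to [0] outside
    [[- B - 1, B + 1]], used to pass to compactly supported functions. *)
Definition cutoff (B x : R) : R := Num.max 0 (Num.min 1 (B + 1 - `|x|)).

Lemma cutoff_in (B x : R) : `|x| <= B -> cutoff B x = 1.
Proof. by move=> xB; rewrite /cutoff min_l ?max_r//; lra. Qed.

Lemma cutoff_out (B x : R) : B + 1 <= `|x| -> cutoff B x = 0.
Proof. by move=> xB; rewrite /cutoff min_r ?max_l//; lra. Qed.

Lemma cutoff01 (B x : R) : 0 <= cutoff B x <= 1.
Proof. by rewrite /cutoff le_max lexx/= ge_max ler01 ge_min lexx. Qed.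

Lemma continuous_cutoff (B : R) : continuous (cutoff B).
Proof.
move=> x; apply: (@continuous_max _ _ (cst 0) (fun x => Num.min 1 (B + 1 - `|x|))).
  exact: cvg_cst.
apply: (@continuous_min _ _ (cst 1) (fun x => B + 1 - `|x|)); first exact: cvg_cst.
by apply: cvgB; [exact: cvg_cst|exact: norm_continuous].
Qed.

End cutoff.

Section resolvent_functions.
Context {R : realType}.

Lemma resolvent_fun_den (s x : R) : 1 <= s -> 0 < x ^+ 2 + s.
Proof. by move=> s1; rewrite ltr_wpDl ?sqr_ge0// (lt_le_trans ltr01). Qed.

Lemma continuous_u (s : R) : 1 <= s -> continuous (fun x : R => (x ^+ 2 + s)^-1).
Proof.
move=> s1 x; apply: cvgV; first by rewrite gt_eqF// resolvent_fun_den.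
by apply: cvgD; [exact: exprn_continuous|exact: cvg_cst].
Qed.

Lemma bounded_u (s : R) : 1 <= s -> bounded_fun (fun x : R => (x ^+ 2 + s)^-1).
Proof.
move=> s1; apply/bounded_funP; exists 1 => x.
rewrite gtr0_norm ?invr_gt0 ?resolvent_fun_den// invf_le1 ?resolvent_fun_den//.
by rewrite (le_trans s1)// lerDr sqr_ge0.
Qed.

Lemma continuous_xu (s : R) : 1 <= s -> continuous (fun x : R => x * (x ^+ 2 + s)^-1).
Proof. by move=> s1 x; apply: cvgM; [exact: cvg_id|exact: continuous_u]. Qed.

Lemma norm_xu_le1 (s x : R) : 1 <= s -> `|x * (x ^+ 2 + s)^-1| <= 1.
Proof.
move=> s1; have xs := resolvent_fun_den x s1.
rewrite normrM normfV (gtr0_norm xs) ler_pdivrMr// mul1r.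
rewrite -[x ^+ 2]real_normK ?num_real//; have := sqr_ge0 (`|x| - 1); nra.
Qed.

Lemma bounded_xu (s : R) : 1 <= s -> bounded_fun (fun x : R => x * (x ^+ 2 + s)^-1).
Proof. by move=> s1; apply/bounded_funP; exists 1 => x; exact: norm_xu_le1. Qed.

End resolvent_functions.

Section semicircle_integral.
Context {R : realType}.
Implicit Types (f g : R -> R) (v s : R).
Local Notation sc_int v f := (\int[semicircle v]_x f x)%R.

Let a v : R := 2 * Num.sqrt v.

Let a_gt0 v : 0 < v -> 0 < a v. Proof. by move=> v0; rewrite mulr_gt0// sqrtr_gt0. Qed.

Let a2 v : 0 < v -> a v ^+ 2 = 4 * v.
Proof. by move=> v0; rewrite exprMn sqr_sqrtr ?ltW//; ring. Qed.

Let pdfE v x : 0 < v ->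
  semicircle_pdf v x = (2 * pi * v)^-1 * Num.sqrt (a v ^+ 2 - x ^+ 2).
Proof.
move=> v0; rewrite /semicircle_pdf -a2//; congr (_ * _).
have [//|h] := leP 0 (a v ^+ 2 - x ^+ 2).
by rewrite sqrtr0 ltr0_sqrtr.
Qed.

Let pdf_out v x : 0 < v -> a v <= `|x| -> semicircle_pdf v x = 0.
Proof.
move=> v0 xa; rewrite pdfE// (_ : Num.sqrt _ = 0) ?mulr0//.
apply/eqP; rewrite sqrtr_eq0 subr_le0 -[leRHS]real_normK ?num_real//.
by rewrite ler_pXn2r ?nnegrE ?(ltW (a_gt0 v0)).
Qed.

Let pdf_out_itv v (x : R) : 0 < v -> (x < - a v) || (a v < x) -> semicircle_pdf v x = 0.
Proof.
move=> v0 h; apply: pdf_out => //; rewrite ler_normr.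
by case/orP: h => /ltW h; rewrite ?h// lerNr h orbT.
Qed.

Let continuous_measurableR f : continuous f -> measurable_fun [set: measurableTypeR R] f.
Proof. exact: continuous_measurable_fun. Qed.

Let semicircle_ge0 v f : 0 < v -> continuous f -> (forall x, 0 <= f x) ->
  (\int[semicircle v]_x (f x)%:E = ((2 * pi * v)^-1)%R%:E *
    \int[lebesgue_measure]_(x in `[(- a v)%R, a v]) (f x * Num.sqrt (a v ^+ 2 - x ^+ 2))%R%:E)%E.
Proof.
move=> v0 cf f0; rewrite /semicircle v0.
rewrite (@ge0_integral_density _ _ _ lebesgue_measure _ (semicircle_pdf v)); first last.
- by move=> x; rewrite lee_fin.
- by apply/measurable_EFinP; exact: continuous_measurableR.
- by [].
- exact: semicircle_pdf_ge0.
- exact: measurable_semicircle_pdf.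
have c0 : 0 <= (2 * pi * v)^-1 by rewrite invr_ge0 !mulr_ge0 ?pi_ge0// ltW.
rewrite -ge0_integralZl//; first last.
- by move=> x _; rewrite lee_fin mulr_ge0.
- apply/measurable_EFinP/measurable_funTS; apply: continuous_measurableR.
  move=> x; apply: cvgM; first exact: cf.
  apply: continuous_comp; last exact: sqrt_continuous.
  by apply: cvgB; [exact: cvg_cst|exact: exprn_continuous].
rewrite [RHS]integral_mkcond; apply: eq_integral => x _; rewrite patchE.
case: ifPn => [_|]; first by rewrite -!EFinM pdfE//; congr EFin; ring.
rewrite notin_setE /= in_itv /= => /negP; rewrite negb_and -!ltNge => h.
by rewrite (pdf_out_itv v0 h) mule0.
Qed.

Lemma semicircle_mass v : semicircle v setT = 1%E.
Proof.
have [v0|v0] := ltP 0 v; last by rewrite /semicircle ltNge v0/= diracT.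
have := semicircle_ge0 v0 (fun x => cvg_cst (1 : R)) (fun x => ler01).
rewrite integral_cst// mul1e => ->.
under eq_integral do rewrite mul1r.
rewrite integral_half_disk ?a_gt0// -EFinM a2//; congr EFin.
move: (pi_gt0 R); move: (pi : R) => p p0.
by field; rewrite !gt_eqF.
Qed.

Lemma semicircle_integrable v f : continuous f -> bounded_fun f ->
  (semicircle v).-integrable setT (EFin \o f).
Proof.
move=> cf bf; apply: measurable_bounded_integrable => //.
- by rewrite semicircle_mass ltry.
- exact: continuous_measurableR.
Qed.

Lemma semicircle_lin v (c : R) f g : continuous f -> bounded_fun f ->
  continuous g -> bounded_fun g ->
  sc_int v (fun x => c * f x + g x) = c * sc_int v f + sc_int v g.
Proof.
move=> cf bf cg bg; have h1 := semicircle_integrable v cf bf.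
have h2 := semicircle_integrable v cg bg.
rewrite RintegralD//; first by rewrite RintegralZl.
exact: (integrableZl _ c h1).
Qed.

Lemma semicircle1 v : sc_int v (fun=> 1) = 1.
Proof. by rewrite Rintegral_cst// semicircle_mass mul1r. Qed.

Lemma semicircle_bound v f M : continuous f -> (forall x, `|f x| <= M) ->
  `|sc_int v f| <= M.
Proof.
move=> cf fM; have bf : bounded_fun f by apply/bounded_funP; exists M.
have If := semicircle_integrable v cf bf.
apply: (le_trans (le_normr_Rintegral _ If)) => //.
have -> : M = sc_int v (fun=> M) by rewrite Rintegral_cst// semicircle_mass mulr1.
have cn : continuous (fun x => `|f x|).
  by move=> x; apply: continuous_comp; [exact: cf|exact: norm_continuous].
apply: le_Rintegral => //.
  by apply: semicircle_integrable => //; apply/bounded_funP; exists M => x; rewrite normr_id.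
apply: measurable_bounded_integrable => //; first by rewrite semicircle_mass ltry.
by apply/bounded_funP; exists `|M|.
Qed.

Lemma semicircle_close v f g (e : R) : continuous f -> bounded_fun f ->
  continuous g -> bounded_fun g -> (forall x, `|f x - g x| <= e) ->
  `|sc_int v f - sc_int v g| <= e.
Proof.
move=> cf bf cg bg fg.
have -> : sc_int v f - sc_int v g = sc_int v (fun x => -1 * g x + f x).
  by rewrite semicircle_lin// mulN1r addrC.
apply: semicircle_bound => [x|x]; last by rewrite mulN1r addrC.
by apply: cvgD; [apply: cvgM; [exact: cvg_cst|exact: cg]|exact: cf].
Qed.

(** The density vanishes outside [[- 2 sqrt v, 2 sqrt v]]. *)
Lemma semicircle_supp v f : continuous f -> (forall x, `|x| <= 2 * Num.sqrt v -> f x = 0) ->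
  sc_int v f = 0.
Proof.
move=> cf f0; have [v0|v0] := ltP 0 v; last first.
  rewrite /semicircle ltNge v0/= /Rintegral integral_dirac//; last first.
    by apply/measurable_EFinP; exact: continuous_measurableR.
  by rewrite diracT mul1e f0// normr0 mulr_ge0// sqrtr_ge0.
have cn : continuous (fun x => `|f x|).
  by move=> x; apply: continuous_comp; [exact: cf|exact: norm_continuous].
have : (\int[semicircle v]_x (`|f x|%R)%:E = 0)%E.
  rewrite semicircle_ge0// integral0_eq ?mule0// => x; rewrite /= in_itv /= => /andP[h1 h2].
  by rewrite f0 ?normr0 ?mul0r// ler_norml h1.
have mf : measurable_fun [set: measurableTypeR R] (EFin \o f).
  by apply/measurable_EFinP; exact: continuous_measurableR.
move=> h; rewrite /Rintegral integralE.
have le0 (u : R -> \bar R) : measurable_fun [set: measurableTypeR R] u ->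
    (forall x, 0 <= u x)%E -> (forall x, u x <= (`|f x|%R)%:E)%E -> (\int[semicircle v]_x u x = 0)%E.
  move=> mu u0 uf; apply/eqP; rewrite eq_le integral_ge0// andbT -h.
  apply: ge0_le_integral => //.
  by apply/measurable_EFinP; exact: continuous_measurableR.
rewrite !le0 ?sube0//=.
- exact: measurable_funeneg.
- by move=> x; rewrite funenegE /= -EFin_max lee_fin ge_max normr_ge0 andbT -normrN ler_norm.
- exact: measurable_funepos.
- by move=> x; rewrite funeposE /= -EFin_max lee_fin ge_max normr_ge0 andbT ler_norm.
Qed.

(** The imaginary part of the Stieltjes transform at [i eta], divided by [eta]. *)
Lemma semicircle_u v (eta : R) : 0 <= v -> 0 < eta ->
  sc_int v (fun x => (x ^+ 2 + eta ^+ 2)^-1) =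
  2 / (eta * (eta + Num.sqrt (eta ^+ 2 + 4 * v))).
Proof.
move=> v_ge0 eta0.
have xe (x : R) : 0 < x ^+ 2 + eta ^+ 2 by rewrite ltr_wpDl ?sqr_ge0 ?exprn_gt0.
have cu : continuous (fun x : R => (x ^+ 2 + eta ^+ 2)^-1).
  move=> x; apply: cvgV; first by rewrite gt_eqF.
  by apply: cvgD; [exact: exprn_continuous|exact: cvg_cst].
move: v_ge0; rewrite le_eqVlt => /predU1P[<-|v0].
  rewrite /semicircle ltxx /Rintegral integral_dirac//; last first.
    by apply/measurable_EFinP; exact: continuous_measurableR.
  rewrite diracT mul1e /= expr0n add0r mulr0 addr0 sqrtr_sqr gtr0_norm//.
  by field; rewrite !gt_eqF// addr_gt0.
rewrite /Rintegral semicircle_ge0//; last by move=> x; rewrite invr_ge0 ltW.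
under eq_integral do rewrite mulrC.
rewrite integral_half_disk_u ?a_gt0// -EFinM /= a2// [_ + 4 * v]addrC.
set c := Num.sqrt _.
have c0 : 0 < c by rewrite sqrtr_gt0 addr_gt0 ?mulr_gt0 ?exprn_gt0.
have c2 : c ^+ 2 = 4 * v + eta ^+ 2 by rewrite sqr_sqrtr// addr_ge0 ?sqr_ge0 ?mulr_ge0 ?(ltW v0).
have ve : v = (c ^+ 2 - eta ^+ 2) / 4 by rewrite c2 addrK; field.
have ce : c - eta != 0.
  apply/eqP => /subr0_eq ce; move: c2; rewrite ce => /eqP.
  by rewrite -[X in X == _]add0r (inj_eq (addIr _)) eq_sym mulf_eq0 pnatr_eq0/= gt_eqF.
have ce2 : c ^+ 2 - eta ^+ 2 != 0 by rewrite subr_sqr mulf_neq0// gt_eqF// addr_gt0.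
move: (pi_gt0 R); move: (pi : R) => p p0.
by rewrite ve; field; rewrite ce2 !gt_eqF// addr_gt0.
Qed.

(** The real part of the Stieltjes transform at [i eta] vanishes by symmetry. The
    integrand changes sign, so the formula for the density is applied to
    [1 + x / (x^2 + eta^2)], which is nonnegative for [eta >= 1]. *)
Lemma semicircle_xu v (eta : R) : 1 <= eta ->
  sc_int v (fun x => x / (x ^+ 2 + eta ^+ 2)) = 0.
Proof.
move=> eta1; have eta0 := lt_le_trans ltr01 eta1.
have e21 : 1 <= eta ^+ 2 by rewrite exprn_ege1.
have cxu := continuous_xu e21.
have bxu := bounded_xu e21.
have [v0|v0] := ltP 0 v; last first.
  rewrite /semicircle ltNge v0/= /Rintegral integral_dirac//; last first.
    by apply/measurable_EFinP; exact: continuous_measurableR.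
  by rewrite diracT mul1e /= mul0r.
have c1 : continuous (fun _ : R => 1 : R) by move=> x; exact: cvg_cst.
have b1 : bounded_fun (fun _ : R => 1 : R) by apply/bounded_funP; exists 1 => x; rewrite normr1.
have : sc_int v (fun x => 1 * (x / (x ^+ 2 + eta ^+ 2)) + 1) = 1.
  rewrite /Rintegral semicircle_ge0//; first last.
  - by move=> x; rewrite mul1r; have := norm_xu_le1 x e21; rewrite ler_norml => /andP[]; lra.
  - by move=> x; apply: cvgD; [apply: cvgM; [exact: cvg_cst|exact: cxu]|exact: cvg_cst].
  pose Q (x : R) := Num.sqrt (a v ^+ 2 - x ^+ 2).
  have cQ : continuous Q.
    move=> x; apply: continuous_comp; last exact: sqrt_continuous.
    by apply: cvgB; [exact: cvg_cst|exact: exprn_continuous].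
  under eq_integral do rewrite mul1r mulrDl mul1r EFinD.
  rewrite integralD//; first last.
  - apply: continuous_compact_integrable; first exact: segment_compact.
    exact: continuous_subspaceT.
  - apply: (@continuous_compact_integrable _ (fun x => x / (x ^+ 2 + eta ^+ 2) * Q x)); first exact: segment_compact.
    by apply: continuous_subspaceT => x; apply: cvgM; [exact: cxu|exact: cQ].
  rewrite integral_half_disk_xu ?a_gt0// add0e integral_half_disk ?a_gt0// -EFinM /= a2//.
  move: (pi_gt0 R); move: (pi : R) => p p0.
  by field; rewrite !gt_eqF.
by rewrite semicircle_lin// semicircle1; lra.
Qed.

End semicircle_integral.

Lemma unif_limit_continuous (R : realType) (f : R -> R) :
  (forall e : R, 0 < e -> exists2 g : R -> R, continuous g & forall x, `|f x - g x| <= e) ->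
  continuous f.
Proof.
move=> h x; apply/cvgrPdist_lt => e e0.
have [g cg fg] := h (e / 4) (divr_gt0 e0 (ltr0n R 4)).
have [d d0 hd] := continuous_epsdelta (cg x) (divr_gt0 e0 (ltr0n R 4)).
exists d => // z xz /=; have /= {}hd := hd z xz.
rewrite (_ : f x - f z = (f x - g x) + (g x - g z) - (f z - g z)); last by ring.
rewrite (le_lt_trans (ler_normB _ _))//.
have := fg x; have := fg z; have := ler_normD (f x - g x) (g x - g z); lra.
Qed.

Section semicircle_continuity.
Context {R : realType}.
Local Notation sc_int v f := (\int[semicircle v]_x f x)%R.

Lemma bounded_lin (c : R) (f g : R -> R) : bounded_fun f -> bounded_fun g ->
  bounded_fun (fun x => c * f x + g x).
Proof.
move=> /bounded_funP[M hM] /bounded_funP[K hK]; apply/bounded_funP.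
exists (`|c| * M + K) => x; rewrite (le_trans (ler_normD _ _))// lerD// normrM.
by rewrite ler_wpM2l.
Qed.

Lemma continuous_lin (c : R) (f g : R -> R) : continuous f -> continuous g ->
  continuous (fun x => c * f x + g x).
Proof.
by move=> cf cg x; apply: cvgD; [apply: cvgM; [exact: cvg_cst|exact: cf]|exact: cg].
Qed.

Lemma bounded_unif_limit (f g : R -> R) (e : R) : bounded_fun g ->
  (forall x, `|f x - g x| <= e) -> bounded_fun f.
Proof.
move=> /bounded_funP[M hM] h; apply/bounded_funP; exists (e + M) => x.
by rewrite -[f x](subrK (g x)) (le_trans (ler_normD _ _))// lerD.
Qed.

Lemma cutoffM_continuous (f : R -> R) (B : R) : continuous f ->
  continuous (fun x => f x * cutoff B x).
Proof. by move=> cf x; apply: cvgM; [exact: cf|exact: continuous_cutoff]. Qed.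

Lemma semicircle_max0 (v : R) : semicircle v = semicircle (Num.max v 0) :> {measure set (measurableTypeR R) -> \bar R}.
Proof.
by have [v0|v0//] := leP v 0; rewrite /semicircle ltxx ltNge v0.
Qed.

(** For resolvent functions the integrals are explicit and continuous in [v]; by
    density this extends to compactly supported functions, and then to bounded
    ones because the supports stay bounded when [v] does. *)
Lemma continuous_semicircle (f : R -> R) : continuous f -> bounded_fun f ->
  continuous (fun v => sc_int v f).
Proof.
pose Cls (f : R -> R) := [/\ continuous f, bounded_fun f & continuous (fun v => sc_int v f)].
have Cls_comp g (B : R) : continuous g -> 0 < B -> (forall x, B <= `|x| -> g x = 0) -> Cls g.
  apply: (@resolvent_density _ Cls 1) => //.
  - move=> c g1 g2 [c1 b1 s1] [c2 b2 s2]; split.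
    + exact: continuous_lin.
    + exact: bounded_lin.
    + have -> : (fun v => sc_int v (fun x => c * g1 x + g2 x)) = (fun v => c * sc_int v g1 + sc_int v g2).
        by apply/funext => v; rewrite semicircle_lin.
      exact: continuous_lin.
  - move=> g1 h.
    have cg1 : continuous g1.
      by apply: unif_limit_continuous => e /h[g2 [cg2 _ _] ?]; exists g2.
    have bg1 : bounded_fun g1.
      by have [g2 [_ bg2 _] ?] := h 1 ltr01; exact: (bounded_unif_limit bg2).
    split => //; apply: unif_limit_continuous => e /h[g2 [cg2 bg2 sg2] g12].
    by exists (fun v => sc_int v g2) => // v; exact: semicircle_close.
  - split; first by move=> x; exact: cvg_cst.
      by apply/bounded_funP; exists 1 => x; rewrite normr1.
    have -> : (fun v : R => sc_int v (fun=> 1)) = cst 1 by apply/funext => v; rewrite semicircle1.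
    by move=> v; exact: cvg_cst.
  - move=> s s1; have s0 := lt_le_trans ltr01 s1.
    have se : Num.sqrt s ^+ 2 = s by rewrite sqr_sqrtr// ltW.
    have e0 : 0 < Num.sqrt s by rewrite sqrtr_gt0.
    have xs (x : R) : 0 < x ^+ 2 + s by rewrite ltr_wpDl ?sqr_ge0.
    split.
    + exact: continuous_u.
    + exact: bounded_u.
    + have -> : (fun v => sc_int v (fun x => (x ^+ 2 + s)^-1)) =
        (fun v => 2 * (Num.sqrt s * (Num.sqrt s + Num.sqrt (s + 4 * Num.max v 0)))^-1).
        apply/funext => v; rewrite semicircle_max0 -[in LHS]se semicircle_u ?se//.
        by rewrite le_max lexx orbT.
      move=> v; apply: cvgM; first exact: cvg_cst.
      apply: cvgV; first by rewrite gt_eqF// mulr_gt0// ltr_pwDl// sqrtr_ge0.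
      apply: cvgM; first exact: cvg_cst.
      apply: cvgD; first exact: cvg_cst.
      apply: (@continuous_cvg _ _ _ _ _ _ Num.sqrt); first exact: sqrt_continuous.
      apply: cvgD; first exact: cvg_cst.
      apply: cvgM; first exact: cvg_cst.
      by apply: (@continuous_max _ _ id (cst 0)); [exact: cvg_id|exact: cvg_cst].
  - move=> s s1; have s0 := lt_le_trans ltr01 s1.
    have se : Num.sqrt s ^+ 2 = s by rewrite sqr_sqrtr// ltW.
    have e1 : 1 <= Num.sqrt s by rewrite -sqrtr1 ler_wsqrtr.
    split.
    + exact: continuous_xu.
    + exact: bounded_xu.
    + have -> : (fun v => sc_int v (fun x => x * (x ^+ 2 + s)^-1)) = cst 0.
        by apply/funext => v; rewrite -[in LHS]se semicircle_xu.
      by move=> v; exact: cvg_cst.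
move=> cf bf v0.
pose B := 2 * Num.sqrt (`|v0| + 1).
have B0 : 0 <= B by rewrite mulr_ge0// sqrtr_ge0.
have [_ _ cB] : Cls (fun x => f x * cutoff B x).
  apply: (Cls_comp _ (B + 1)); [exact: cutoffM_continuous|by rewrite ltr_wpDl|].
  by move=> x xB; rewrite cutoff_out ?mulr0.
have bc : bounded_fun (fun x => f x * cutoff B x).
  move/bounded_funP: bf => [M hM]; apply/bounded_funP; exists M => x.
  have /andP[h0 h1] := cutoff01 B x.
  by rewrite normrM (ger0_norm h0) (le_trans _ (hM x))// ler_piMr.
have near_eq v : `|v0 - v| < 1 -> sc_int v f = sc_int v (fun x => f x * cutoff B x).
  move=> vv; apply/eqP; rewrite -subr_eq0; apply/eqP.
  have -> : sc_int v f - sc_int v (fun x => f x * cutoff B x) =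
     sc_int v (fun x => -1 * (f x * cutoff B x) + f x).
    by rewrite semicircle_lin ?mulN1r 1?addrC//; exact: cutoffM_continuous.
  apply: semicircle_supp; first by apply: continuous_lin => //; exact: cutoffM_continuous.
  move=> x xv; rewrite cutoff_in; first by ring.
  apply: (le_trans xv); rewrite ler_wpM2l// ler_wsqrtr//.
  have := ler_norm (v - v0); rewrite distrC => h; have := ler_norm v0; lra.
apply/cvgrPdist_lt => e e0.
have [r r0 hr] := continuous_epsdelta (cB v0) e0.
exists (Num.min r 1) => /=; first by rewrite lt_min r0 ltr01.
move=> v /=; rewrite lt_min => /andP[vr v1].
have v00 : `|v0 - v0| < 1 by rewrite subrr normr0 ltr01.
by rewrite (near_eq _ v1) (near_eq _ v00); exact: hr.
Qed.

End semicircle_continuity.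

(** * The semicircle law for urn band matrices *)

Lemma norm_avg_le (K : realFieldType) (T : finType) (f : T -> K) :
  `|avg f| <= avg (fun t => `|f t|).
Proof.
by rewrite unlock normrM ger0_norm ?invr_ge0// ler_wpM2l ?invr_ge0// ler_norm_sum.
Qed.

Lemma sum_ord_cst (K : pzRingType) (n : nat) (c : K) : \sum_(i < n) c = n%:R * c.
Proof. by rewrite sumr_const card_ord mulr_natl. Qed.

Section spectral_mean.
Context {R : realType} {N : nat}.
Implicit Types (A : 'M[R]_N) (f g : R -> R).

(** The integral of [f] against the empirical eigenvalue measure of [A]. *)
Definition spectral_mean f A : R := N%:R^-1 * \sum_(z <- eigenvalues A) f z.

Lemma spectral_mean_lin (c : R) f g A :
  spectral_mean (fun x => c * f x + g x) A = c * spectral_mean f A + spectral_mean g A.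
Proof. by rewrite /spectral_mean big_split -mulr_sumr mulrDr mulrCA. Qed.

Lemma spectral_mean_cst (c : R) A : (0 < N)%N -> A^T = A -> spectral_mean (fun=> c) A = c.
Proof.
move=> N0 As; rewrite /spectral_mean big_const_seq count_predT size_eigenvalues//.
by rewrite iter_addr_0 -[c *+ N]mulr_natl mulKf// pnatr_eq0 -lt0n.
Qed.

Lemma spectral_mean_norm_le f g A : (forall x, `|f x| <= g x) ->
  `|spectral_mean f A| <= spectral_mean g A.
Proof.
move=> fg; rewrite /spectral_mean normrM ger0_norm ?invr_ge0// ler_wpM2l ?invr_ge0//.
by rewrite (le_trans (ler_norm_sum _ _ _))// ler_sum.
Qed.

Lemma spectral_mean_close (e : R) f g A : (0 < N)%N -> A^T = A ->
  (forall x, `|f x - g x| <= e) -> `|spectral_mean f A - spectral_mean g A| <= e.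
Proof.
move=> N0 As fg; rewrite -mulrBr -sumrB -(spectral_mean_cst e N0 As).
exact: spectral_mean_norm_le.
Qed.

End spectral_mean.

Section urn_spectrum.
Context {R : realType}.
Local Notation sc_int v f := (\int[semicircle v]_x f x)%R.

(** What the proof needs to know about a band: every row has at most [w] free
    positions, all but a proportion [def] of the [N w] possible positions are
    free, and neighbouring rows are nearly equal. Strict and periodic bands share
    these properties. [D] tells the free positions and [e] the variable that
    fills each of them. *)
Record band_pattern (N L : nat) (D : rel 'I_N) (e : 'I_N -> 'I_N -> 'I_L) (w : nat) (def : R) : Prop :=
  BandPattern {
    pattern_sym : forall i j, D i j = D j i;
    pattern_idx_sym : forall i j, e i j = e j i;
    pattern_inj : forall i j k l, D i j -> D k l -> e k l = e i j ->
      ((k == i) && (l == j)) || ((k == j) && (l == i));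
    pattern_width_gt0 : (0 < w)%N;
    pattern_width_le : (w <= N)%N;
    pattern_degree : forall i, (#|[pred j | D i j]| <= w)%N;
    pattern_deficit : N%:R * (1 - def) * w%:R <= \sum_i (#|[pred j | D i j]|)%:R;
    pattern_regular : forall (q : nat) (i k : 'I_N), (k <= i < k + q)%N ->
      (#|[pred j | D i j != D k j]| <= 4 * q)%N }.

Definition pattern_matrix (N L : nat) (D : rel 'I_N) (e : 'I_N -> 'I_N -> 'I_L) (w : nat)
    (y : 'I_L -> R) : 'M[R]_N :=
  \matrix_(i, j) if D i j then (Num.sqrt w%:R)^-1 * y (e i j) else 0.

Definition urn_variance (M : nat) (x : 'I_M -> R) : R :=
  avg (fun a => x a ^+ 2) - avg x ^+ 2.

Section urn_moments.
Variables (M : nat) (x : 'I_M -> R) (K : R).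
Hypotheses (M_gt0 : (0 < M)%N) (K_ge1 : 1 <= K) (x4 : avg (fun a => x a ^+ 4) <= K).
Local Notation m := (avg x).

Let card_M : (0 < #|'I_M|)%N. Proof. by rewrite card_ord. Qed.

Let avg_affine (c d : R) (f : 'I_M -> R) : avg (fun a => c + d * f a) = c + d * avg f.
Proof. by rewrite avgD avg_cst// avgZ. Qed.

Lemma urn_varianceE : avg (fun a => (x a - m) ^+ 2) = urn_variance x.
Proof.
transitivity (avg (fun a => x a ^+ 2 + (m ^+ 2 + (-2 * m) * x a))).
  by apply: eq_avg => a; ring.
by rewrite avgD avg_affine /urn_variance; ring.
Qed.

Lemma urn_variance_ge0 : 0 <= urn_variance x.
Proof. by rewrite -urn_varianceE avg_ge0// => a; exact: sqr_ge0. Qed.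

Let x2 : avg (fun a => x a ^+ 2) <= K.
Proof.
apply: (@le_trans _ _ (2^-1 + 2^-1 * avg (fun a => x a ^+ 4))); last by have := K_ge1; have := x4; lra.
rewrite -avg_affine; apply: avg_le => a.
have := sqr_ge0 (x a ^+ 2 - 1); rewrite (_ : x a ^+ 4 = (x a ^+ 2) ^+ 2) -?exprM//; nra.
Qed.

Lemma urn_variance_le : urn_variance x <= K.
Proof. by rewrite (le_trans _ x2)// lerBlDr lerDl sqr_ge0. Qed.

Lemma urn_mean_le : `|m| <= K.
Proof.
have m2 : m ^+ 2 <= K.
  by rewrite (le_trans _ x2)// -subr_ge0 urn_variance_ge0.
rewrite -real_normK ?num_real// in m2; have := sqr_ge0 (`|m| - 1).
have := normr_ge0 m; have := K_ge1; nra.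
Qed.

Lemma urn_absolute_deviation : avg (fun a => `|x a - m|) <= K.
Proof.
apply: (@le_trans _ _ (2^-1 + 2^-1 * avg (fun a => (x a - m) ^+ 2))); last first.
  by rewrite urn_varianceE; have := urn_variance_le; have := K_ge1; have := x4; lra.
rewrite -avg_affine; apply: avg_le => a; have := sqr_ge0 (`|x a - m| - 1).
rewrite -[X in _ <= _ + _ * X]real_normK ?num_real//; nra.
Qed.

Lemma urn_third_deviation :
  avg (fun a => `|x a - m| ^+ 3) <= K + 4 * (K + K ^+ 4).
Proof.
have m4 : m ^+ 4 <= K ^+ 4.
  rewrite -[m ^+ 4]ger0_norm; last by rewrite (_ : 4%N = (2 * 2)%N)// exprM sqr_ge0.
  by rewrite normrX lerXn2r ?nnegrE ?urn_mean_le// (le_trans ler01).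
apply: (@le_trans _ _ (2^-1 * avg (fun a => (x a - m) ^+ 2) +
    (4 * m ^+ 4 + 4 * avg (fun a => x a ^+ 4)))); last first.
  by rewrite urn_varianceE; have := urn_variance_le; have := K_ge1; have := x4; lra.
rewrite -avg_affine -avgZ -avgD; apply: avg_le => a.
set t := x a - m.
have t4 : t ^+ 4 <= 8 * m ^+ 4 + 8 * x a ^+ 4.
  have h1 : t ^+ 2 <= 2 * (m ^+ 2 + x a ^+ 2) by have := sqr_ge0 (x a + m); rewrite /t; nra.
  have h2 : (t ^+ 2) ^+ 2 <= (2 * (m ^+ 2 + x a ^+ 2)) ^+ 2.
    by rewrite lerXn2r ?nnegrE ?sqr_ge0// mulr_ge0// addr_ge0// sqr_ge0.
  rewrite (_ : t ^+ 4 = (t ^+ 2) ^+ 2) -?exprM// (_ : m ^+ 4 = (m ^+ 2) ^+ 2) -?exprM//.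
  rewrite (_ : x a ^+ 4 = (x a ^+ 2) ^+ 2) -?exprM//.
  have := sqr_ge0 (m ^+ 2 - x a ^+ 2); nra.
have t3 : `|t| ^+ 3 <= 2^-1 * t ^+ 2 + 2^-1 * t ^+ 4.
  rewrite -[t ^+ 2]real_normK ?num_real//.
  rewrite (_ : t ^+ 4 = `|t| ^+ 4); last by rewrite -normrX ger0_norm// (_ : 4%N = (2 * 2)%N)// exprM sqr_ge0.
  rewrite -subr_ge0 (_ : _ - _ = 2^-1 * (`|t| * (`|t| - 1)) ^+ 2); last by field.
  by rewrite mulr_ge0// sqr_ge0.
lra.
Qed.

End urn_moments.

(** Makes the error uniform over all urns with variance at most [K]. *)
Lemma self_const_le (eta v K : R) : 0 < eta -> 0 <= v -> v <= K ->
  self_const eta v <= self_const eta K.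
Proof.
move=> e0 v0 vK; have y0 : 0 <= eta^-1 by rewrite invr_ge0 ltW.
have K0 := le_trans v0 vK.
rewrite /self_const /cov_const /error_const; set y := eta^-1 in y0 *.
rewrite -subr_ge0; set p := (X in 0 <= X).
have -> : p = (K - v) * (8 * y ^+ 3 + y / 2 + y ^+ 2 * (8 * y ^+ 4 + 4 * y ^+ 3 + 2 * y ^+ 2)
   + y ^+ 2 * (K + v) * (2 * y ^+ 3 + 20 * y ^+ 4)).
  by rewrite /p; field.
rewrite mulr_ge0 ?subr_ge0//.
by nonneg.
Qed.

(** The explicit root of the quadratic equation satisfied by the Stieltjes
    transform of the semicircle law. *)
Lemma semicircle_stieltjes (eta v : R) : 0 < eta -> 0 <= v ->
  let c0 := 2 / (eta + Num.sqrt (eta ^+ 2 + 4 * v)) in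
  0 <= c0 /\ eta * c0 + v * c0 ^+ 2 = 1.
Proof.
move=> e0 v0 c0; have s0 := sqrtr_ge0 (eta ^+ 2 + 4 * v).
have es : 0 < eta + Num.sqrt (eta ^+ 2 + 4 * v) by rewrite ltr_pwDl.
split; first by rewrite divr_ge0// ltW.
have s2 : Num.sqrt (eta ^+ 2 + 4 * v) ^+ 2 = eta ^+ 2 + 4 * v.
  by rewrite sqr_sqrtr// addr_ge0 ?sqr_ge0// mulr_ge0.
rewrite /c0; set s := Num.sqrt _ in s0 es s2 *.
have -> : v = (s ^+ 2 - eta ^+ 2) / 4 by rewrite s2; field.
by field; rewrite gt_eqF.
Qed.

Section fixed_pattern.
Variables (N M L : nat) (D : rel 'I_N) (e : 'I_N -> 'I_N -> 'I_L) (w : nat) (def : R).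
Variables (x : 'I_M -> R) (K eta r : R) (q : nat).
Hypotheses (pat : band_pattern D e w def) (M_gt0 : (0 < M)%N) (K_ge1 : 1 <= K)
  (x4 : avg (fun a => x a ^+ 4) <= K).
Hypotheses (eta_ge1 : 1 <= eta) (eta_K : 4 * K <= eta ^+ 2) (r_gt0 : 0 < r) (r_le1 : r <= 1)
  (q_gt0 : (0 < q)%N).
Local Notation sw := (@Num.sqrt R w%:R).
(** The constant exceeds all absolute moments up to order three of the centred
    urn, so that each moment of an entry that has to be small is at most [r^2]. *)
Hypothesis w_large : 5 * (K + K ^+ 4) <= r ^+ 2 * sw.
Local Notation m := (avg x).
Local Notation v := (urn_variance x).

Let tau a := sw^-1 * (x a - m).

Let eta_gt0 : 0 < eta. Proof. exact: lt_le_trans eta_ge1. Qed.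
Let w_gt0 : 0 < w%:R :> R. Proof. by rewrite ltr0n (pattern_width_gt0 pat). Qed.
Let sw_gt0 : 0 < sw. Proof. by rewrite sqrtr_gt0. Qed.
Let sw2 : sw ^+ 2 = w%:R. Proof. by rewrite sqr_sqrtr// ltW. Qed.
Let card_M : (0 < #|'I_M|)%N. Proof. by rewrite card_ord. Qed.

Let sw_ge1 : 1 <= sw.
Proof. by rewrite -[leLHS]sqrtr1 ler_wsqrtr// ler1n (pattern_width_gt0 pat). Qed.

Let small (z : R) : z <= 5 * (K + K ^+ 4) -> sw^-1 * z <= r ^+ 2.
Proof. by move=> zC; rewrite ler_pdivrMl// mulrC (le_trans zC). Qed.

Let K4 : 0 <= K ^+ 4. Proof. by rewrite exprn_ge0// (le_trans ler01). Qed.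

Let tau_centred : avg tau = 0.
Proof. by rewrite avgZ avgB avg_cst// subrr mulr0. Qed.

Let w_tau2 : w%:R * avg (fun a => tau a ^+ 2) = v.
Proof.
rewrite -urn_varianceE// -avgZ; apply: eq_avg => a.
by rewrite /tau exprMn exprVn sw2 mulrA mulfV ?gt_eqF// mul1r.
Qed.

Let tau1_r : avg (fun a => `|tau a|) <= r ^+ 2.
Proof.
rewrite (_ : avg _ = sw^-1 * avg (fun a => `|x a - m|)); last first.
  by rewrite -avgZ; apply: eq_avg => a; rewrite normrM ger0_norm// invr_ge0 ltW.
by apply: small; have := urn_absolute_deviation M_gt0 K_ge1 x4; have := K_ge1; have := K4; lra.
Qed.

Let tau2_r : avg (fun a => tau a ^+ 2) <= r ^+ 2.
Proof.
rewrite -[leLHS](mulKf (lt0r_neq0 w_gt0)) w_tau2 -sw2 expr2 invfM -mulrA small//.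
apply: (@le_trans _ _ v).
  by rewrite ler_piMl ?urn_variance_ge0// invf_le1.
by have := urn_variance_le M_gt0 K_ge1 x4; have := K_ge1; have := K4; lra.
Qed.

Let tau3_r : w%:R * avg (fun a => `|tau a| ^+ 3) <= r ^+ 2.
Proof.
rewrite (_ : _ * _ = sw^-1 * avg (fun a => `|x a - m| ^+ 3)); last first.
  rewrite -!avgZ; apply: eq_avg => a.
  rewrite normrM (ger0_norm (_ : 0 <= sw^-1)) ?invr_ge0 ?(ltW sw_gt0)// -[X in X * _]sw2.
  by field; rewrite gt_eqF.
by apply: small; have := urn_third_deviation M_gt0 K_ge1 x4; have := K_ge1; have := K4; lra.
Qed.

Let w_r : w%:R^-1 <= r ^+ 2.
Proof.
rewrite -sw2 expr2 invfM small// (@le_trans _ _ 1) ?invf_le1//.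
by have := K_ge1; have := K4; lra.
Qed.

Local Notation A phi := (pattern_matrix D e w (x \o phi)).
Local Notation c0 := (2 / (eta + Num.sqrt (eta ^+ 2 + 4 * v))).

Lemma pattern_matrix_tr y : (pattern_matrix D e w y)^T = pattern_matrix D e w y.
Proof. by apply/matrixP => i j; rewrite !mxE (pattern_sym pat) (pattern_idx_sym pat). Qed.

Let N_gt0 : (0 < N)%N.
Proof. exact: leq_trans (pattern_width_gt0 pat) (pattern_width_le pat). Qed.

Let normc_invn (z : R[i]) : normc (N%:R^-1 * z) = N%:R^-1 * normc z.
Proof.
by rewrite normcM -(rmorph_nat (real_complex R)) -fmorphV normc_real ger0_norm// invr_ge0.
Qed.

Let degR i : (#|[pred j | D i j]|)%:R <= w%:R :> R.
Proof. by rewrite ler_nat (pattern_degree pat). Qed.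

Let v_eta : 4 * v <= eta ^+ 2.
Proof. by apply: le_trans eta_K; rewrite ler_pM2l// (urn_variance_le M_gt0 K_ge1 x4). Qed.

Let y_le1 : eta^-1 <= 1. Proof. by rewrite invf_le1. Qed.
Let y_ge0 : 0 <= eta^-1. Proof. by rewrite invr_ge0 ltW. Qed.

Let centred_close :
  normc (\sum_i (avg (fun phi : {ffun 'I_L -> 'I_M} => resolvent eta (urn_matrix D e tau phi) i i) - (0 +i* c0)%C))
  <= N%:R * (2 * (K * Num.max def 0 + r * self_const eta K)).
Proof.
have [c0_ge0 c0_eq] := semicircle_stieltjes eta_gt0 (urn_variance_ge0 x M_gt0).
have := mean_resolvent_close eta_gt0 M_gt0 (pattern_sym pat) (pattern_idx_sym pat) (pattern_inj pat)
  tau_centred w_gt0 degR r_gt0 r_le1 w_tau2 tau1_r tau2_r tau3_r w_r v_eta c0_ge0 c0_eq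
  (pattern_deficit pat).
move/le_trans; apply; rewrite ler_wpM2l// -mulrA ler_wpM2l//.
have v0 := urn_variance_ge0 x M_gt0; have vK := urn_variance_le M_gt0 K_ge1 x4.
have s0 : 0 <= self_const eta v.
  rewrite /self_const /cov_const /error_const; nonneg.
rewrite mulrDr lerD//.
  apply: (@le_trans _ _ (v * Num.max def 0)); last by rewrite ler_wpM2r// le_max lexx orbT.
  rewrite mulrA mulrA [_ * v]mulrC -!mulrA ler_wpM2l//.
  apply: (@le_trans _ _ (eta^-1 * (eta^-1 ^+ 2 * Num.max def 0))).
    by rewrite expr2 -!mulrA !ler_wpM2l// le_max lexx.
  rewrite mulrA -exprS ler_piMl ?exprn_ile1// le_max lexx orbT//.
rewrite mulrCA ler_wpM2l ?(ltW r_gt0)//.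
by rewrite (le_trans _ (self_const_le eta_gt0 v0 vK))// ler_piMl//.
Qed.

(** Centre the urn, use the self-consistent equation for the centred matrix, and
    restore the mean by the comparison of resolvents. The two groups of terms are
    the errors of these two steps. *)
Lemma mean_trace_pattern :
  normc (N%:R^-1 * avg (fun phi : {ffun 'I_L -> 'I_M} => \sum_i resolvent eta (A phi) i i) - (0 +i* c0)%C) <=
  2 * (K * Num.max def 0 + r * self_const eta K) + K * (3 * q%:R / sw + q%:R^-1).
Proof.
pose X (phi : {ffun 'I_L -> 'I_M}) := urn_matrix D e tau phi.
have AX (phi : {ffun 'I_L -> 'I_M}) : A phi - X phi = \matrix_(i, j) (if D i j then sw^-1 * m else 0).
  apply/matrixP => i j; rewrite !mxE; case: (D i j); last by rewrite subrr.
  by rewrite /tau mulrBr opprB addrC subrK.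
have shift (phi : {ffun 'I_L -> 'I_M}) := trace_resolvent_shift eta_gt0 (pattern_matrix_tr _)
  (urn_matrix_tr tau (pattern_sym pat) (pattern_idx_sym pat) phi) (AX phi) sw_gt0 sw2 q_gt0 degR
  (fun i k => pattern_regular pat (q := q ^ 2) (i := i) (k := k)).
have N0 : N%:R != 0 :> R[i] by rewrite pnatr_eq0 -lt0n.
have centring (F : fieldType) (n a z b : F) : n != 0 ->
    n^-1 * a - z = n^-1 * (b - n * z + (a - b)) by move=> n0; field.
have -> : N%:R^-1 * avg (fun phi : {ffun 'I_L -> 'I_M} => \sum_i resolvent eta (A phi) i i) - (0 +i* c0)%C =
  N%:R^-1 * (\sum_i (avg (fun phi => resolvent eta (X phi) i i) - (0 +i* c0)%C)) +
  N%:R^-1 * avg (fun phi : {ffun 'I_L -> 'I_M} => \sum_i (resolvent eta (A phi) i i - resolvent eta (X phi) i i)).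
  have cN : \sum_(i < N) (0 +i* c0)%C = N%:R * (0 +i* c0)%C :> R[i].
    exact: sum_ord_cst.
  rewrite -mulrDr sumrB cN -avg_sum.
  under [X in _ = _ * (_ + X)]eq_avg do rewrite sumrB.
  rewrite avgB; exact: centring.
rewrite (le_trans (le_normcD _ _))// !normc_invn lerD//.
  by rewrite ler_pdivrMl ?ltr0n//.
have N1 : 0 < N%:R :> R by rewrite ltr0n.
have q0 : 0 < q%:R :> R by rewrite ltr0n.
rewrite ler_pdivrMl// (le_trans (normc_avg _))//.
rewrite -[leRHS](avg_cst (card_samples (L := L) M_gt0)); apply: avg_le => phi.
apply: (le_trans (shift phi)).
have mK := urn_mean_le M_gt0 K_ge1 x4.
have wN : sw <= N%:R.
  rewrite (@le_trans _ _ w%:R) ?ler_nat ?(pattern_width_le pat)//.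
  by rewrite -[leRHS]sw2 expr2 ler_peMl// ltW.
rewrite normrM (ger0_norm (_ : 0 <= sw^-1)) ?invr_ge0 ?(ltW sw_gt0)//.
have -> : sw^-1 * `|m| * (eta^-1 ^+ 2 * (2 * q%:R * N%:R + (N%:R / q%:R + q%:R) * sw)) =
  N%:R * ((`|m| * eta^-1 ^+ 2) * (2 * q%:R / sw + q%:R^-1 + q%:R / N%:R)).
  by field; rewrite !gt_eqF.
rewrite ler_wpM2l// ler_pM//; first by nonneg.
- by rewrite -[leRHS]mulr1 ler_pM// ?sqr_ge0// exprn_ile1.
- have : q%:R / N%:R <= q%:R / sw by rewrite ler_wpM2l// lef_pV2 ?posrE.
  by rewrite -!mulrA; lra.
Qed.

End fixed_pattern.

(** The convergence is uniform over all patterns and over all urns with fourth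
    moment at most [K]. The uniformity matters: the urn will be a random one,
    formed by the first [M] variables of the exchangeable sequence. *)
Definition urn_universal (K : R) (f : R -> R) : Prop :=
  forall ep : R, 0 < ep -> exists2 delta : R, 0 < delta &
  forall (N M L : nat) (D : rel 'I_N) (e : 'I_N -> 'I_N -> 'I_L) (w : nat) (def : R)
    (x : 'I_M -> R), band_pattern D e w def -> (0 < M)%N -> w%:R^-1 <= delta -> def <= delta ->
    avg (fun a => x a ^+ 4) <= K ->
  `|avg (fun phi : {ffun 'I_L -> 'I_M} => spectral_mean f (pattern_matrix D e w (x \o phi)))
    - sc_int (urn_variance x) f| <= ep.

Section fixed_bound.
Variables (K : R) (K_ge1 : 1 <= K).

Let K_gt0 : 0 < K. Proof. exact: lt_le_trans K_ge1. Qed.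

(** The parameters are chosen in the order [r], [q], width: [q] has to be large to
    make the rank of the mean small, and the width large in terms of [q]. *)
Lemma mean_trace_close (eta ep : R) : 1 <= eta -> 4 * K <= eta ^+ 2 -> 0 < ep ->
  exists2 delta : R, 0 < delta &
  forall (N M L : nat) (D : rel 'I_N) (e : 'I_N -> 'I_N -> 'I_L) (w : nat) (def : R)
    (x : 'I_M -> R), band_pattern D e w def -> (0 < M)%N -> w%:R^-1 <= delta -> def <= delta ->
    avg (fun a => x a ^+ 4) <= K ->
  normc (N%:R^-1 * avg (fun phi : {ffun 'I_L -> 'I_M} =>
      \sum_i resolvent eta (pattern_matrix D e w (x \o phi)) i i)
    - (0 +i* (2 / (eta + Num.sqrt (eta ^+ 2 + 4 * urn_variance x))))%C) <= ep.
Proof.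
move=> eta1 etaK ep0.
have S0 : 0 <= self_const eta K.
  have y0 : 0 <= eta^-1 by rewrite invr_ge0 (le_trans _ eta1).
  have K0 := ltW K_gt0.
  rewrite /self_const /cov_const /error_const; nonneg.
have S1 : 0 < self_const eta K + 1 by rewrite ltr_wpDl.
pose r := Num.min 1 (ep / (8 * (self_const eta K + 1))).
have r0 : 0 < r by rewrite lt_min ltr01 divr_gt0// mulr_gt0.
have r1 : r <= 1 by rewrite ge_min lexx.
have rS : r * self_const eta K <= ep / 8.
  apply: (@le_trans _ _ (ep / (8 * (self_const eta K + 1)) * (self_const eta K + 1))).
    by rewrite ler_pM ?(ltW r0)//; [rewrite ge_min lexx orbT|rewrite lerDl].
  by rewrite le_eqVlt; apply/orP; left; apply/eqP; field; rewrite gt_eqF.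
have [q q0 qE] : exists2 q : nat, (0 < q)%N & K / q%:R <= ep / 4.
  exists (Num.truncn (4 * K / ep)).+1 => //.
  rewrite ler_pdivrMr ?ltr0n// mulrC -ler_pdivrMr ?divr_gt0//.
  rewrite (_ : K / (ep / 4) = 4 * K / ep); last by field; rewrite gt_eqF.
  by rewrite ltW// truncnS_gt.
pose C := 5 * (K + K ^+ 4).
have C0 : 0 < C by rewrite mulr_gt0// addr_gt0// exprn_gt0.
pose d1 := Num.min (r ^+ 2 / C) (ep / (12 * K * q%:R)).
have d10 : 0 < d1 by rewrite lt_min !divr_gt0 ?exprn_gt0// !mulr_gt0// ltr0n.
exists (Num.min (d1 ^+ 2) (ep / (8 * K))).
  by rewrite lt_min exprn_gt0// divr_gt0// mulr_gt0.
move=> N M L D e w def x pat M0; rewrite !le_min => /andP[wd _] /andP[_ defd] x4.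
have w0 : 0 < w%:R :> R by rewrite ltr0n (pattern_width_gt0 pat).
have sw0 : 0 < Num.sqrt w%:R :> R by rewrite sqrtr_gt0.
have swd : (Num.sqrt w%:R)^-1 <= d1.
  rewrite -(@ler_pXn2r _ 2)// ?nnegrE ?invr_ge0 ?(ltW sw0) ?(ltW d10)//.
  by rewrite exprVn sqr_sqrtr// ltW.
have := swd; rewrite le_min => /andP[sw1 sw2].
have wl : C <= r ^+ 2 * Num.sqrt w%:R by rewrite -ler_pdivrMr// mulrC -ler_pdivlMr.
apply: (le_trans (mean_trace_pattern pat M0 K_ge1 x4 eta1 etaK r0 r1 q0 wl)).
have h1 : K * Num.max def 0 <= ep / 8.
  rewrite mulrC -ler_pdivlMr// ge_max divr_ge0 ?divr_ge0 ?(ltW ep0) ?(ltW K_gt0)// andbT.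
  by rewrite (le_trans defd)// le_eqVlt; apply/orP; left; apply/eqP; field; rewrite gt_eqF.
have h2 : K * (3 * q%:R / Num.sqrt w%:R) <= ep / 4.
  rewrite mulrA mulrC -ler_pdivlMr ?mulr_gt0 ?ltr0n//.
  rewrite (le_trans sw2)// le_eqVlt; apply/orP; left; apply/eqP; field.
  by rewrite !gt_eqF// ltr0n.
by rewrite [K * (_ + _)]mulrDr; lra.
Qed.

Lemma urn_universal_lin (c : R) f g : continuous f -> bounded_fun f -> continuous g -> bounded_fun g ->
  urn_universal K f -> urn_universal K g -> urn_universal K (fun x => c * f x + g x).
Proof.
move=> cf bf cg bg uf ug ep ep0.
have c1 : 0 < `|c| + 1 by rewrite ltr_wpDl.
have [d1 d10 h1] := uf (ep / 2 / (`|c| + 1)) (divr_gt0 (divr_gt0 ep0 (ltr0n R 2)) c1).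
have [d2 d20 h2] := ug (ep / 2) (divr_gt0 ep0 (ltr0n R 2)).
exists (Num.min d1 d2); first by rewrite lt_min d10.
move=> N M L D e w def x pat M0; rewrite !le_min => /andP[w1 w2] /andP[e1 e2] x4.
have {}h1 := h1 _ _ _ _ _ _ _ _ pat M0 w1 e1 x4.
have {}h2 := h2 _ _ _ _ _ _ _ _ pat M0 w2 e2 x4.
rewrite semicircle_lin//.
under eq_avg do rewrite spectral_mean_lin.
rewrite avgD avgZ opprD addrACA -mulrBr (le_trans (ler_normD _ _))//.
rewrite [leRHS]splitr lerD// normrM.
apply: (@le_trans _ _ ((`|c| + 1) * (ep / 2 / (`|c| + 1)))).
  by rewrite ler_pM// lerDl.
by rewrite mulrC divfK// gt_eqF.
Qed.

Lemma urn_universal_closed f : continuous f -> bounded_fun f ->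
  (forall ep : R, 0 < ep -> exists2 g : R -> R, [/\ continuous g, bounded_fun g & urn_universal K g] &
    forall x, `|f x - g x| <= ep) ->
  urn_universal K f.
Proof.
move=> cf bf h ep ep0; have [g [cg bg ug] fg] := h (ep / 4) (divr_gt0 ep0 (ltr0n R 4)).
have [d d0 hd] := ug (ep / 4) (divr_gt0 ep0 (ltr0n R 4)).
exists d => // N M L D e w def x pat M0 w1 e1 x4.
have {}hd := hd _ _ _ _ _ _ _ _ pat M0 w1 e1 x4.
have N0 : (0 < N)%N := leq_trans (pattern_width_gt0 pat) (pattern_width_le pat).
have sg := semicircle_close (urn_variance x) cf bf cg bg fg.
set a := avg _; set b := avg _ in hd.
have ab : `|a - b| <= ep / 4.
  rewrite /a /b -avgB (le_trans (norm_avg_le _))//.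
  rewrite -[leRHS](avg_cst (card_samples (L := L) M0)); apply: avg_le => phi.
  by apply: spectral_mean_close => //; exact: pattern_matrix_tr pat _.
set A := (\int[_]_x _)%R in sg *; set B := (\int[_]_x _)%R in hd sg *.
rewrite (_ : a - A = (a - b) + (b - B) - (A - B)); last by ring.
rewrite (le_trans (ler_normB _ _))//; have := ler_normD (a - b) (b - B); lra.
Qed.

Lemma urn_universal1 : urn_universal K (fun=> 1).
Proof.
move=> ep ep0; exists 1 => // N M L D e w def x pat M0 _ _ _.
rewrite semicircle1 (_ : avg _ = 1) ?subrr ?normr0 ?ltW//.
rewrite -[RHS](avg_cst (card_samples (L := L) M0)); apply: eq_avg => phi.
apply: spectral_mean_cst; last exact: pattern_matrix_tr pat _.
exact: leq_trans (pattern_width_gt0 pat) (pattern_width_le pat).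
Qed.

Section resolvent_functions.
Variables (s : R) (s_ge : 4 * K <= s).
Let eta := Num.sqrt s.
Let s_gt0 : 0 < s. Proof. by have := K_ge1; have := s_ge; lra. Qed.
Let eta2 : eta ^+ 2 = s. Proof. by rewrite sqr_sqrtr// ltW. Qed.
Let eta_gt0 : 0 < eta. Proof. by rewrite sqrtr_gt0. Qed.
Let eta_ge1 : 1 <= eta.
Proof. by rewrite -sqrtr1 ler_wsqrtr//; have := K_ge1; have := s_ge; lra. Qed.

Let real_part (z : R[i]) : `|complex.Re z| <= normc z.
Proof.
by case: z => a b /=; rewrite -sqrtr_sqr ler_wsqrtr// lerDl sqr_ge0.
Qed.

Let imag_part (z : R[i]) : `|complex.Im z| <= normc z.
Proof.
by case: z => a b /=; rewrite -sqrtr_sqr ler_wsqrtr// lerDr sqr_ge0.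
Qed.

Let Re_avg (T : finType) (n : nat) (h : T -> R[i]) (c : R) :
  complex.Re (n%:R^-1 * avg h - (0 +i* c)%C) = avg (fun t => n%:R^-1 * complex.Re (h t)).
Proof.
have ReM (r : R) (z : R[i]) : complex.Re (r%:C%C * z) = r * complex.Re z.
  by case: z => a b /=; rewrite mul0r subr0.
have ReD : {morph @complex.Re R : x y / x + y} by case=> a b [a' b'].
have ReB (z : R[i]) : complex.Re (z - (0 +i* c)%C) = complex.Re z by case: z => a b /=; rewrite subr0.
rewrite ReB avgZ unlock -!(rmorph_nat (real_complex R)) -!fmorphV !ReM.
by rewrite (big_morph _ ReD erefl).
Qed.

Let Im_avg (T : finType) (n : nat) (h : T -> R[i]) (c : R) :
  complex.Im (n%:R^-1 * avg h - (0 +i* c)%C) = avg (fun t => n%:R^-1 * complex.Im (h t)) - c.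
Proof.
have ImM (r : R) (z : R[i]) : complex.Im (r%:C%C * z) = r * complex.Im z.
  by case: z => a b /=; rewrite mul0r addr0.
have ImD : {morph @complex.Im R : x y / x + y} by case=> a b [a' b'].
have ImB (z : R[i]) : complex.Im (z - (0 +i* c)%C) = complex.Im z - c by case: z.
rewrite ImB avgZ unlock -!(rmorph_nat (real_complex R)) -!fmorphV !ImM.
by rewrite (big_morph _ ImD erefl).
Qed.

Lemma urn_universal_u : urn_universal K (fun x => (x ^+ 2 + s)^-1).
Proof.
move=> ep ep0; have etaK : 4 * K <= eta ^+ 2 by rewrite eta2.
have [d d0 hd] := mean_trace_close eta_ge1 etaK ep0.
exists d => // N M L D e w def x pat M0 w1 e1 x4.
have := le_trans (imag_part _) (hd _ _ _ _ _ _ _ _ pat M0 w1 e1 x4).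
rewrite Im_avg.
have v0 := urn_variance_ge0 x M0.
rewrite -{2}eta2 semicircle_u//.
set c := eta + _; have c0 : 0 < c by rewrite ltr_pwDl// sqrtr_ge0.
have -> : avg (fun phi : {ffun 'I_L -> 'I_M} => N%:R^-1 *
    complex.Im (\sum_i resolvent eta (pattern_matrix D e w (x \o phi)) i i)) =
  eta * avg (fun phi : {ffun 'I_L -> 'I_M} =>
    spectral_mean (fun z => (z ^+ 2 + s)^-1) (pattern_matrix D e w (x \o phi))).
  rewrite -avgZ; apply: eq_avg => phi.
  rewrite trace_resolvent_Im//; last exact: pattern_matrix_tr pat _.
  by rewrite eta2 /spectral_mean -mulr_sumr mulrCA.
set a := avg _.
have -> : eta * a - 2 / c = eta * (a - 2 / (eta * c)) by field; rewrite !gt_eqF.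
rewrite normrM gtr0_norm// => /(le_trans _); apply.
by rewrite ler_peMl.
Qed.

Lemma urn_universal_xu : urn_universal K (fun x => x * (x ^+ 2 + s)^-1).
Proof.
move=> ep ep0; have etaK : 4 * K <= eta ^+ 2 by rewrite eta2.
have [d d0 hd] := mean_trace_close eta_ge1 etaK ep0.
exists d => // N M L D e w def x pat M0 w1 e1 x4.
have := le_trans (real_part _) (hd _ _ _ _ _ _ _ _ pat M0 w1 e1 x4).
rewrite Re_avg.
rewrite -{2}eta2 semicircle_xu// subr0.
congr (`|_| <= _); apply: eq_avg => phi.
rewrite trace_resolvent_Re//; last exact: pattern_matrix_tr pat _.
by rewrite eta2.
Qed.

End resolvent_functions.

Lemma urn_universal_compact (f : R -> R) (B : R) : continuous f -> 0 < B ->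
  (forall x : R, B <= `|x| -> f x = 0) -> urn_universal K f.
Proof.
move=> cf B0 fB.
pose Cls (f : R -> R) := [/\ continuous f, bounded_fun f & urn_universal K f].
suff [_ _ //] : Cls f.
have s0 : 1 <= 4 * K by have := K_ge1; lra.
apply: (resolvent_density s0 _ _ _ _ _ cf B0 fB) => {f cf fB}.
- move=> c f g [cf bf uf] [cg bg ug]; split; last exact: urn_universal_lin.
    exact: continuous_lin.
  exact: bounded_lin.
- move=> f h.
  have cf : continuous f.
    by apply: unif_limit_continuous => ep /h[g [cg _ _] ?]; exists g.
  have bf : bounded_fun f.
    by have [g [_ bg _] ?] := h 1 ltr01; exact: (bounded_unif_limit bg).
  by split => //; apply: urn_universal_closed.
- split; [by move=> x; exact: cvg_cst| |exact: urn_universal1].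
  by apply/bounded_funP; exists 1 => x; rewrite normr1.
- move=> s Ks; have s1 := le_trans s0 Ks; have sp := lt_le_trans ltr01 s1.
  split; [exact: continuous_u|exact: bounded_u|exact: urn_universal_u].
- move=> s Ks; have s1 := le_trans s0 Ks.
  split; [exact: continuous_xu|exact: bounded_xu|exact: urn_universal_xu].
Qed.

(** The class of test functions with the universal limit contains the resolvent
    functions and is closed under linear combinations and uniform limits, hence
    contains all compactly supported functions. Applied to a cutoff function, this
    also shows that no mass escapes to infinity, because the semicircle laws
    involved live in a fixed interval; so bounded functions are included. *)
Theorem urn_semicircle (f : R -> R) : continuous f -> bounded_fun f -> urn_universal K f.
Proof.
move=> cf /[dup] bf /bounded_funP[m hm] ep ep0.
pose B := 2 * Num.sqrt K; have B0 : 0 <= B by rewrite mulr_ge0// sqrtr_ge0.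
have B1 : 0 < B + 1 by rewrite ltr_wpDl.
have m0 : 0 <= m by rewrite (le_trans _ (hm 0)).
have m1 : 0 < 2 * (m + 1) by rewrite mulr_gt0// ltr_wpDl.
have cc : continuous (fun x => f x * cutoff B x) := cutoffM_continuous cf (B := B).
have bc : bounded_fun (fun x => f x * cutoff B x).
  apply/bounded_funP; exists m => x; have /andP[h0 h1] := cutoff01 B x.
  by rewrite normrM (ger0_norm h0) (le_trans _ (hm x))// ler_piMr.
have bk : bounded_fun (cutoff B).
  by apply/bounded_funP; exists 1 => x; have /andP[h0 h1] := cutoff01 B x; rewrite ger0_norm.
have [|d1 d10 h1] := urn_universal_compact cc B1 _ (divr_gt0 ep0 (ltr0n R 2)).
  by move=> x xB; rewrite cutoff_out ?mulr0.
have [|d2 d20 h2] := urn_universal_compact (continuous_cutoff (B := B)) B1 _ (divr_gt0 ep0 m1).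
  by move=> x xB; rewrite cutoff_out.
exists (Num.min d1 d2); first by rewrite lt_min d10.
move=> N M L D e w def x pat M0; rewrite !le_min => /andP[w1 w2] /andP[e1 e2] x4.
have {}h1 := h1 _ _ _ _ _ _ _ _ pat M0 w1 e1 x4.
have {}h2 := h2 _ _ _ _ _ _ _ _ pat M0 w2 e2 x4.
have N0 : (0 < N)%N := leq_trans (pattern_width_gt0 pat) (pattern_width_le pat).
have vB : 2 * Num.sqrt (urn_variance x) <= B.
  by rewrite ler_wpM2l// ler_wsqrtr// (urn_variance_le M0 K_ge1 x4).
have local (g : R -> R) : continuous g -> bounded_fun g ->
    continuous (fun x => g x * cutoff B x) -> bounded_fun (fun x => g x * cutoff B x) ->
    sc_int (urn_variance x) (fun x => g x * cutoff B x) = sc_int (urn_variance x) g.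
  move=> cg bg cgc bgc; apply/eqP; rewrite eq_sym -subr_eq0; apply/eqP.
  have -> : sc_int (urn_variance x) g - sc_int (urn_variance x) (fun x => g x * cutoff B x) =
      sc_int (urn_variance x) (fun x => -1 * (g x * cutoff B x) + g x).
    by rewrite semicircle_lin// mulN1r addrC.
  apply: semicircle_supp; first exact: continuous_lin.
  by move=> z zv; rewrite cutoff_in ?(le_trans zv)//; ring.
rewrite local// in h1.
have c1 : continuous (fun _ : R => 1 : R) by move=> z; exact: cvg_cst.
have b1 : bounded_fun (fun _ : R => 1 : R) by apply/bounded_funP; exists 1 => z; rewrite normr1.
have E1 : (fun z => 1 * cutoff B z) = cutoff B by apply/funext => z; rewrite mul1r.
have := local _ c1 b1; rewrite E1 semicircle1 => /(_ (continuous_cutoff (B := B)) bk) ck.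
rewrite ck in h2.
set a := avg _; set b := avg _ in h1; set k := avg _ in h2.
set I := (\int[_]_x _)%R in h1 *.
have As (phi : {ffun 'I_L -> 'I_M}) := pattern_matrix_tr pat (x \o phi).
have ab : `|a - b| <= m * (1 - k).
  rewrite /a /b -avgB (le_trans (norm_avg_le _))//.
  rewrite -(avg_cst (card_samples (L := L) M0) 1) -avgB -avgZ; apply: avg_le => phi.
  rewrite -(spectral_mean_cst 1 N0 (As phi)).
  have linB g h : spectral_mean g (pattern_matrix D e w (x \o phi)) - spectral_mean h (pattern_matrix D e w (x \o phi)) =
    spectral_mean (fun z => -1 * h z + g z) (pattern_matrix D e w (x \o phi)).
    by rewrite spectral_mean_lin mulN1r addrC.
  rewrite !linB.
  have -> : m * spectral_mean (fun z => -1 * cutoff B z + 1) (pattern_matrix D e w (x \o phi)) =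
    spectral_mean (fun z => m * (1 - cutoff B z)) (pattern_matrix D e w (x \o phi)).
    rewrite /spectral_mean mulrCA; congr (_ * _); rewrite mulr_sumr; apply: eq_bigr => z _.
    by rewrite mulN1r addrC.
  apply: spectral_mean_norm_le => z; have /andP[k0 k1] := cutoff01 B z.
  rewrite (_ : _ + _ = f z * (1 - cutoff B z)); last by ring.
  by rewrite normrM (ger0_norm (_ : 0 <= 1 - _)) ?subr_ge0// ler_wpM2r// subr_ge0.
have hk : m * (1 - k) <= ep / 2.
  apply: (@le_trans _ _ ((m + 1) * (ep / (2 * (m + 1))))).
    apply: (@le_trans _ _ (m * (ep / (2 * (m + 1))))).
      rewrite ler_wpM2l//; apply: le_trans h2; rewrite distrC; exact: ler_norm.
    by rewrite ler_wpM2r ?lerDl// divr_ge0 ?ltW.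
  rewrite le_eqVlt; apply/orP; left; apply/eqP; field.
  by rewrite gt_eqF// ltr_wpDl.
rewrite (_ : a - I = (a - b) + (b - I)); last by ring.
rewrite (le_trans (ler_normD _ _))// [leRHS]splitr lerD//.
exact: le_trans hk.
Qed.

End fixed_bound.

End urn_spectrum.

(** * Almost sure convergence of running means *)

Section running_means.
Context {R : realType}.
Implicit Types Y : nat -> R.

Definition running_mean Y (n : nat) : R := n%:R^-1 * \sum_(i < n) Y i.

(** Convergence is first proved along the fourth powers, then between them. *)
Let p (k : nat) : nat := (k.+1 ^ 4)%N.
Let s (k : nat) : R := k.+1%:R.

Let s_gt0 k : 0 < s k. Proof. by rewrite ltr0n. Qed.

Let pE k : (p k)%:R = s k ^+ 4 :> R. Proof. by rewrite /p natrX. Qed.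

Lemma sum_inverse_squares (K : nat) : \sum_(k < K) s k ^- 2 <= 2.
Proof.
case: K => [|K]; first by rewrite big_ord0.
apply: (@le_trans _ _ (2 - (s K)^-1)); last by rewrite lerBlDr lerDl invr_ge0 ltW.
elim: K => [|K ih]; first by rewrite big_ord_recr big_ord0 /= /s; lra.
rewrite big_ord_recr /= (le_trans (lerD ih (lexx _)))//.
have sS : s K.+1 = s K + 1 by rewrite /s -natr1.
rewrite sS; have := s_gt0 K; set z := s K => z0.
have -> : 2 - z^-1 + (z + 1) ^- 2 = 2 - (z + 1)^-1 - (z * (z + 1) ^+ 2)^-1.
  by field; rewrite !gt_eqF// addr_gt0.
by rewrite lerBlDr lerDl invr_ge0 mulr_ge0 ?(ltW z0)// sqr_ge0.
Qed.

Lemma fourth_power_gap k : (p k.+1 - p k)%:R <= 15 * s k ^+ 3.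
Proof.
rewrite natrB; last by rewrite /p leq_exp2r.
rewrite !pE (_ : s k.+1 = s k + 1); last by rewrite /s -[in LHS]natr1.
have : 1 <= s k by rewrite /s ler1n.
set z := s k => z1; have : 0 <= (z - 1) * (11 * z ^+ 2 + 5 * z + 1).
  by apply: mulr_ge0; [lra|nra].
nra.
Qed.

Let p_locate n : (0 < n)%N -> exists k, (p k <= n < p k.+1)%N.
Proof.
elim: n => // -[_ _|n ih _]; first by exists 0%N.
have [k /andP[k1 k2]] := ih isT.
have [h|h] := ltnP n.+2 (p k.+1); first by exists k; rewrite (leq_trans k1).
exists k.+1; rewrite h /= (leq_ltn_trans k2)//.
by rewrite /p ltn_exp2r.
Qed.

(** The bound makes the increments along the fourth powers absolutely summable and
    the blocks between consecutive fourth powers negligible, since such a block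
    has relative length [O (1 / k)]. *)
Lemma running_mean_cvg Y (B : R) :
  (forall K : nat, \sum_(k < K) (s k ^+ 2 * (running_mean Y (p k.+1) - running_mean Y (p k)) ^+ 2 +
     s k ^- 5 * \sum_(p k <= i < p k.+1) Y i ^+ 2) <= B) ->
  cvgn (running_mean Y).
Proof.
move=> hB; set S := running_mean Y in hB *.
pose d k := S (p k.+1) - S (p k).
pose e k := s k ^- 5 * \sum_(p k <= i < p k.+1) Y i ^+ 2.
have e_ge0 k : 0 <= e k.
  by rewrite mulr_ge0 ?invr_ge0 ?exprn_ge0 ?(ltW (s_gt0 k))// sumr_ge0// => i _; exact: sqr_ge0.
have u_ge0 k : 0 <= s k ^+ 2 * d k ^+ 2 by rewrite mulr_ge0 ?sqr_ge0.
have bounded_cvg (f : nat -> R) (C : R) : (forall k, 0 <= f k) ->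
    (forall K : nat, \sum_(k < K) f k <= C) -> cvgn (series f).
  move=> f0 fC; apply: nondecreasing_is_cvgn; first exact: nondecreasing_series.
  by exists C => _ [n _ <-]; rewrite seriesEord; exact: fC.
have cd : cvgn (series d).
  apply: normed_cvg; apply: (@bounded_cvg (fun k => `|d k|) (2 + B)) => [k|K]; first exact: normr_ge0.
  apply: (@le_trans _ _ (\sum_(k < K) (s k ^- 2 + (s k ^+ 2 * d k ^+ 2 + e k)))).
    apply: ler_sum => k _ /=; have sk := s_gt0 k.
    have : 0 <= (s k * `|d k| - (s k)^-1) ^+ 2 by exact: sqr_ge0.
    rewrite (_ : _ ^+ 2 = s k ^+ 2 * `|d k| ^+ 2 - 2 * `|d k| + s k ^- 2); last first.
      by field; rewrite gt_eqF.
    rewrite real_normK ?num_real//; have := e_ge0 k; have := u_ge0 k.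
    have : 0 <= s k ^- 2 by rewrite invr_ge0 sqr_ge0.
    by have := normr_ge0 (d k); move: `|d k| (s k ^- 2) (s k ^+ 2 * d k ^+ 2) (e k) => z1 z2 z3 z4; lra.
  by rewrite big_split lerD// sum_inverse_squares.
have [l Sl] : exists l : R, S (p k) @[k --> \oo] --> l.
  exists (S (p 0) + limn (series d)).
  have -> : (fun k => S (p k)) = (fun k => S (p 0) + series d k).
    by apply/funext => k; rewrite {1}(eq_sum_telescope (fun k => S (p k)) k).
  by apply: cvgD; [exact: cvg_cst|exact: cd].
have e0 : e k @[k --> \oo] --> 0.
  apply: cvg_series_cvg_0; apply: (@bounded_cvg _ B) => // K.
  by rewrite (le_trans _ (hB K))// ler_sum// => k _; rewrite lerDr.
have i0 : (s k)^-1 @[k --> \oo] --> 0 by exact: cvg_harmonic.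
suff : S n @[n --> \oo] --> l by move=> h; apply/cvg_ex; exists l.
apply/cvgrPdist_le => ep ep0.
(* A quarter each for [S (p k)] against the limit, for the new terms, and for the
   change of normalization; the last quarter is slack. *)
pose del := ep / 4; have del0 : 0 < del by rewrite divr_gt0.
have iS : (s k)^-1 * S (p k) @[k --> \oo] --> 0 * l by exact: cvgM.
rewrite mul0r in iS.
have del1 : 0 < del / 15 by rewrite divr_gt0.
have del2 : 0 < del ^+ 2 / 15 by rewrite divr_gt0// exprn_gt0.
have [k0 _ hk0] : \forall k \near \oo, [/\ `|l - S (p k)| <= del,
    `|0 - (s k)^-1 * S (p k)| <= del / 15 & `|0 - e k| <= del ^+ 2 / 15].
  move/cvgrPdist_le: Sl => /(_ _ del0) h1.
  move/cvgrPdist_le: iS => /(_ _ del1) h2.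
  move/cvgrPdist_le: e0 => /(_ _ del2) h3.
  by near=> k; split; [near: k; exact: h1|near: k; exact: h2|near: k; exact: h3].
near=> n.
have pn : (p k0 <= n)%N by near: n; exact: nbhs_infty_ge.
have [k /andP[kn nk]] : exists k, (p k <= n < p k.+1)%N.
  by apply: p_locate; rewrite (leq_trans _ pn)// /p expn_gt0.
have k0k : (k0 <= k)%N.
  by have := leq_ltn_trans pn nk; rewrite /p ltn_exp2r.
have [h1 h2 h3] := hk0 k k0k.
rewrite sub0r normrN normrM ger0_norm ?invr_ge0 ?(ltW (s_gt0 k))// in h2.
rewrite sub0r normrN ger0_norm// in h3.
have sk := s_gt0 k.
have pk0 : 0 < (p k)%:R :> R by rewrite pE exprn_gt0.
have n0 : 0 < n%:R :> R by rewrite ltr0n (leq_trans _ kn)// /p expn_gt0.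
have nkR : (p k)%:R <= n%:R :> R by rewrite ler_nat.
have gap : n%:R - (p k)%:R <= 15 * s k ^+ 3.
  rewrite -natrB// (le_trans _ (fourth_power_gap k))// ler_nat leq_sub2r// ltnW//.
pose Z := \sum_(p k <= i < n) Y i.
have SE : S n - S (p k) = n%:R^-1 * Z - ((n%:R - (p k)%:R) / n%:R) * S (p k).
  rewrite /S /running_mean -!(big_mkord xpredT) (big_cat_nat _ kn)//= -/Z.
  by field; rewrite !gt_eqF.
have Z_le : `|n%:R^-1 * Z| <= del.
  rewrite normrM ger0_norm ?invr_ge0 ?(ltW n0)//.
  apply: (@le_trans _ _ ((p k)%:R^-1 * `|Z|)).
    by rewrite ler_wpM2r// lef_pV2 ?posrE.
  rewrite ler_pdivrMl//.
  pose a := del * s k / 15; have a0 : 0 < a by rewrite divr_gt0// mulr_gt0.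
  apply: (@le_trans _ _ (\sum_(p k <= i < n) (a / 2 + (2 * a)^-1 * Y i ^+ 2))).
    rewrite (le_trans (ler_norm_sum _ _ _))// ler_sum// => i _.
    have : 0 <= (2 * a)^-1 * (`|Y i| - a) ^+ 2 by rewrite mulr_ge0 ?sqr_ge0// invr_ge0 mulr_ge0// ltW.
    rewrite (_ : _ * _ = (2 * a)^-1 * `|Y i| ^+ 2 - `|Y i| + a / 2); last by field; rewrite gt_eqF.
    by rewrite real_normK ?num_real//; lra.
  rewrite big_split /= sumr_const_nat -[(a / 2) *+ _]mulr_natr -mulr_sumr natrB//.
  have hY : \sum_(p k <= i < n) Y i ^+ 2 <= s k ^+ 5 * (del ^+ 2 / 15).
    apply: (@le_trans _ _ (\sum_(p k <= i < p k.+1) Y i ^+ 2)).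
      rewrite [leRHS](big_cat_nat kn (ltnW nk))//= lerDl sumr_ge0// => i _; exact: sqr_ge0.
    by move: h3; rewrite /e ler_pdivrMl ?exprn_gt0.
  apply: (@le_trans _ _ (a / 2 * (15 * s k ^+ 3) + (2 * a)^-1 * (s k ^+ 5 * (del ^+ 2 / 15)))).
    by rewrite lerD ?ler_wpM2l ?divr_ge0 ?invr_ge0 ?mulr_ge0// ltW.
  rewrite le_eqVlt; apply/orP; left; apply/eqP; rewrite pE /a.
  by field; rewrite !gt_eqF.
have S_le : `|((n%:R - (p k)%:R) / n%:R) * S (p k)| <= del.
  rewrite normrM ger0_norm ?divr_ge0 ?subr_ge0 ?(ltW n0)//.
  apply: (@le_trans _ _ (15 * (s k)^-1 * `|S (p k)|)); last by rewrite -mulrA mulrC -ler_pdivlMr.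
  rewrite ler_wpM2r// ler_pdivrMr//.
  apply: (le_trans gap); rewrite -mulrA ler_wpM2l//.
  apply: (@le_trans _ _ ((s k)^-1 * (p k)%:R)); last by rewrite ler_wpM2l// invr_ge0 ltW.
  by rewrite pE le_eqVlt; apply/orP; left; apply/eqP; field; rewrite gt_eqF.
rewrite (_ : l - S n = (l - S (p k)) - (S n - S (p k))); last by ring.
rewrite (le_trans (ler_normB _ _))// SE.
have := ler_normB (n%:R^-1 * Z) ((n%:R - (p k)%:R) / n%:R * S (p k)).
rewrite (_ : ep = del + (del + del) + del); last by rewrite /del; field.
by move: h1 Z_le S_le; lra.
Unshelve. all: by end_near.
Qed.

End running_means.

Section real_expectation.
Context {d : measure_display} {T : measurableType d} {R : realType}.
Variable P : probability T R.

(** Integrability travels with the value, because without it the integral is not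
    linear. *)
Definition has_mean (f : T -> R) (c : R) : Prop :=
  P.-integrable setT (EFin \o f) /\ \int[P]_w f w = c.

Lemma has_mean_cst (c : R) : has_mean (fun=> c) c.
Proof.
split; first exact: finite_measure_integrable_cst.
transitivity (c * fine (P setT)); first exact: Rintegral_cst.
by rewrite probability_setT mulr1.
Qed.

Lemma has_mean_lin (c : R) f g a b : has_mean f a -> has_mean g b ->
  has_mean (fun w => c * f w + g w) (c * a + b).
Proof.
move=> [fi fa] [gi gb]; have cfi := integrableZl measurableT c fi.
split; first exact: (integrableD measurableT cfi gi).
by rewrite RintegralD// RintegralZl// fa gb.
Qed.

Lemma has_meanD f g a b : has_mean f a -> has_mean g b ->
  has_mean (fun w => f w + g w) (a + b).
Proof.
move=> hf hg; have := has_mean_lin 1 hf hg; rewrite mul1r.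
by congr has_mean; apply/funext => w; rewrite mul1r.
Qed.

Lemma has_meanZ (c : R) f a : has_mean f a -> has_mean (fun w => c * f w) (c * a).
Proof.
move=> hf; have := has_mean_lin c hf (has_mean_cst 0); rewrite addr0.
by congr has_mean; apply/funext => w; rewrite addr0.
Qed.

Lemma has_mean_sum (I : Type) (r : seq I) (f : I -> T -> R) (a : I -> R) :
  (forall i, has_mean (f i) (a i)) ->
  has_mean (fun w => \sum_(i <- r) f i w) (\sum_(i <- r) a i).
Proof.
move=> hf; elim: r => [|i r ih].
  rewrite big_nil; have := has_mean_cst 0; congr has_mean.
  by apply/funext => w; rewrite big_nil.
rewrite big_cons; have := has_meanD (hf i) ih; congr has_mean.
by apply/funext => w; rewrite big_cons.
Qed.

(** The sum of the series has a finite mean, hence is almost surely finite. *)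
Lemma has_mean_summable (f : nat -> T -> R) (a : nat -> R) (C : R) :
  (forall k w, 0 <= f k w) -> (forall k, has_mean (f k) (a k)) ->
  (forall K : nat, \sum_(k < K) a k <= C) ->
  {ae P, forall w, exists B : R, forall K : nat, \sum_(k < K) f k w <= B}.
Proof.
move=> f0 fa aC.
have mf k : measurable_fun setT (EFin \o f k) by have [/integrableP[]] := fa k.
have fE k : (\int[P]_w (f k w)%:E = (a k)%:E)%E.
  have [fi <-] := fa k; rewrite fineK//; exact: integrable_fin_num.
pose F w := (\sum_(k <oo) (f k w)%:E)%E.
have Fi : P.-integrable setT F.
  apply/integrableP; split.
    by apply: ge0_emeasurable_sum => [k w _ _|k _]; [rewrite lee_fin|exact: mf].
  have F0 w : (0 <= F w)%E by apply: nneseries_ge0 => k _ _; rewrite lee_fin.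
  under eq_integral do rewrite gee0_abs//.
  rewrite integral_nneseries// => [|k w _]; last by rewrite lee_fin.
  apply: (@le_lt_trans _ _ C%:E); last exact: ltry.
  apply: lime_le.
    by apply: is_cvg_nneseries => k _ _; apply: integral_ge0 => w _; rewrite lee_fin.
  apply: nearW => K; rewrite big_mkord; under eq_bigr do rewrite fE.
  by rewrite sumEFin lee_fin.
have := integrable_ae measurableT Fi; apply: filterS => w /(_ I) Fw.
exists (fine (F w)) => K; rewrite -lee_fin fineK// -sumEFin -(big_mkord xpredT (fun k => (f k w)%:E)).
by apply: nneseries_lim_ge => k _ _; rewrite lee_fin.
Qed.

(** Constant second moments [q] and mixed moments [rho] give
    [E (S_n S_m) = rho + (q - rho) / m] for [n <= m], so that running means are
    Cauchy in mean square at rate [1 / n]; along fourth powers this is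
    summable with room to spare. The limit is random in general. *)
Lemma strong_law (Y : nat -> T -> R) (q rho : R) :
  (forall i j, has_mean (fun w => Y i w * Y j w) (if i == j then q else rho)) ->
  {ae P, forall w, cvgn (running_mean (fun i => Y i w))}.
Proof.
move=> YY.
pose p (k : nat) := (k.+1 ^ 4)%N; pose s (k : nat) : R := k.+1%:R.
have s0 k : 0 < s k by rewrite ltr0n.
pose S n w := running_mean (fun i => Y i w) n.
have SS n m : (0 < n)%N -> (n <= m)%N -> has_mean (fun w => S n w * S m w) (rho + (q - rho) / m%:R).
  move=> n0 nm; have nR : n%:R != 0 :> R by rewrite pnatr_eq0 -lt0n.
  have mR : m%:R != 0 :> R by rewrite pnatr_eq0 -lt0n (leq_trans n0).
  have h : has_mean (fun w => \sum_(i < n) \sum_(j < m) Y i w * Y j w)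
     (\sum_(i < n) \sum_(j < m) if i == j :> nat then q else rho).
    by apply: has_mean_sum => i; apply: has_mean_sum => j; exact: YY.
  have := has_meanZ (n%:R^-1 * m%:R^-1) h; congr has_mean.
    by apply/funext => w; rewrite /S /running_mean mulrACA mulr_suml; congr (_ * _);
      apply: eq_bigr => i _; rewrite mulr_sumr.
  have -> : \sum_(i < n) \sum_(j < m) (if i == j :> nat then q else rho) =
      n%:R * (m%:R * rho + (q - rho)).
    rewrite -sum_ord_cst; apply: eq_bigr => i _.
    have im : (i < m)%N := leq_trans (ltn_ord i) nm.
    transitivity (\sum_(j < m) (rho + (if j == Ordinal im then q - rho else 0))).
      apply: eq_bigr => j _; rewrite -val_eqE /= eq_sym; case: eqP => _; last by rewrite addr0.
      by rewrite addrC subrK.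
    by rewrite big_split /= sum_ord_cst -big_mkcond big_pred1_eq.
  by field; rewrite nR mR.
pose C := `|q - rho| + 15 * `|q|.
pose f k w := s k ^+ 2 * (S (p k.+1) w - S (p k) w) ^+ 2 + s k ^- 5 * \sum_(p k <= i < p k.+1) Y i w ^+ 2.
pose a k := s k ^+ 2 * ((q - rho) / (p k)%:R - (q - rho) / (p k.+1)%:R)
   + s k ^- 5 * ((p k.+1 - p k)%:R * q).
have pS k : (p k <= p k.+1)%N by rewrite /p leq_exp2r.
have p0 k : (0 < p k)%N by rewrite /p expn_gt0.
have fa k : has_mean (f k) (a k).
  apply: has_meanD; apply: has_meanZ.
    have := has_meanD (SS _ _ (p0 k.+1) (leqnn _)) (has_mean_lin (-2) (SS _ _ (p0 k) (pS k)) (SS _ _ (p0 k) (leqnn _))).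
    congr has_mean; last by ring.
    by apply/funext => w; ring.
  rewrite (_ : _ * q = \sum_(p k <= i < p k.+1) q); last by rewrite sumr_const_nat mulr_natl.
  apply: has_mean_sum => i; have := YY i i; rewrite eqxx.
  by congr has_mean; apply/funext => w; rewrite expr2.
have f0 k w : 0 <= f k w.
  apply: addr_ge0; rewrite mulr_ge0 ?sqr_ge0 ?invr_ge0 ?exprn_ge0 ?(ltW (s0 k))//.
  by rewrite sumr_ge0// => i _; exact: sqr_ge0.
have aC k : a k <= C * s k ^- 2.
  rewrite /a /C [leRHS]mulrDl lerD//.
    apply: (@le_trans _ _ (s k ^+ 2 * (`|q - rho| / (p k)%:R))).
      rewrite ler_wpM2l ?sqr_ge0// -mulrBr.
      apply: (le_trans (ler_norm _)); rewrite normrM ler_wpM2l// ger0_norm.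
        by rewrite lerBlDr lerDl invr_ge0.
      by rewrite subr_ge0 lef_pV2 ?posrE ?ltr0n// ler_nat.
    rewrite /p natrX -/(s k) le_eqVlt; apply/orP; left; apply/eqP; field.
    by rewrite gt_eqF.
  apply: (@le_trans _ _ (s k ^- 5 * ((15 * s k ^+ 3) * `|q|))).
    rewrite ler_wpM2l ?invr_ge0 ?exprn_ge0 ?(ltW (s0 k))//.
    by apply: (le_trans (ler_wpM2l _ (ler_norm q))) => //; rewrite ler_wpM2r// fourth_power_gap.
  rewrite le_eqVlt; apply/orP; left; apply/eqP; field.
  by rewrite gt_eqF.
have C0 : 0 <= C by rewrite addr_ge0// mulr_ge0.
have := has_mean_summable f0 fa (C := C * 2).
have hC (K : nat) : \sum_(k < K) a k <= C * 2.
  apply: (@le_trans _ _ (\sum_(k < K) C * s k ^- 2)); first exact: ler_sum.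
  by rewrite -mulr_sumr ler_wpM2l// sum_inverse_squares.
move=> /(_ hC); apply: filterS => w [B hB].
exact: (@running_mean_cvg _ _ B).
Qed.

End real_expectation.

(** * Strict and periodic bands *)

Section band_patterns.
Implicit Types (N b : nat).

Let leq_cardU (T : finType) (A B : pred T) : (#|[predU A & B]| <= #|A| + #|B|)%N.
Proof. by rewrite -cardUI leq_addr. Qed.

Lemma card_window N (u c q : nat) :
  (#|[pred j : 'I_N | (u <= j + c < u + q)%N]| <= q)%N.
Proof.
case: q => [|q].
  by rewrite leqn0; apply/eqP/eq_card0 => j; rewrite !inE addn0; lia.
rewrite -[leqRHS]card_ord; apply: (@leq_card_in _ _ (fun j : 'I_N => inord (j + c - u) : 'I_q.+1)).
move=> j k; rewrite !inE => hj hk /(congr1 val) /=.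
rewrite !inordK; [|lia|lia] => h; apply: val_inj => /=; lia.
Qed.

Lemma card_window_ge N (u q : nat) (D : pred 'I_N) :
  (forall j : 'I_N, (u <= j < u + q)%N -> D j) -> (u + q <= N)%N ->
  (q <= #|[pred j | D j]|)%N.
Proof.
move=> hD uq; have lt (k : 'I_q) : (u + k < N)%N by have := ltn_ord k; lia.
pose h k := Ordinal (lt k); have h_inj : injective h.
  by move=> k l /(congr1 val) /= kl; apply: val_inj => /=; lia.
rewrite -[leqLHS]card_ord -(card_codom h_inj); apply: subset_leq_card.
apply/fintype.subsetP => _ /codomP[k ->]; rewrite !inE; apply: hD => /=.
by have := ltn_ord k; lia.
Qed.

Definition near_diag (dist : nat -> nat -> nat -> nat) N b : rel 'I_N :=
  fun i j => (dist N i j <= b)%N.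

Lemma strict_distE N i j : strict_dist N i j = (maxn i j - minn i j)%N.
Proof. rewrite /strict_dist; lia. Qed.

Lemma strict_dist_sym N i j : strict_dist N i j = strict_dist N j i.
Proof. by rewrite !strict_distE maxnC minnC. Qed.

Lemma periodic_dist_sym N i j : periodic_dist N i j = periodic_dist N j i.
Proof. by rewrite /periodic_dist strict_dist_sym. Qed.

(** The windows of two rows at distance less than [q] differ by two intervals of
    length less than [q]. *)
Lemma strict_regular N b (q : nat) (i k : 'I_N) : (k <= i < k + q)%N ->
  (#|[pred j | near_diag strict_dist b i j != near_diag strict_dist b k j]| <= 4 * q)%N.
Proof.
move=> ik; pose W u c := [pred j : 'I_N | (u <= j + c < u + q)%N].
have h := leq_cardU (W (k + b).+1 0%N) (W k b).
have sub : (#|[pred j | near_diag strict_dist b i j != near_diag strict_dist b k j]|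
    <= #|[predU W (k + b).+1 0%N & W k b]|)%N.
  apply: subset_leq_card; apply/fintype.subsetP => j.
  by rewrite !inE /near_diag !strict_distE; lia.
apply: (leq_trans sub); apply: (leq_trans h).
by apply: (leq_trans (leq_add (card_window _ _ _ _) (card_window _ _ _ _))); lia.
Qed.

(** Modulo [N] the window consists of up to three intervals, whose endpoints move
    across at most four intervals. *)
Lemma periodic_regular N b (q : nat) (i k : 'I_N) : (b < N)%N -> (k <= i < k + q)%N ->
  (#|[pred j | near_diag periodic_dist b i j != near_diag periodic_dist b k j]| <= 4 * q)%N.
Proof.
move=> bN ik; pose W u c := [pred j : 'I_N | (u <= j + c < u + q)%N].
pose U1 := [predU W (k + b).+1 0%N & W k b]; pose U2 := [predU W (k + N)%N b & W (k + b).+1 N].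
have h := leq_cardU U1 U2.
have h1 := leq_cardU (W (k + b).+1 0%N) (W k b).
have h2 := leq_cardU (W (k + N)%N b) (W (k + b).+1 N).
have sub : (#|[pred j | near_diag periodic_dist b i j != near_diag periodic_dist b k j]|
    <= #|[predU U1 & U2]|)%N.
  apply: subset_leq_card; apply/fintype.subsetP => j.
  rewrite !inE /near_diag /periodic_dist !strict_distE.
  by have := ltn_ord i; have := ltn_ord j; have := ltn_ord k; lia.
apply: (leq_trans sub); apply: (leq_trans h); apply: (leq_trans (leq_add h1 h2)).
have hW u c := card_window N u c q.
by apply: (leq_trans (leq_add (leq_add (hW _ _) (hW _ _)) (leq_add (hW _ _) (hW _ _)))); lia.
Qed.

Lemma strict_degree_le N b (i : 'I_N) :
  (#|[pred j | near_diag strict_dist b i j]| <= band_width b N)%N.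
Proof.
rewrite /band_width leq_min; apply/andP; split.
  by rewrite -[leqRHS]card_ord; exact: max_card.
apply: (leq_trans _ (card_window N i b (2 * b + 1))); apply: subset_leq_card.
by apply/fintype.subsetP => j; rewrite !inE /near_diag strict_distE; lia.
Qed.

Lemma strict_degree_ge N b (i : 'I_N) : (b < N)%N ->
  (b <= #|[pred j | near_diag strict_dist b i j]|)%N.
Proof.
move=> bN; have iN := ltn_ord i; have [h|h] := leqP (i + b) N.
  apply: (@card_window_ge _ i) => [j|]; last by lia.
  by rewrite /near_diag strict_distE; lia.
apply: (@card_window_ge _ (N - b)) => [j|]; last by lia.
by rewrite /near_diag strict_distE; have := ltn_ord j; lia.
Qed.

Lemma strict_degree_interior N b (i : 'I_N) : (b <= i)%N -> (i + b < N)%N ->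
  (2 * b + 1 <= #|[pred j | near_diag strict_dist b i j]|)%N.
Proof.
move=> bi ib; apply: (@card_window_ge _ (i - b)) => [j|]; last by lia.
by rewrite /near_diag strict_distE; lia.
Qed.

Lemma periodic_degree N b (i : 'I_N) : (b < N)%N ->
  #|[pred j | near_diag periodic_dist b i j]| = band_width b N.
Proof.
move=> bN; have iN := ltn_ord i; rewrite /band_width.
have [h|h] := leqP N (2 * b + 1).
  rewrite -[RHS]card_ord; apply: eq_card => j.
  by rewrite !inE /near_diag /periodic_dist strict_distE; have := ltn_ord j; lia.
have lt (k : 'I_(2 * b + 1)) : ((i + k + (N - b)) %% N < N)%N by rewrite ltn_mod; lia.
(* [g] runs through the window of row [i] from left to right, modulo [N]. *)
pose g k := Ordinal (lt k); have gE (k : 'I_(2 * b + 1)) :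
    (i + k + (N - b) = g k + N \/ i + k + (N - b) = g k \/ i + k + (N - b) = g k + 2 * N)%N.
  have kb := ltn_ord k; rewrite /g /=.
  have := divn_eq (i + k + (N - b)) N; have := lt k.
  set r := (_ %% _)%N; set m := (_ %/ _)%N => rN e.
  have : (m < 3)%N by rewrite /m ltn_divLR; lia.
  by case: m e => [|[|[|]]] //; lia.
have g_inj : injective g.
  move=> k l gkl; apply: val_inj => /=.
  have := gE k; have := gE l; rewrite gkl; have := ltn_ord k; have := ltn_ord l.
  by have := ltn_ord (g l); lia.
rewrite -[RHS]card_ord -(card_codom g_inj); apply: eq_card => j.
apply/idP/idP; rewrite !inE /near_diag /periodic_dist strict_distE; last first.
  move=> /codomP[k ->]; have := gE k; have := ltn_ord k; have := ltn_ord (g k); lia.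
move=> hj; have jN := ltn_ord j; apply/codomP.
have [k hk] : exists k : nat, (k < 2 * b + 1)%N /\
    ((i + k + (N - b) = j + N \/ i + k + (N - b) = j \/ i + k + (N - b) = j + 2 * N)%N).
  have [h1|h1] := leqP (maxn i j - minn i j) b; first by exists (j + b - i)%N; lia.
  have [h2|h2] := leqP i j; first by exists (j + b - i - N)%N; lia.
  by exists (j + N + b - i)%N; lia.
case: hk => kb hk; exists (Ordinal kb); apply: val_inj => /=.
have := gE (Ordinal kb); rewrite /=; have := lt (Ordinal kb) => /=; lia.
Qed.

(** Only the first and the last [b] rows are cut by the corners. *)
Lemma strict_deficit_narrow (R : realFieldType) N b : (0 < N)%N -> (b < N)%N ->
  N%:R * (1 - 2 * (b%:R / N%:R)) * (band_width b N)%:R <=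
  \sum_(i < N) (#|[pred j | near_diag strict_dist b i j]|)%:R :> R.
Proof.
move=> N0 bN; have NR : N%:R != 0 :> R by rewrite pnatr_eq0 -lt0n.
have -> : N%:R * (1 - 2 * (b%:R / N%:R)) = N%:R - (2 * b)%:R :> R by rewrite natrM; field.
have [h|h] := leqP N (2 * b).
  apply: (@le_trans _ _ 0); last exact: sumr_ge0.
  by rewrite mulr_le0_ge0// subr_le0 ler_nat.
rewrite -natrB 1?ltnW// -natrM -natr_sum ler_nat.
have -> : band_width b N = (2 * b + 1)%N by rewrite /band_width; lia.
apply: (@leq_trans (\sum_(i < N | (b <= i < b + (N - 2 * b))%N) (2 * b + 1))).
  rewrite sum_nat_const leq_mul2r; apply/orP; right.
  by apply: (@card_window_ge _ b) => [j|]; lia.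
rewrite [leqRHS](bigID (fun i : 'I_N => (b <= i < b + (N - 2 * b))%N)) /=.
apply: leq_trans (leq_addr _ _); apply: leq_sum => i hi.
by apply: strict_degree_interior; lia.
Qed.

(** Every row has at least [b] free positions, and the width is at most [N]. *)
Lemma strict_deficit_wide (R : realFieldType) N b : (0 < N)%N -> (b < N)%N ->
  N%:R * (1 - (1 - b%:R / N%:R)) * (band_width b N)%:R <=
  \sum_(i < N) (#|[pred j | near_diag strict_dist b i j]|)%:R :> R.
Proof.
move=> N0 bN; have NR : N%:R != 0 :> R by rewrite pnatr_eq0 -lt0n.
have -> : N%:R * (1 - (1 - b%:R / N%:R)) = b%:R :> R by field.
apply: (@le_trans _ _ (\sum_(i < N) b%:R)).
  by rewrite sum_ord_cst mulrC ler_wpM2r// ler_nat /band_width geq_minl.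
by apply: ler_sum => i _; rewrite ler_nat; exact: strict_degree_ge.
Qed.

Lemma periodic_deficit (R : realFieldType) N b : (b < N)%N ->
  N%:R * (1 - 0) * (band_width b N)%:R <=
  \sum_(i < N) (#|[pred j | near_diag periodic_dist b i j]|)%:R :> R.
Proof.
move=> bN; under eq_bigr do rewrite periodic_degree//.
by rewrite sum_ord_cst subr0 mulr1.
Qed.

End band_patterns.

(** * From the urn to an exchangeable sequence *)

Section spectral_measure.
Context {R : realType}.

Lemma integral_eigenvalue_measure (N : nat) (A : 'M[R]_N) (f : R -> R) :
  A^T = A -> continuous f -> \int[eigenvalue_measure A]_x f x = spectral_mean f A.
Proof.
move=> As cf.
have mf : measurable_fun [set: measurableTypeR R] (EFin \o f).
  by apply/measurable_EFinP; exact: continuous_measurable_fun.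
have ge0 (g : R -> \bar R) : measurable_fun [set: measurableTypeR R] g -> (forall x, 0 <= g x)%E ->
    (\int[eigenvalue_measure A]_x g x = (N%:R^-1)%:E * \sum_(j < N) g (eigenvalues A)`_j)%E.
  move=> mg g0; rewrite ge0_integral_mscale// ge0_integral_measure_sum//.
  by congr (_ * _)%E; apply: eq_bigr => j _; rewrite integral_dirac// diracT mul1e.
rewrite /Rintegral integralE !ge0//; [|exact: measurable_funeneg|exact: measurable_funepos].
have posE (x : R) : ((EFin \o f)^\+ x)%E = (Num.max (f x) 0)%:E.
  by rewrite funeposE /= -EFin_max.
have negE (x : R) : ((EFin \o f)^\- x)%E = (Num.max (- f x) 0)%:E.
  by rewrite funenegE /= -EFin_max.
under eq_bigr do rewrite posE.
under [X in (_ - _ * X)%E]eq_bigr do rewrite negE.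
rewrite !sumEFin -!EFinM -EFinB /= -mulrBr -sumrB /spectral_mean; congr (_ * _).
rewrite (big_nth 0) size_eigenvalues// big_mkord; apply: eq_bigr => j _.
set z := f _; have [z0|z0] := leP 0 z.
  by rewrite max_r ?subr0// oppr_le0.
by rewrite max_l ?sub0r ?opprK// oppr_ge0 ltW.
Qed.

Context {d : measure_display} {T : measurableType d}.

(** For a power this is a trace, a polynomial in the entries; a continuous [f] is
    a limit of polynomials on growing intervals. This avoids the measurability of
    the individual eigenvalues. *)
Lemma measurable_spectral_mean (N : nat) (A : T -> 'M[R]_N) (f : R -> R) :
  (forall w, (A w)^T = A w) -> (forall i j, measurable_fun setT (fun w => A w i j)) ->
  continuous f -> measurable_fun setT (fun w => spectral_mean f (A w)).
Proof.
move=> As mA cf.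
have mpow k i j : measurable_fun setT (fun w => iter k (mulmx (A w)) 1%:M i j).
  elim: k i j => [|k ih] i j /=; first exact: measurable_cst.
  under eq_fun do rewrite mxE.
  by apply: measurable_sum => l; apply: measurable_funM.
have mpoly (p : {poly R}) : measurable_fun setT (fun w => spectral_mean (fun x => p.[x]) (A w)).
  under eq_fun.
    move=> w; rewrite /spectral_mean.
    under eq_bigr do rewrite horner_coef.
    rewrite exchange_big /=.
    under eq_bigr do rewrite -mulr_sumr -trace_power//.
    over.
  apply: measurable_funM; first exact: measurable_cst.
  apply: measurable_sum => k; apply: measurable_funM; first exact: measurable_cst.
  by apply: measurable_sum => i; exact: mpow.
have /choice[p hp] (n : nat) : exists p : {poly R}, forall x : R, - n.+1%:R <= x <= n.+1%:R ->
    `|f x - p.[x]| <= n.+1%:R^-1.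
  by apply: weierstrass; rewrite ?gtrN ?invr_gt0 ?ltr0n.
apply: (@measurable_fun_cvg _ _ _ _ (fun n w => spectral_mean (fun x => (p n).[x]) (A w))) => // w _.
have [B hB] : exists B : nat, forall z, z \in eigenvalues (A w) -> `|z| <= B%:R.
  exists (Num.truncn (\sum_(z <- eigenvalues (A w)) `|z|)).+1 => z zA.
  apply: le_trans (ltW (truncnS_gt _)).
  by rewrite (big_rem z)//= lerDl sumr_ge0.
apply/cvgrPdist_le => e e0.
near=> n.
have nB : (B <= n)%N by near: n; exact: nbhs_infty_ge.
have N1 : n.+1%:R^-1 <= e by apply: ltW; near: n; exact: (near_infty_natSinv_lt (PosNum e0)).
rewrite /spectral_mean -mulrBr -sumrB.
have small (z : R) : z \in eigenvalues (A w) -> `|f z - (p n).[z]| <= e.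
  move=> zA; apply: le_trans N1; apply: hp; rewrite -ler_norml.
  by rewrite (le_trans (hB z zA))// ler_nat ltnW.
have [N0|N0] := posnP N; first by rewrite [X in X%:R^-1]N0 invr0 mul0r normr0 ltW.
rewrite normrM ger0_norm ?invr_ge0// ler_pdivrMl ?ltr0n//.
rewrite (le_trans (ler_norm_sum _ _ _))// big_seq.
rewrite (le_trans (ler_sum _ (fun z zA => small z zA)))//.
by rewrite -big_seq big_const_seq count_predT size_eigenvalues// iter_addr_0 mulr_natl.
Unshelve. all: by end_near. Qed.

End spectral_measure.

Section injections.
Variables (L M : nat) (LM : (L <= M)%N).

Lemma injection_extends (phi : 'I_L -> 'I_M) : injective phi ->
  exists s : 'S_M, forall l, s (widen_ord LM l) = phi l.
Proof.
move=> phi_inj.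
case: M LM phi phi_inj => [|M'] LM' phi phi_inj.
  by exists 1%g => l; have := ltn_ord (phi l).
pose t := codom phi ++ [seq x <- enum 'I_M'.+1 | x \notin codom phi].
have ut : uniq t.
  rewrite cat_uniq filter_uniq ?enum_uniq// andbT.
  rewrite (map_inj_uniq phi_inj) enum_uniq /= -all_predC; apply/allP => x.
  by rewrite mem_filter => /andP[].
have mt x : x \in t.
  by rewrite mem_cat mem_filter mem_enum andbT; case: (x \in codom phi).
have st : size t = M'.+1.
  by rewrite -(card_uniqP ut) -[RHS]card_ord; apply: eq_card => x; rewrite mt.
pose g (i : 'I_M'.+1) := nth ord0 t i.
have g_inj : injective g.
  move=> i j /eqP; rewrite /g nth_uniq ?st// => /eqP ij; exact: val_inj.
exists (perm g_inj) => l; rewrite permE /g /= nth_cat size_codom card_ord ltn_ord.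
by rewrite (nth_map l) ?size_enum_ord// nth_ord_enum.
Qed.

(** Sampling [L] times with replacement from [M] items seldom produces a
    repetition when [L^2] is small against [M]. *)
Lemma injections_abound (R : realFieldType) : (0 < M)%N ->
  1 - L%:R ^+ 2 / M%:R <= (#|[set phi : {ffun 'I_L -> 'I_M} | injectiveb phi]%SET|)%:R / (#|{ffun 'I_L -> 'I_M}|)%:R :> R.
Proof.
move=> M0; rewrite card_inj_ffuns card_ffun !card_ord natrX.
have MR : 0 < M%:R :> R by rewrite ltr0n.
have falling_le (l : nat) : (M ^_ l)%:R / M%:R ^+ l <= 1 :> R.
  rewrite ler_pdivrMr ?exprn_gt0// mul1r -natrX ler_nat.
  by elim: l => [|l ih]; rewrite ?ffactn0// ffactnSr expnSr leq_mul// leq_subr.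
move: LM => _; elim: L => [|l ih].
  by rewrite expr0n /= mul0r subr0 ffactn0 expr0 divr1.
rewrite ffactnSr natrM [M%:R ^+ _]exprSr invfM mulrACA.
set r := (M ^_ l)%:R / M%:R ^+ l in ih *; have r1 : r <= 1 by exact: falling_le.
have r0 : 0 <= r by rewrite divr_ge0.
have h : 1 - l%:R / M%:R <= (M - l)%:R / M%:R :> R.
  rewrite -[X in X - _](divff (lt0r_neq0 MR)) -mulrBl ler_pM2r ?invr_gt0// lerBlDr -natrD ler_nat.
  lia.
apply: (@le_trans _ _ (r * (1 - l%:R / M%:R))); last by rewrite ler_wpM2l.
apply: (@le_trans _ _ (r - l%:R / M%:R)).
  apply: (@le_trans _ _ (1 - l%:R ^+ 2 / M%:R - l%:R / M%:R)); last by rewrite lerD2r.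
  rewrite -addrA lerD2l -opprD lerN2 -mulrDl ler_pM2r ?invr_gt0// -natr1.
  have : 0 <= l%:R :> R by []. by nra.
rewrite mulrBr mulr1 lerD2l lerN2 ler_piMl// divr_ge0//.
Qed.

End injections.

(** The set of convergence is measurable by Cauchy's criterion, and the limit is a
    constant outside of it. *)
Lemma measurable_limn {d : measure_display} {T : measurableType d} {R : realType} (h : nat -> T -> R) :
  (forall n, measurable_fun setT (h n)) -> measurable_fun setT (fun w => limn (fun n => h n w)).
Proof.
move=> mh.
pose C : set T := \bigcap_k \bigcup_n \bigcap_m [set w | `|h (n + m)%N w - h n w| <= k.+1%:R^-1].
have mC : measurable C.
  apply: bigcap_measurableType => // k _; apply: bigcup_measurable => n _.
  apply: bigcap_measurableType => // m _.
  rewrite [X in measurable X](_ : _ = (fun w => `|h (n + m)%N w - h n w|) @^-1` `]-oo, k.+1%:R^-1]).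
    rewrite -[X in measurable X]setTI.
    apply: (measurableT_comp (@normr_measurable R setT)) => //; exact: measurable_funB.
  by apply/seteqP; split => w /=; rewrite in_itv.
have CE w : C w <-> cvgn (fun n => h n w).
  split=> [Cw|cw].
    apply/cauchy_cvgP/cauchy_exP => e e0.
    pose k := Num.truncn e^-1.
    have ke : k.+1%:R^-1 < e by rewrite invf_plt ?posrE ?ltr0n// truncnS_gt.
    have [n _ hn] := Cw k I; exists (h n w); exists n => // p /= np.
    rewrite -ball_normE /= distrC.
    by have := hn (p - n)%N I; rewrite /= subnKC// => /le_lt_trans; apply.
  move=> k _.
  have k0 : 0 < k.+1%:R^-1 / 2 :> R by rewrite divr_gt0// invr_gt0 ltr0n.
  have /cvgrPdist_le/(_ _ k0)[n _ hn] := cw.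
  exists n => // m _ /=; rewrite distrC [leRHS]splitr.
  rewrite (_ : _ - _ = (limn (h ^~ w) - h (n + m)%N w) - (limn (h ^~ w) - h n w)); last by ring.
  by rewrite (le_trans (ler_normB _ _))// lerD// hn//= leq_addr.
pose h' n w := (h n w - point) * \1_C w + point.
apply: (@measurable_fun_cvg _ _ _ _ h') => // [n|w _].
  apply: measurable_funD; last exact: measurable_cst.
  by apply: measurable_funM; [exact: measurable_funB|exact: measurable_indic].
rewrite /h'; have [Cw|Cw] := pselect (C w).
  have -> : (fun n => (h n w - point) * \1_C w + point) = (fun n => h n w).
    by apply/funext => n; rewrite indicE mem_set// mulr1 subrK.
  by apply/CE.
have -> : (fun n => (h n w - point) * \1_C w + point) = (fun=> point : R).
  by apply/funext => n; rewrite indicE memNset// mulr0 add0r.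
rewrite dvgP; first exact: cvg_cst.
by move/CE.
Qed.

Lemma measurable_semicircle_comp {d : measure_display} {T : measurableType d} {R : realType}
    (f : R -> R) (V : T -> R) : continuous f -> bounded_fun f -> measurable_fun setT V ->
  measurable_fun setT (fun w => \int[semicircle (V w)]_x f x).
Proof.
move=> cf bf mV.
exact: (measurableT_comp (continuous_measurable_fun (continuous_semicircle cf bf)) mV).
Qed.

Lemma avgE (K : numFieldType) (I : finType) (f : I -> K) : avg f = #|I|%:R^-1 * \sum_i f i.
Proof. by rewrite unlock. Qed.

Section exchangeable_sampling.
Context {d : measure_display} {T : measurableType d} {R : realType}.
Variables (P : probability T R) (xi : nat -> {RV P >-> R}).
Hypotheses (xi_exch : exchangeable xi) (xi_mom : finite_moments xi).

Lemma has_mean_le (f g : T -> R) (a b : R) : has_mean P f a -> has_mean P g b ->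
  (forall w, f w <= g w) -> a <= b.
Proof. by move=> [fi <-] [gi <-] fg; exact: le_Rintegral. Qed.

Lemma has_mean_norm_le (f g : T -> R) (a b : R) : has_mean P f a -> has_mean P g b ->
  (forall w, `|f w| <= g w) -> `|a| <= b.
Proof.
move=> fa gb fg; rewrite ler_norml; apply/andP; split.
  rewrite -mulN1r; apply: (has_mean_le (has_meanZ (-1) gb) fa) => w.
  by have := fg w; rewrite ler_norml mulN1r => /andP[].
by apply: (has_mean_le fa gb) => w; exact: le_trans (ler_norm _) (fg w).
Qed.

Lemma has_mean_bounded (f : T -> R) (m : R) : measurable_fun setT f ->
  (forall w, `|f w| <= m) -> has_mean P f (\int[P]_w f w).
Proof.
move=> mf fm; split => //; apply: measurable_bounded_integrable => //.
  exact: (le_lt_trans (probability_le1 P measurableT) (ltry _)).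
exists m; split; first exact: num_real.
by move=> M mM w _ /=; exact: le_trans (fm w) (ltW mM).
Qed.

Lemma has_mean_avg (I : finType) (f : I -> T -> R) (a : I -> R) :
  (forall i, has_mean P (f i) (a i)) ->
  has_mean P (fun w => avg (fun i => f i w)) (avg a).
Proof.
move=> fa; have := has_meanZ (#|I|%:R^-1) (has_mean_sum (index_enum I) fa).
rewrite -(avgE a); congr has_mean; apply/funext => w; exact/esym/avgE.
Qed.

Lemma measurable_draw (n : nat) (j : 'I_n -> nat) :
  measurable_fun setT (fun w => [tuple xi (j i) w | i < n] : n.-tuple (measurableTypeR R)).
Proof.
apply/measurable_fun_tnthP => i.
rewrite (_ : _ \o _ = xi (j i)); first exact: (measurable_funPT (xi (j i))).
by apply/funext => w /=; rewrite tnth_mktuple.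
Qed.

Lemma exchangeable_permute (n : nat) (s : 'S_n) (g : n.-tuple (measurableTypeR R) -> R) (c : R) :
  measurable_fun setT g -> has_mean P (fun w => g [tuple xi i w | i < n]) c ->
  has_mean P (fun w => g [tuple xi (s i) w | i < n]) c.
Proof.
move=> mg [gi gc].
pose d1 w : n.-tuple (measurableTypeR R) := [tuple xi i w | i < n].
pose d2 w : n.-tuple (measurableTypeR R) := [tuple xi (s i) w | i < n].
have m1 : measurable_fun setT d1 by exact: measurable_draw.
have m2 : measurable_fun setT d2 by exact: (measurable_draw (fun i => s i)).
have same (h : n.-tuple (measurableTypeR R) -> \bar R) : measurable_fun setT h -> (forall x, 0 <= h x)%E ->
    (\int[P]_w h (d2 w) = \int[P]_w h (d1 w))%E.
  move=> mh h0.
  transitivity (\int[pushforward P d2]_x h x)%E.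
    by rewrite ge0_integral_pushforward// preimage_setT.
  transitivity (\int[pushforward P d1]_x h x)%E; last first.
    by rewrite ge0_integral_pushforward// preimage_setT.
  by apply: eq_measure_integral => A mA _; rewrite /pushforward; exact/esym/xi_exch.
have mgE : measurable_fun setT (EFin \o g) by exact/measurable_EFinP.
split.
  move/integrableP : gi => [_ gi]; apply/integrableP; split.
    exact: (measurableT_comp mgE m2).
  apply: le_lt_trans gi.
  by rewrite (same (fun x => `|(g x)%:E|)%E)//; exact: measurableT_comp.
rewrite -gc /Rintegral; congr fine.
rewrite [LHS]integralE [RHS]integralE; congr (_ - _)%E.
  have := same _ (measurable_funepos mgE) (fun x => funepos_ge0 _ x).
  by congr (_ = _); apply: eq_integral => w _; rewrite !funeposE.
have := same _ (measurable_funeneg mgE) (fun x => funeneg_ge0 _ x).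
by congr (_ = _); apply: eq_integral => w _; rewrite !funenegE.
Qed.

(** An injection of [L] indices among [M] extends to a permutation of the [M]
    indices. *)
Lemma exchangeable_injection (L M : nat) (phi : 'I_L -> 'I_M)
    (g : L.-tuple (measurableTypeR R) -> R) (c : R) : (L <= M)%N -> injective phi ->
  measurable_fun setT g -> has_mean P (fun w => g [tuple xi i w | i < L]) c ->
  has_mean P (fun w => g [tuple xi (phi i) w | i < L]) c.
Proof.
move=> LM phi_inj mg gc; have [s sE] := injection_extends LM phi_inj.
pose res (t : M.-tuple (measurableTypeR R)) : L.-tuple (measurableTypeR R) :=
  [tuple tnth t (widen_ord LM l) | l < L].
have mres : measurable_fun setT res.
  apply/measurable_fun_tnthP => i.
  rewrite (_ : _ \o _ = (@tnth _ (measurableTypeR R))^~ (widen_ord LM i)); first exact: measurable_tnth.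
  by apply/funext => t /=; rewrite tnth_mktuple.
have := @exchangeable_permute M s (g \o res) c (measurableT_comp mg mres).
rewrite (_ : (fun w => (g \o res) [tuple xi i w | i < M]) = (fun w => g [tuple xi i w | i < L])); last first.
  apply/funext => w /=; congr g; apply: eq_from_tnth => i.
  by rewrite !tnth_mktuple.
move=> /(_ gc); congr has_mean; apply/funext => w /=; congr g; apply: eq_from_tnth => i.
by rewrite !tnth_mktuple sE.
Qed.

(** The finite form of de Finetti's theorem: by exchangeability the first [L]
    variables are distributed like [L] draws without replacement from the first
    [M] ones, which can be replaced by independent draws when [M] is large. *)
Lemma exchangeable_urn (L M : nat) (g : L.-tuple (measurableTypeR R) -> R) (m c : R) :
  (L <= M)%N -> (0 < M)%N -> measurable_fun setT g -> (forall t, `|g t| <= m) ->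
  has_mean P (fun w => g [tuple xi i w | i < L]) c ->
  exists2 c', has_mean P (fun w => avg (fun phi : {ffun 'I_L -> 'I_M} =>
      g [tuple xi (phi i) w | i < L])) c' &
    `|c - c'| <= 2 * m * L%:R ^+ 2 / M%:R.
Proof.
move=> LM M0 mg gm gc.
pose a (phi : {ffun 'I_L -> 'I_M}) := \int[P]_w g [tuple xi (phi i) w | i < L].
have ga (phi : {ffun 'I_L -> 'I_M}) : has_mean P (fun w => g [tuple xi (phi i) w | i < L]) (a phi).
  by apply: (@has_mean_bounded _ m) => //; exact: (measurableT_comp mg (measurable_draw (fun i => phi i))).
exists (avg a); first exact: has_mean_avg.
have m0 : 0 <= m by exact: le_trans (normr_ge0 _) (gm [tuple 0 | i < L]).
have am (phi : {ffun 'I_L -> 'I_M}) : `|a phi| <= m by apply: (has_mean_norm_le (ga phi) (has_mean_cst P m)).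
have cm : `|c| <= m by apply: (has_mean_norm_le gc (has_mean_cst P m)).
have T0 := card_samples (L := L) M0.
have mm : 0 <= 2 * m by rewrite mulr_ge0.
rewrite -(avg_cst T0 c) -avgB (le_trans (norm_avg_le _))//.
apply: (@le_trans _ _ (avg (fun phi : {ffun 'I_L -> 'I_M} => 2 * m * (1 - (injectiveb phi)%:R)))).
  apply: avg_le => phi; case: (boolP (injectiveb phi)) => [/injectiveP inj|_] /=.
    have [_ aE] := ga phi; have [_ cE] := exchangeable_injection LM inj mg gc.
    by rewrite -cE -/(a phi) subrr normr0 subrr mulr0.
  rewrite subr0 mulr1 (le_trans (ler_normB _ _))// mulr_natl mulr2n lerD//.
rewrite avgZ avgB avg_cst// -mulrA ler_wpM2l//.
have := injections_abound LM R M0.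
rewrite [X in _ <= X -> _](_ : _ = avg (fun phi : {ffun 'I_L -> 'I_M} => (injectiveb phi)%:R)); last first.
  rewrite avgE [RHS]mulrC -natr_sum -sum1_card; congr (_%:R * _).
  by rewrite big_mkcond; apply: eq_bigr => phi _; rewrite inE; case: injectiveb.
lra.
Qed.

Let moment_integrable i k : P.-integrable setT (EFin \o (fun w => xi i w ^+ k)).
Proof.
have mk : measurable_fun setT (fun w => xi i w ^+ k) by exact: measurable_funX.
apply/integrableP; split; first exact/measurable_EFinP.
have := xi_mom i k; rewrite unlock; congr (_ < _)%E.
by apply: eq_integral => w _; rewrite /= normrX.
Qed.

(** An exchangeable sequence is identically distributed, and so are its pairs. *)
Let moment_mean i k : has_mean P (fun w => xi i w ^+ k) (\int[P]_w (xi 0%N w ^+ k)).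
Proof.
have i1 : (1 <= i.+1)%N by [].
pose g (t : 1.-tuple (measurableTypeR R)) : R := tnth t ord0 ^+ k.
have mg : measurable_fun setT g by apply: measurable_funX; exact: measurable_tnth.
have g0 : has_mean P (fun w => g [tuple xi i w | i < 1]) (\int[P]_w (xi 0%N w ^+ k)).
  rewrite (_ : (fun w => _) = (fun w => xi 0%N w ^+ k)); first by split.
  by apply/funext => w; rewrite /g tnth_mktuple.
have := exchangeable_injection i1 (phi := fun=> ord_max) _ mg g0.
move=> /(_ (fun x y _ => etrans (ord1 x) (esym (ord1 y)))).
by congr has_mean; apply/funext => w; rewrite /g tnth_mktuple.
Qed.

Let product_integrable i j k : P.-integrable setT (EFin \o (fun w => xi i w ^+ k * xi j w ^+ k)).
Proof.
have h := integrableD measurableT (moment_integrable i (k * 2)) (moment_integrable j (k * 2)).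
apply: le_integrable h => //.
  by apply/measurable_EFinP/measurable_funM; exact: measurable_funX.
move=> w _ /=; rewrite lee_fin !exprM.
have := sqr_ge0 (`|xi i w ^+ k| - `|xi j w ^+ k|).
rewrite normrM (ger0_norm (addr_ge0 (sqr_ge0 _) (sqr_ge0 _))).
have := real_normK (num_real (xi i w ^+ k)); have := real_normK (num_real (xi j w ^+ k)); nra.
Qed.

Let product_mean i j k : i != j ->
  has_mean P (fun w => xi i w ^+ k * xi j w ^+ k) (\int[P]_w (xi 0%N w ^+ k * xi 1%N w ^+ k)).
Proof.
move=> ij; pose M := (i + j).+2.
pose g (t : 2.-tuple (measurableTypeR R)) : R := tnth t ord0 ^+ k * tnth t ord_max ^+ k.
have mg : measurable_fun setT g.
  by apply: measurable_funM; apply: measurable_funX; exact: measurable_tnth.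
have g0 : has_mean P (fun w => g [tuple xi i w | i < 2]) (\int[P]_w (xi 0%N w ^+ k * xi 1%N w ^+ k)).
  rewrite (_ : (fun w => _) = (fun w => xi 0%N w ^+ k * xi 1%N w ^+ k)).
    by split; first exact: product_integrable.
  by apply/funext => w; rewrite /g !tnth_mktuple.
have iM : (i < M)%N by rewrite /M; lia. have jM : (j < M)%N by rewrite /M; lia.
pose phi (l : 'I_2) : 'I_M := if l == ord0 then Ordinal iM else Ordinal jM.
have inj : injective phi.
  move=> x y; rewrite /phi; case: eqP => [->|x0]; case: eqP => [->|y0] //=.
  - by move/(congr1 val) => /= e; rewrite e eqxx in ij.
  - by move/(congr1 val) => /= e; rewrite e eqxx in ij.
  - move=> _; apply: val_inj => /=.
    have x0' : val x <> 0%N by move=> e; apply: x0; exact: val_inj.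
    have y0' : val y <> 0%N by move=> e; apply: y0; exact: val_inj.
    by have := ltn_ord x; have := ltn_ord y; move: x0' y0' => /=; lia.
have := exchangeable_injection (isT : (2 <= M)%N) inj mg g0.
by congr has_mean; apply/funext => w; rewrite /g !tnth_mktuple.
Qed.

Let power_running_mean_cvg k :
  {ae P, forall w, cvgn (running_mean (fun i => xi i w ^+ k))}.
Proof.
apply: (strong_law (q := \int[P]_w (xi 0%N w ^+ (k * 2)))
  (rho := \int[P]_w (xi 0%N w ^+ k * xi 1%N w ^+ k))) => i j.
have [->|ij] := eqVneq i j; last exact: product_mean.
have := moment_mean j (k * 2); congr has_mean; apply/funext => w.
by rewrite exprM expr2.
Qed.

(** The strong law applies to the variables and to their squares. *)
Lemma empirical_variance_cvg :
  {ae P, forall w, empirical_variance xi n w @[n --> \oo] --> limiting_variance xi w}.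
Proof.
have := power_running_mean_cvg 1; have := power_running_mean_cvg 2.
apply: filterS2 => w h2 h1.
have -> : (fun n => empirical_variance xi n w) = (fun n =>
    running_mean (fun i => xi i w ^+ 2) n - running_mean (fun i => xi i w ^+ 1) n ^+ 2) by [].
rewrite /limiting_variance; apply: is_cvgB; first exact: h2.
exact: (is_cvgM h1 h1).
Qed.

Lemma measurable_empirical_variance n : measurable_fun setT (empirical_variance xi n).
Proof.
apply: measurable_funB; [|apply: measurable_funX]; apply: measurable_funM => //.
  by apply: measurable_sum => i; exact: measurable_funX.
by apply: measurable_sum => i.
Qed.

(** Dominated convergence, by weak continuity of the semicircle law. *)
Lemma mean_semicircle_cvg (f : R -> R) : continuous f -> bounded_fun f ->
  \int[P]_w (\int[semicircle (empirical_variance xi n w)]_x f x)%R @[n --> \oo] -->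
  \int[P]_w (\int[semicircle (limiting_variance xi w)]_x f x)%R.
Proof.
move=> cf bf; have /bounded_funP[m hm] := bf.
pose sc v := \int[semicircle v]_x f x.
have csc : continuous sc by exact: continuous_semicircle.
have mlim := measurable_limn measurable_empirical_variance.
have sc_m v : `|sc v| <= m by exact: semicircle_bound.
have mf_ n : measurable_fun setT (fun w => (sc (empirical_variance xi n w))%:E).
  by apply/measurable_EFinP; exact: measurable_semicircle_comp (measurable_empirical_variance n).
have mf : measurable_fun setT (fun w => (sc (limiting_variance xi w))%:E).
  by apply/measurable_EFinP; exact: measurable_semicircle_comp mlim.
have f_f : {ae P, forall w, setT w ->
    (sc (empirical_variance xi n w))%:E @[n --> \oo] --> (sc (limiting_variance xi w))%:E}.
  apply: filterS empirical_variance_cvg => w h _; apply: cvg_EFin; first exact: nearW.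
  exact: (continuous_cvg _ (csc _) h).
have ig : P.-integrable setT (cst m%:E) by have [] := has_mean_cst P m.
have f_g : {ae P, forall w n, setT w -> (`|(sc (empirical_variance xi n w))%:E| <= cst m%:E w)%E}.
  by apply: aeW => w n _; rewrite /= lee_fin.
have [fi _ h] := dominated_convergence measurableT mf_ mf f_f ig f_g.
apply: fine_cvg; rewrite fineK//; exact: integrable_fin_num.
Qed.

(** With the matrix fixed, replace the variables by draws from the urn of the first
    [M] ones, apply the uniform semicircle law to this urn, and let [M] tend to
    infinity: its variance tends to the limiting variance. Urns with fourth moment
    above [K] are rare by Markov's inequality, used in the form that the error is
    always at most [ep / 4 + 2 m (fourth moment) / K]. *)
Lemma exchangeable_pattern_close (f : R -> R) (ep : R) : continuous f -> bounded_fun f -> 0 < ep ->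
  exists2 delta : R, 0 < delta &
  forall (N L : nat) (D : rel 'I_N) (e : 'I_N -> 'I_N -> 'I_L) (wd : nat) (def : R),
    band_pattern D e wd def -> wd%:R^-1 <= delta -> def <= delta ->
  exists2 c : R, has_mean P (fun w => spectral_mean f (pattern_matrix D e wd (fun l => xi l w))) c &
    `|c - \int[P]_w (\int[semicircle (limiting_variance xi w)]_x f x)%R| <= ep.
Proof.
move=> cf bf ep0; have /bounded_funP[m hm] := bf.
have m0 : 0 <= m by exact: le_trans (normr_ge0 _) (hm 0).
set kappa := \int[P]_w (xi 0%N w ^+ 4).
have kappa0 : 0 <= kappa.
  apply: (has_mean_le (has_mean_cst P 0) (moment_mean 0 4)) => w.
  by rewrite (exprM _ 2 2) sqr_ge0.
(* Chosen so that [2 m kappa / K <= ep / 4]. *)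
pose K := 1 + 8 * m * kappa / ep.
have K1 : 1 <= K by rewrite lerDl divr_ge0 ?mulr_ge0// ltW.
have K0 : 0 < K := lt_le_trans ltr01 K1.
have [delta delta0 urn] := urn_semicircle K1 cf bf (divr_gt0 ep0 (ltr0n R 4)).
exists delta => // N L D e wd def pat wd_le def_le.
have N0 : (0 < N)%N := leq_trans (pattern_width_gt0 pat) (pattern_width_le pat).
pose g (t : L.-tuple (measurableTypeR R)) : R := spectral_mean f (pattern_matrix D e wd (tnth t)).
have gE (j : 'I_L -> nat) w : g [tuple xi (j l) w | l < L] =
    spectral_mean f (pattern_matrix D e wd (fun l => xi (j l) w)).
  rewrite /g (_ : tnth _ = (fun l => xi (j l) w))//.
  by apply/funext => l; rewrite tnth_mktuple.
have As (y : 'I_L -> R) := pattern_matrix_tr pat y.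
have mg : measurable_fun setT g.
  apply: measurable_spectral_mean => // i j.
  under eq_fun do rewrite mxE; case: (D i j); last exact: measurable_cst.
  by apply: measurable_funM; [exact: measurable_cst|exact: measurable_tnth].
have gm t : `|g t| <= m.
  by rewrite -(spectral_mean_cst m N0 (As (tnth t))); exact: spectral_mean_norm_le.
set c := \int[P]_w g [tuple xi l w | l < L].
have gc : has_mean P (fun w => g [tuple xi l w | l < L]) c.
  by apply: (@has_mean_bounded _ m) => //; exact: (measurableT_comp mg (measurable_draw (fun l => l))).
exists c.
  have -> : (fun w => spectral_mean f (pattern_matrix D e wd (fun l => xi l w))) =
      (fun w => g [tuple xi l w | l < L]) by apply/funext => w; rewrite gE.
  exact: gc.
set s := \int[P]_w _.
pose sc v := \int[semicircle v]_x f x.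
have sc_m v : `|sc v| <= m by exact: semicircle_bound.
have msc n : measurable_fun setT (fun w => sc (empirical_variance xi n w)).
  exact: measurable_semicircle_comp (measurable_empirical_variance n).
have step (M : nat) : (0 < M)%N -> (L <= M)%N ->
    `|c - \int[P]_w sc (empirical_variance xi M w)| <= 2 * m * L%:R ^+ 2 / M%:R + ep / 2.
  move=> M0 LM; have [c' gc' cc'] := exchangeable_urn LM M0 mg gm gc.
  have sm := has_mean_bounded (msc M) (fun w => sc_m _).
  have diff := has_mean_lin (-1) sm gc'.
  have bound := has_mean_lin (2 * m / K) (has_mean_avg (fun a : 'I_M => moment_mean a 4)) (has_mean_cst P (ep / 4)).
  rewrite avg_cst ?card_ord// -/kappa in bound.
  have : `|-1 * (\int[P]_w sc (empirical_variance xi M w)) + c'| <= 2 * m / K * kappa + ep / 4.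
    apply: (has_mean_norm_le diff bound) => w.
    pose x (a : 'I_M) : R := xi a w.
    have vE : urn_variance x = empirical_variance xi M w by rewrite /urn_variance !avgE card_ord.
    rewrite mulN1r addrC -vE.
    have -> : avg (fun phi : {ffun 'I_L -> 'I_M} => g [tuple xi (phi i) w | i < L]) =
        avg (fun phi : {ffun 'I_L -> 'I_M} => spectral_mean f (pattern_matrix D e wd (x \o phi))).
      by apply: eq_avg => phi; rewrite gE.
    have x4_ge0 : 0 <= avg (fun a => x a ^+ 4).
      by apply: avg_ge0 => a; rewrite (exprM _ 2 2) sqr_ge0.
    have [x4|x4] := leP (avg (fun a => x a ^+ 4)) K.
      rewrite (le_trans (urn _ _ _ _ _ _ _ _ pat M0 wd_le def_le x4))// lerDr.
      by rewrite !mulr_ge0// invr_ge0 ltW.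
    apply: (@le_trans _ _ (2 * m)); last first.
      rewrite (le_trans (_ : _ <= 2 * m / K * avg (fun a => x a ^+ 4)))//; last by rewrite lerDl divr_ge0 ?ltW.
      by rewrite -mulrA ler_peMr ?mulr_ge0// ler_pdivlMl// mulr1 ltW.
    rewrite (le_trans (ler_normB _ _))// mulr_natl mulr2n lerD//.
    rewrite (le_trans (norm_avg_le _))// -[leRHS](avg_cst (card_samples (L := L) M0)).
    apply: avg_le => phi; rewrite -(spectral_mean_cst m N0 (As (x \o phi))).
    exact: spectral_mean_norm_le.
  have h1 : 2 * m / K * kappa <= ep / 4.
    rewrite mulrAC ler_pdivrMr// /K mulrDr mulr1 [ep / 4 * _](_ : _ = 2 * m * kappa); last by field; rewrite gt_eqF.
    by rewrite lerDr divr_ge0// ltW.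
  set S := \int[P]_w _ => h2.
  rewrite (_ : c - S = (c - c') + (-1 * S + c')); last by ring.
  by rewrite (le_trans (ler_normD _ _))// lerD//; lra.
apply/ler_addgt0Pr => r r0.
have r2 : 0 < r / 2 by rewrite divr_gt0.
have ep2 : 0 < ep / 2 by rewrite divr_gt0.
have /cvgrPdist_le/(_ _ r2)[M1 _ hM1] := mean_semicircle_cvg cf bf.
pose M := maxn M1 (maxn L (Num.truncn (4 * m * L%:R ^+ 2 / r)).+1).
have M0 : (0 < M)%N by rewrite /M !leq_max !orbT.
have LM : (L <= M)%N by rewrite /M !leq_max leqnn !orbT.
have h2 := step M M0 LM.
have h1 : `|s - \int[P]_w sc (empirical_variance xi M w)| <= r / 2.
  by apply: hM1; rewrite /M /= leq_max leqnn.
move: (\int[P]_w sc (empirical_variance xi M w)) h1 h2 => S h1 h2.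
have h3 : 2 * m * L%:R ^+ 2 / M%:R <= r / 2.
  rewrite ler_pdivrMr ?ltr0n// -ler_pdivrMl//.
  have -> : (r / 2)^-1 * (2 * m * L%:R ^+ 2) = 4 * m * L%:R ^+ 2 / r by field; rewrite gt_eqF.
  by rewrite ltW// (lt_le_trans (truncnS_gt _))// ler_nat /M !leq_max leqnn !orbT.
rewrite (_ : c - s = (c - S) - (s - S)); last by ring.
rewrite (le_trans (ler_normB _ _))//; move: h1 h2 h3; lra.
Qed.

End exchangeable_sampling.

Section band_filling.
Context {d : measure_display} {T : measurableType d} {R : realType}.
Variables (P : probability T R) (xi : nat -> {RV P >-> R}).

(** The enumeration of the free positions on and above the diagonal is extended to
    all positions by symmetry. *)
Lemma band_filling_pattern (dist : nat -> nat -> nat -> nat) (b N wd : nat) (F : T -> 'M[R]_N) :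
  (0 < N)%N -> (forall i j, dist N i j = dist N j i) -> (forall i, (dist N i i <= b)%N) ->
  de_finetti_band dist xi b F ->
  exists (L : nat) (e : 'I_N -> 'I_N -> 'I_L),
    [/\ forall i j, e i j = e j i,
        forall i j k l, near_diag dist b i j -> near_diag dist b k l -> e k l = e i j ->
          ((k == i) && (l == j)) || ((k == j) && (l == i)) &
        forall w, (Num.sqrt wd%:R)^-1 *: F w = pattern_matrix (near_diag dist b) e wd (fun l => xi l w)].
Proof.
move=> N0 dsym ddiag [Fsym F0 [e0 [e0_perm Fe]]].
set B := band dist N b in e0_perm Fe.
pose up (i j : 'I_N) := if (i <= j)%N then (i, j) else (j, i).
have up_sym i j : up i j = up j i.
  rewrite /up; case: ltngtP => // ij.
  by rewrite (val_inj ij : i = j).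
have upB i j : near_diag dist b i j -> up i j \in B.
  rewrite /near_diag /up => ij; case: leqP => h; rewrite inE /= ?h ?ij// dsym ij andbT.
  exact: ltnW.
have e0_inj : {in B &, injective e0}.
  apply/dinjectiveP; rewrite /dinjectiveb (perm_uniq e0_perm); exact: iota_uniq.
have e0_lt p : p \in B -> (e0 p < #|B|)%N.
  move=> pB; have : e0 p \in [seq e0 p | p in B] by apply: map_f; rewrite mem_enum.
  by rewrite (perm_mem e0_perm) mem_iota.
have B0 : (0 < #|B|)%N.
  by apply/card_gt0P; exists (up (Ordinal N0) (Ordinal N0)); apply: upB; exact: ddiag.
(* Off the band the value of the index does not matter; [inord] needs a successor. *)
exists #|B|.-1.+1, (fun i j => inord (e0 (up i j))).
have valE i j : near_diag dist b i j -> (inord (e0 (up i j)) : 'I_(#|B|.-1.+1)) = e0 (up i j) :> nat.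
  by move=> ij; rewrite inordK// prednK//; exact/e0_lt/upB.
split=> [i j|i j k l ij kl /(congr1 val) /=|w].
- by rewrite up_sym.
- rewrite !valE// => /(e0_inj _ _ (upB _ _ kl) (upB _ _ ij)).
  rewrite /up; case: leqP => _; case: leqP => _ [-> ->]; rewrite !eqxx ?orbT//.
- apply/matrixP => i j; rewrite !mxE; case: (boolP (near_diag dist b i j)) => ij; last first.
    by rewrite F0 ?mulr0// ltnNge.
  congr (_ * _); rewrite valE// -(Fe w _ (upB _ _ ij)) /up.
  by case: leqP => //= _; rewrite -[in RHS]Fsym mxE.
Qed.

End band_filling.


Section band_convergence.
Context {d : measure_display} {T : measurableType d} {R : realType}.
Variables (P : probability T R) (xi : nat -> {RV P >-> R}).
Hypotheses (xi_exch : exchangeable xi) (xi_mom : finite_moments xi).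

(** Both ensembles are instances: all that matters is the symmetry of the distance,
    a band with regular rows of bounded degree, and a vanishing deficit. *)
Lemma band_cvg_weakly_in_expectation (dist : nat -> nat -> nat -> nat) (b : nat -> nat)
    (F : forall N, T -> 'M[R]_N) (def : nat -> R) (sigma_mu : probability (measurableTypeR R) R) :
  (forall N, (0 < N)%N -> (b N <= N - 1)%N) -> b N @[N --> \oo] --> \oo ->
  (forall f : R -> R, continuous f -> bounded_fun f ->
     (\int[sigma_mu]_x f x)%:E =
     'E_P[fun w => (\int[semicircle (limiting_variance xi w)]_x f x)%R]%E) ->
  (forall N, de_finetti_band dist xi (b N) (F N)) ->
  (forall N i j, dist N i j = dist N j i) -> (forall N i, dist N i i = 0%N) ->
  def N @[N --> \oo] --> 0 ->
  (forall N (D := near_diag dist (b N) : rel 'I_N), (0 < N)%N ->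
     [/\ forall i, (#|[pred j | D i j]| <= band_width (b N) N)%N,
       N%:R * (1 - def N) * (band_width (b N) N)%:R <= \sum_i (#|[pred j | D i j]|)%:R &
       forall (q : nat) (i k : 'I_N), (k <= i < k + q)%N ->
         (#|[pred j | D i j != D k j]| <= 4 * q)%N]) ->
  cvg_weakly_in_expectation P
    (fun N w => eigenvalue_measure ((Num.sqrt (band_width (b N) N)%:R)^-1 *: F N w))
    (fun=> sigma_mu).
Proof.
move=> b_le b_oo sigmaE F_band dsym ddiag def0 hdist f cf bf.
set s := \int[P]_w (\int[semicircle (limiting_variance xi w)]_x f x)%R.
have /bounded_funP[m hm] := bf.
have sE : ('E_P[fun=> (\int[sigma_mu]_x f x)%R] = s%:E)%E.
  rewrite expectation_cst (sigmaE f cf bf) unlock /s /Rintegral fineK//.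
  apply: integrable_fin_num => //.
  have mV := measurable_limn (measurable_empirical_variance xi).
  have msc := measurable_semicircle_comp cf bf mV.
  by have [] := has_mean_bounded P msc (fun w => semicircle_bound _ cf hm).
rewrite sE; apply/fine_cvgP.
have close (ep : R) : 0 < ep -> \forall N \near \oo,
    exists2 c : R, ('E_P[fun w => (\int[eigenvalue_measure ((Num.sqrt (band_width (b N) N)%:R)^-1 *: F N w)]_x f x)%R] = c%:E)%E &
      `|c - s| <= ep.
  move=> ep0; have [delta delta0 hdelta] := exchangeable_pattern_close xi_exch xi_mom cf bf ep0.
  have /cvgrPdist_le/(_ _ delta0) hdef := def0.
  have hb : \forall N \near \oo, ((Num.truncn delta^-1).+1 <= b N)%N.
    exact: (b_oo _ (nbhs_infty_ge _)).
  near=> N.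
  have N0 : (0 < N)%N by near: N; exact: nbhs_infty_gt.
  have bN : (b N < N)%N by have := b_le N N0; lia.
  have bw : (b N <= band_width (b N) N)%N by rewrite /band_width; lia.
  have bdelta : ((Num.truncn delta^-1).+1 <= b N)%N.
    by near: N; exact: hb.
  have wd0 : (0 < band_width (b N) N)%N by rewrite /band_width; lia.
  have wd_le : (band_width (b N) N)%:R^-1 <= delta.
    rewrite invf_ple ?posrE ?ltr0n// ltW// (lt_le_trans (truncnS_gt _))// ler_nat.
    exact: leq_trans bw.
  have def_le : def N <= delta.
    apply: (le_trans (ler_norm _)); rewrite -normrN -[- _]sub0r; near: N; exact: hdef.
  have [deg deficit reg] := hdist N N0.
  have dN (i : nat) : (dist N i i <= b N)%N by rewrite ddiag.
  have [L [e [es einj FE]]] := band_filling_pattern (band_width (b N) N) N0 (dsym N) dN (F_band N).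
  have pat : band_pattern (near_diag dist (b N) : rel 'I_N) e (band_width (b N) N) (def N).
    split=> //; first by move=> i j; rewrite /near_diag dsym.
    exact: geq_minl.
  have [c [ci cE] cs] := hdelta _ _ _ _ _ _ pat wd_le def_le.
  exists c => //; rewrite unlock -cE /Rintegral fineK; last exact: integrable_fin_num.
  apply: eq_integral => w _; rewrite FE; congr EFin.
  by apply: integral_eigenvalue_measure => //; exact: pattern_matrix_tr pat _.
split.
  have := close 1 ltr01; apply: filterS => N [c -> _] //.
apply/cvgrPdist_le => ep ep0; have := close ep ep0; apply: filterS => N [c /= -> cs].
by rewrite distrC.
Unshelve. all: by end_near. Qed.

End band_convergence.

Theorem theorem25 (R : realType) (d : measure_display) (T : measurableType d)
    (P : probability T R) (b : nat -> nat)
    (b_le : forall N : nat, (0 < N)%N -> (b N <= N - 1)%N)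
    (b_oo : b N @[N --> \oo] --> \oo)
    (xi : nat -> {RV P >-> R})
    (xi_exch : exchangeable xi)
    (xi_mom : finite_moments xi)
    (F Fper : forall N : nat, T -> 'M[R]_N)
    (F_strict : forall N : nat, de_finetti_band strict_dist xi (b N) (F N))
    (F_periodic : forall N : nat,
       de_finetti_band periodic_dist xi (b N) (Fper N))
    (sigma_mu : probability (measurableTypeR R) R)
    (sigma_muE : forall f : R -> R, continuous f -> bounded_fun f ->
       (\int[sigma_mu]_x f x)%:E =
       'E_P[fun w => (\int[semicircle (limiting_variance xi w)]_x f x)%R]%E) :
  cvg_weakly_in_expectation P
    (fun N w => eigenvalue_measure
       ((Num.sqrt (band_width (b N) N)%:R)^-1 *: Fper N w))
    (fun=> sigma_mu)
  /\
  (((b N)%:R / N%:R @[N --> \oo] --> (0 : R)) \/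
   ((b N)%:R / N%:R @[N --> \oo] --> (1 : R)) ->
   cvg_weakly_in_expectation P
     (fun N w => eigenvalue_measure
        ((Num.sqrt (band_width (b N) N)%:R)^-1 *: F N w))
     (fun=> sigma_mu)).

Proof.
have lt_b N : (0 < N)%N -> (b N < N)%N by move=> N0; have := b_le N N0; lia.
split.
  apply: (band_cvg_weakly_in_expectation xi_exch xi_mom (def := fun=> 0) b_le b_oo sigma_muE F_periodic).
  - exact: periodic_dist_sym.
  - by move=> N i; rewrite /periodic_dist strict_distE maxnn minnn subnn min0n.
  - exact: cvg_cst.
  - move=> N D N0; split=> [i||q i k].
    + by rewrite periodic_degree ?lt_b.
    + exact/periodic_deficit/lt_b.
    + exact/periodic_regular/lt_b.
move=> bN.
have strict (def : nat -> R) : def N @[N --> \oo] --> 0 ->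
    (forall N, (0 < N)%N -> N%:R * (1 - def N) * (band_width (b N) N)%:R <=
      \sum_(i < N) (#|[pred j | near_diag strict_dist (b N) i j]|)%:R :> R) ->
    cvg_weakly_in_expectation P
      (fun N w => eigenvalue_measure ((Num.sqrt (band_width (b N) N)%:R)^-1 *: F N w))
      (fun=> sigma_mu).
  move=> def0 hdef.
  apply: (band_cvg_weakly_in_expectation xi_exch xi_mom (def := def) b_le b_oo sigma_muE F_strict) => //.
  - exact: strict_dist_sym.
  - by move=> N i; rewrite strict_distE maxnn minnn subnn.
  - move=> N D N0; split=> [i||q i k]; [exact: strict_degree_le|exact: hdef|exact: strict_regular].
case: bN => bN.
  apply: (strict (fun N => 2 * ((b N)%:R / N%:R))) => [|N N0].
    by rewrite -[X in _ --> X](mulr0 2); apply: cvgM; [exact: cvg_cst|exact: bN].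
  by apply: strict_deficit_narrow => //; exact: lt_b.
apply: (strict (fun N => 1 - (b N)%:R / N%:R)) => [|N N0].
  by rewrite -[X in _ --> X](subrr 1); apply: cvgB; [exact: cvg_cst|exact: bN].
by apply: strict_deficit_wide => //; exact: lt_b.
Qed.
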